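(* Let $\alpha\in(\tfrac12,1)$, $\eta_0<\tfrac12$, $\eta_t=\eta_0t^{-\alpha}$, and assume $\Gamma$ is positive definite. Then, with probability at least $1-3T^{-1/3}-\frac{\sqrt{\mathrm{Tr}(\Gamma)}}{\lambda_0(1-\gamma)\sqrt T}$, $$d_{\mathsf{TV}}\big(\mathcal N(0,\widehat\Lambda_T),\mathcal N(0,\Lambda^\star)\big)\lesssim \frac{\sqrt{\mathrm{Tr}(\Gamma)}}{\lambda_0(1-\gamma)}\,(\|\theta^\star\|_2+1)\,\|\Gamma^{-1}\|\,T^{-1/3}+o(T^{-1/3}),$$ where the $o(T^{-1/3})$ term may depend on all problem parameters (including $\alpha$) but is of smaller order than $T^{-1/3}$ as a function of $T$.
   Context: Setting: $\mathcal S$ is a finite state space, $\gamma\in[0,1)$ a discount factor, $P(\cdot\mid s)$ a Markov transition kernel on $\mathcal S$ (induced by a fixed policy) with unique stationary distribution $\mu$, and $r:\mathcal S\to[0,1]$ the expected reward. A feature map $\phi:\mathcal S\to\mathbb R^d$ satisfies $\|\phi(s)\|_2\le1$ for all $s$. Define $A=\mathbb E_{s\sim\mu,s'\sim P(\cdot\mid s)}[\phi(s)(\phi(s)-\gamma\phi(s'))^\top]$, $b=\mathbb E_{s\sim\mu}[\phi(s)r(s)]$, $\Sigma=\mathbb E_{s\sim\mu}[\phi(s)\phi(s)^\top]$, $\lambda_0=\lambda_{\min}(\Sigma)$ (assumed $>0$), $\lambda_\Sigma=\lambda_{\max}(\Sigma)$, $\theta^\star=A^{-1}b$. Samples: $(s_t,s_t',r_t)$,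 $t=1,2,\dots$, are i.i.d. with $s_t\sim\mu$, $s_t'\sim P(\cdot\mid s_t)$, $r_t\in[0,1]$ with $\mathbb E[r_t\mid s_t]=r(s_t)$; set $A_t=\phi(s_t)(\phi(s_t)-\gamma\phi(s_t'))^\top$, $b_t=r_t\phi(s_t)$. TD iterates: $\theta_0=0$, $\theta_t=\theta_{t-1}-\eta_t(A_t\theta_{t-1}-b_t)$; $\Delta_t=\theta_t-\theta^\star$, $\bar\theta_T=\frac1T\sum_{t=1}^T\theta_t$, $\bar\Delta_T=\bar\theta_T-\theta^\star$. Let $\Gamma=\mathbb E[(A_t\theta^\star-b_t)(A_t\theta^\star-b_t)^\top]$ and $\Lambda^\star=A^{-1}\Gamma A^{-\top}$. Plug-in estimator: $\bar A_T=\frac1T\sum_{t=1}^TA_t$, $\widehat\Gamma_T=\frac1T\sum_{t=1}^T(A_t\bar\theta_T-b_t)(A_t\bar\theta_T-b_t)^\top$, $\widehat\Lambda_T=\bar A_T^{-1}\widehat\Gamma_T\bar A_T^{-\top}$. $d_{\mathsf{TV}}$ is total variation distance; $\|\cdot\|$ is the spectral norm. The symbol $\lesssim$ means inequality up to a universal constant. *)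

(* Defs.v *)
From HB Require Import structures.
From mathcomp Require Import all_boot all_order all_algebra.
From mathcomp Require Import all_classical all_reals all_analysis.
Set Implicit Arguments. Unset Strict Implicit. Unset Printing Implicit Defensive.
Import Order.TTheory GRing.Theory Num.Theory.
Import numFieldNormedType.Exports.
Local Open Scope classical_set_scope.
Local Open Scope ring_scope.

Section Defs.
Variable R : realType.

Definition l2norm (n : nat) (v : 'cV[R]_n) : R :=
  Num.sqrt (\sum_(i < n) v i 0 ^+ 2).

Definition opnorm (m n : nat) (M : 'M[R]_(m, n)) : R :=
  sup [set l2norm (M *m x) | x in [set x : 'cV[R]_n | l2norm x <= 1]].

Definition posdef (n : nat) (M : 'M[R]_n) : Prop :=
  forall x : 'cV[R]_n, x != 0 -> 0 < (x^T *m M *m x) 0 0.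

Definition is_lambda_min (n : nat) (M : 'M[R]_n) (l : R) : Prop :=
  eigenvalue M l /\ forall a, eigenvalue M a -> l <= a.

Fixpoint iter_gauss (n : nat) (g : (nat -> R) -> \bar R) : \bar R :=
  match n with
  | 0 => g (fun _ => 0)
  | n'.+1 => (\int[@lebesgue_measure R]_x
               ((normal_pdf 0 1 x)%:E *
                 iter_gauss n' (fun z => g (fun i => if i == n' then x else z i))))%E
  end.

Definition tuple_of_cV (n : nat) (v : 'cV[R]_n) : n.-tuple R :=
  [tuple v i 0 | i < n].

(* law of L z with z ~ N(0, I_n): this is N(0, L L^T) *)
Definition gauss_lin (n : nat) (L : 'M[R]_n) (A : set (n.-tuple R)) : \bar R :=
  iter_gauss n (fun z => (\1_A (tuple_of_cV (L *m \col_(i < n) z i)))%:E).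

(* a factor L with L L^T = S (exists for S positive semidefinite);
   the Gaussian law does not depend on the choice *)
Definition cov_factor (n : nat) (S : 'M[R]_n) : 'M[R]_n :=
  xget 0 [set L : 'M[R]_n | L *m L^T = S].

Definition gauss (n : nat) (S : 'M[R]_n) : set (n.-tuple R) -> \bar R :=
  gauss_lin (cov_factor S).

Definition dTV_gauss (n : nat) (S1 S2 : 'M[R]_n) : \bar R :=
  ereal_sup [set `|(gauss S1 A - gauss S2 A)%E|%E
            | A in [set A : set (n.-tuple R) | measurable A]].

Variables (S : finType) (d : nat).

Definition is_kernel (P : S -> S -> R) : Prop :=
  (forall x y, 0 <= P x y) /\ (forall x, \sum_y P x y = 1).

Definition is_distr (nu : S -> R) : Prop :=
  (forall x, 0 <= nu x) /\ \sum_x nu x = 1.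

Definition is_stationary (P : S -> S -> R) (nu : S -> R) : Prop :=
  is_distr nu /\ forall y, \sum_x nu x * P x y = nu y.

Definition unique_stationary (P : S -> S -> R) (mu : S -> R) : Prop :=
  is_stationary P mu /\ forall nu, is_stationary P nu -> nu = mu.

Definition Amat (gamma : R) (P : S -> S -> R) (mu : S -> R)
  (phi : S -> 'cV[R]_d) : 'M[R]_d :=
  \sum_x \sum_y (mu x * P x y) *: (phi x *m (phi x - gamma *: phi y)^T).

Definition bvec (mu r : S -> R) (phi : S -> 'cV[R]_d) : 'cV[R]_d :=
  \sum_x (mu x * r x) *: phi x.

Definition Sigmat (mu : S -> R) (phi : S -> 'cV[R]_d) : 'M[R]_d :=
  \sum_x mu x *: (phi x *m (phi x)^T).

Definition At (gamma : R) (phi : S -> 'cV[R]_d) (s s' : S) : 'M[R]_d :=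
  phi s *m (phi s - gamma *: phi s')^T.

Definition bt (phi : S -> 'cV[R]_d) (s : S) (rw : R) : 'cV[R]_d :=
  rw *: phi s.

Fixpoint td_iter (eta : nat -> R) (A : nat -> 'M[R]_d) (b : nat -> 'cV[R]_d)
  (t : nat) : 'cV[R]_d :=
  match t with
  | 0 => 0
  | t'.+1 => td_iter eta A b t' - eta t'.+1 *: (A t'.+1 *m td_iter eta A b t' - b t'.+1)
  end.

Definition avg_iter (eta : nat -> R) (A : nat -> 'M[R]_d) (b : nat -> 'cV[R]_d)
  (T : nat) : 'cV[R]_d :=
  T%:R^-1 *: \sum_(1 <= t < T.+1) td_iter eta A b t.

Definition Abar (A : nat -> 'M[R]_d) (T : nat) : 'M[R]_d :=
  T%:R^-1 *: \sum_(1 <= t < T.+1) A t.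

Definition Gammahat (A : nat -> 'M[R]_d) (b : nat -> 'cV[R]_d) (th : 'cV[R]_d)
  (T : nat) : 'M[R]_d :=
  T%:R^-1 *: \sum_(1 <= t < T.+1) ((A t *m th - b t) *m (A t *m th - b t)^T).

Definition Lambdahat (A : nat -> 'M[R]_d) (b : nat -> 'cV[R]_d) (th : 'cV[R]_d)
  (T : nat) : 'M[R]_d :=
  invmx (Abar A T) *m Gammahat A b th T *m (invmx (Abar A T))^T.

End Defs.

Section Sampling.
Context {dO : measure_display} {Om : measurableType dO} {R : realType}.
Variable (Pr : probability Om R) (S : finType).
Variables (s s' : nat -> Om -> S) (rw : nat -> Om -> R).

Definition sample_event (t : nat) (X X' : {set S}) (B : set R) : set Om :=
  [set w | s t w \in X /\ s' t w \in X' /\ B (rw t w)].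

Definition samples_independent : Prop :=
  forall (ts : seq nat) (X X' : nat -> {set S}) (B : nat -> set R),
    uniq ts -> all (fun t => 0 < t)%N ts -> (forall t, measurable (B t)) ->
    fine (Pr (\bigcap_(t in [set` ts]) sample_event t (X t) (X' t) (B t)))
    = \prod_(t <- ts) fine (Pr (sample_event t (X t) (X' t) (B t))).

Definition samples_ident_distr : Prop :=
  forall t (X X' : {set S}) (B : set R), (0 < t)%N -> measurable B ->
    Pr (sample_event t X X' B) = Pr (sample_event 1 X X' B).

Definition samples_measurable : Prop :=
  forall t, (forall x, measurable [set w | s t w = x]) /\
            (forall x, measurable [set w | s' t w = x]) /\
            measurable_fun setT (rw t).

(* s_t ~ mu, s'_t ~ P(.|s_t), r_t in [0,1], E[r_t | s_t] = r(s_t) *)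
Definition samples_law (P : S -> S -> R) (mu r : S -> R) : Prop :=
  forall t, (0 < t)%N ->
    (forall x y, fine (Pr [set w | s t w = x /\ s' t w = y]) = mu x * P x y) /\
    (forall w, 0 <= rw t w <= 1) /\
    (forall x, ('E_Pr[fun w => (rw t w * (s t w == x)%:R)%R] = (r x * mu x)%:E)%E).

End Sampling.

(* Main.v *)
Require Import Defs.
From HB Require Import structures.
From mathcomp Require Import all_boot all_order all_algebra.
From mathcomp Require Import all_classical all_reals all_analysis.
From mathcomp Require Import measurable_realfun ring lra.
Set Implicit Arguments. Unset Strict Implicit. Unset Printing Implicit Defensive.
Import Order.TTheory GRing.Theory Num.Theory.
Import numFieldNormedType.Exports.
Local Open Scope classical_set_scope.
Local Open Scope ring_scope.

(** Since the o-term may depend on the problem, it suffices to find an exponent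
kappa > 1/3 such that, outside an event of probability at most T^(-1/3), the
distance is at most c * T^(-kappa) with c depending on the problem; we take
kappa = 1/2 - alpha/6.

Gaussian side: linear changes of variables in iterated Lebesgue integrals (by
pivoting into shears, translations and scalings) show that the law of [L z] has
a density depending only on [L *m L^T]. If two covariances S1, S2 satisfy
S1 <= s^2 S2 and S2 <= s^2 S1 as quadratic forms, then each density is at most
s^(2n) times that of the law dilated by s, and comparing masses gives a total
variation distance at most s^(2n) - 1. Hence the distance between N(0, S) and
N(0, Lambda) is Lipschitz in S near a positive definite Lambda.

Stochastic side: the i.i.d. averages of A_t, of the noise e_t = A_t theta* - b_t
and of e_t e_t^T have fourth central moments O(T^-2), so Markov's inequality
bounds their deviations by O(T^(-kappa)). Writing
A Delta_t = (Delta_t - Delta_(t+1)) / eta_(t+1) - e_(t+1) - (A_(t+1) - A) Delta_t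
and averaging, the mean error is -A^-1 times the mean noise plus a boundary term
(summation by parts) and a martingale; E |Delta_t|^2 = O(eta_t) bounds the second
moment of the last two by O(T^(alpha/3 - 4/3)). *)

(** * Iterated Lebesgue integrals over column vectors *)

Section LebesgueIterated.
Context {R : realType}.
Local Notation mu := (@lebesgue_measure R).

(** The exponent [kappa] balances two failure probabilities. At scale [T^(-kappa)], Chebyshev's
    inequality for the remainder costs [T^(2 kappa + alpha/3 - 4/3)], which is [T^(-1/3)]. For an
    i.i.d. average it would cost [T^(2 kappa - 1)], that is [T^(-alpha/3)], too much when
    [alpha < 1]; the fourth moment costs only [T^(4 kappa - 2)], that is [T^(-2 alpha/3)], which
    suffices as soon as [alpha >= 1/2]. The condition [kappa > 1/3] amounts to [alpha < 1]. Two
    encodings shape the rest. The Gaussian law is an iterated one-dimensional integral, so changes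
    of variables are built on such integrals, for nonnegative integrands. Independence of the
    samples is a product formula for rectangle events; random variables are therefore approximated
    uniformly by linear combinations of rectangle indicators, which is enough because the state
    space is finite and the rewards are bounded. *)

Fixpoint lint (n : nat) : ('cV[R]_n -> \bar R) -> \bar R :=
  match n with
  | 0 => fun H => H 0
  | n'.+1 => fun H => (\int[mu]_x lint (fun v : 'cV_n' => H (col_mx x%:M v)))%E
  end.

(* Matrices carry no sigma-algebra: joint measurability is expressed by testing
   against all coordinatewise measurable substitutions. *)
Definition jmeas d (T : measurableType d) n (F : T -> 'cV[R]_n -> \bar R) :=
  forall d' (T' : measurableType d') (tau : T' -> T) (c : T' -> 'cV[R]_n),
    measurable_fun setT tau ->
    (forall i, measurable_fun setT (fun t => c t i 0)) ->
    measurable_fun setT (fun t => F (tau t) (c t)).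

Definition cmeas n (H : 'cV[R]_n -> \bar R) :=
  forall d' (T' : measurableType d') (c : T' -> 'cV[R]_n),
    (forall i, measurable_fun setT (fun t => c t i 0)) ->
    measurable_fun setT (fun t => H (c t)).

Lemma measurable_col_mx d (T : measurableType d) n (f : T -> R)
    (c : T -> 'cV[R]_n) :
  measurable_fun setT f -> (forall i, measurable_fun setT (fun t => c t i 0)) ->
  forall i : 'I_(1 + n),
    measurable_fun setT (fun t => col_mx ((f t)%:M : 'M[R]_1) (c t) i 0).
Proof.
move=> mf mc i; rewrite -(splitK i); case: (fintype.split i) => j /=.
  rewrite (_ : (fun t => _) = f) //; apply/funext => t.
  by rewrite col_mxEu mxE (ord1 j) eqxx mulr1n.
rewrite (_ : (fun t => _) = (fun t => c t j 0)) //; apply/funext => t.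
by rewrite col_mxEd.
Qed.

Lemma jmeas_slice d (T : measurableType d) n (F : T -> 'cV[R]_n.+1 -> \bar R) :
  jmeas F ->
  jmeas (fun (p : (T * measurableTypeR R)%type) (v : 'cV_n) =>
           F p.1 (col_mx (p.2%:M : 'M[R]_1) v)).
Proof.
move=> mF d' T' tau c mtau mc.
apply: (mF _ _ (fun t => (tau t).1) (fun t => col_mx ((tau t).2%:M : 'M[R]_1) (c t))).
  exact: measurableT_comp.
apply: (measurable_col_mx _ mc).
exact: (measurableT_comp measurable_snd mtau).
Qed.

Lemma lint_ge0 n (H : 'cV[R]_n -> \bar R) :
  (forall v, 0 <= H v)%E -> (0 <= lint H)%E.
Proof. by elim: n H => [|n IH] H H0 //=; apply: integral_ge0 => x _; exact: IH. Qed.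

Lemma eq_lint n (H K : 'cV[R]_n -> \bar R) : H =1 K -> lint H = lint K.
Proof. by move=> /funext ->. Qed.

(** The induction runs over all parameter spaces at once: slicing moves the first coordinate of the
    vector into the parameter, so that [T] becomes its product with the real line. *)
Lemma measurable_lint d (T : measurableType d) n (F : T -> 'cV[R]_n -> \bar R) :
  jmeas F -> (forall t v, 0 <= F t v)%E ->
  measurable_fun setT (fun t => lint (F t)).
Proof.
elim: n d T F => [|n IH] d T F mF F0 /=.
  by apply: (mF _ _ id (fun=> 0)) => // i; under eq_fun do rewrite mxE.
have := @measurable_fun_fubini_tonelli_F _ _ T (measurableTypeR R) R mu
  (fun p : T * measurableTypeR R =>
     lint (fun v : 'cV_n => F p.1 (col_mx (p.2%:M : 'M[R]_1) v))).
apply.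
  by apply: IH => //; exact: jmeas_slice.
by move=> x; apply: lint_ge0.
Qed.

Lemma measurable_lint_slice n (H : 'cV[R]_n.+1 -> \bar R) :
  cmeas H -> (forall v, 0 <= H v)%E ->
  measurable_fun setT
    (fun x : R => lint (fun v : 'cV_n => H (col_mx (x%:M : 'M[R]_1) v))).
Proof.
move=> mH H0; apply: (@measurable_lint _ (measurableTypeR R)) => // d' T' tau c mt mc.
by apply: mH; exact: measurable_col_mx.
Qed.

Lemma cmeas_slice n (H : 'cV[R]_n.+1 -> \bar R) (x : R) :
  cmeas H -> cmeas (fun v : 'cV_n => H (col_mx (x%:M : 'M[R]_1) v)).
Proof.
by move=> mH d T c mc; apply: mH; apply: (measurable_col_mx (f := fun=> x)).
Qed.

Lemma le_lint n (H K : 'cV[R]_n -> \bar R) :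
  cmeas H -> cmeas K -> (forall v, 0 <= H v)%E -> (forall v, H v <= K v)%E ->
  (lint H <= lint K)%E.
Proof.
elim: n H K => [|n IH] H K mH mK H0 HK //=.
have K0 v : (0 <= K v)%E by exact: le_trans (HK v).
apply: ge0_le_integral => //.
- by move=> x _; exact: lint_ge0.
- exact: measurable_lint_slice.
- exact: measurable_lint_slice.
- by move=> x _; apply: IH => //; exact: cmeas_slice.
Qed.

Lemma lintZ n (k : R) (H : 'cV[R]_n -> \bar R) :
  0 <= k -> cmeas H -> (forall v, 0 <= H v)%E ->
  lint (fun v => k%:E * H v)%E = (k%:E * lint H)%E.
Proof.
move=> k0; elim: n H => [|n IH] H mH H0 //=.
under eq_integral => x _ do rewrite (IH _ (cmeas_slice x mH))//.
rewrite ge0_integralZl//; first exact: measurable_lint_slice.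
by move=> x _; exact: lint_ge0.
Qed.

Lemma lintD n (H K : 'cV[R]_n -> \bar R) :
  cmeas H -> cmeas K -> (forall v, 0 <= H v)%E -> (forall v, 0 <= K v)%E ->
  lint (fun v => H v + K v)%E = (lint H + lint K)%E.
Proof.
elim: n H K => [|n IH] H K mH mK H0 K0 //=.
under eq_integral => x _ do
  rewrite (IH _ _ (cmeas_slice x mH) (cmeas_slice x mK))//.
rewrite ge0_integralD//; try exact: measurable_lint_slice.
- by move=> x _; exact: lint_ge0.
- by move=> x _; exact: lint_ge0.
Qed.

(** The outer variable moves inwards past one coordinate at a time, each time by Tonelli in two
    variables with the remaining coordinates already integrated. *)
Lemma lint_fubini n (F : R -> 'cV[R]_n -> \bar R) :
  @jmeas _ (measurableTypeR R) n F -> (forall x v, 0 <= F x v)%E ->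
  (\int[mu]_x lint (F x))%E = lint (fun v => \int[mu]_x F x v)%E.
Proof.
elim: n F => [|n IH] F mF F0 //=.
rewrite (@fubini_tonelli _ _ (measurableTypeR R) (measurableTypeR R) R mu mu
  (fun p => lint (fun v : 'cV_n => F p.1 (col_mx (p.2%:M : 'M[R]_1) v)))).
- apply: eq_integral => y _; rewrite /fubini_G /=.
  apply: IH => // d' T' tau c mtau mc.
  by apply: mF => //; apply: (measurable_col_mx (f := fun=> y)).
- by apply: measurable_lint => //; exact: jmeas_slice.
- by move=> p; exact: lint_ge0.
Qed.

Lemma lebesgue_measure_translate (a : R) (A : set R) : measurable A ->
  pushforward mu ((fun x => x + a) : _ -> measurableTypeR R) A = mu A.
Proof.
move=> mA; have mf : measurable_fun setT (fun x : R => x + a).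
  exact: measurable_funD.
apply/esym/lebesgue_measure_unique => //= _ [[b c]] _ <-.
rewrite /pushforward /=.
have -> : (fun x => x + a) @^-1` `]b, c] = `]b - a, c - a]%classic.
  apply/seteqP; split => x /=; rewrite !in_itv /= ltrBlDr lerBrDr//.
by rewrite !lebesgue_measure_itv/= !lte_fin ltrD2r -!EFinB opprB addrA subrK.
Qed.

Lemma integral_translate (a : R) (f : R -> \bar R) :
  measurable_fun setT f -> (forall x, 0 <= f x)%E ->
  (\int[mu]_x f (x + a)%R = \int[mu]_x f x)%E.
Proof.
move=> mf f0.
have ma : measurable_fun setT ((fun x => x + a) : R -> measurableTypeR R).
  exact: measurable_funD.
rewrite -[LHS](@ge0_integral_pushforward _ _ (measurableTypeR R) (measurableTypeR R) R _ ma mu setT f)//=.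
by apply: eq_measure_integral => //= A mA _; exact: lebesgue_measure_translate.
Qed.

Lemma lebesgue_measure_scale (k : R) (A : set R) : 0 < k -> measurable A ->
  pushforward mu ((fun x => k * x) : _ -> measurableTypeR R) A = (k^-1%:E * mu A)%E.
Proof.
move=> k0 mA; have mf : measurable_fun setT (fun x : R => k * x).
  exact: measurable_funM.
pose k' : {nonneg R} := NngNum (ltW k0).
suff -> : mu A = pushforward (mscale k' mu) ((fun x => k * x) : _ -> measurableTypeR R) A.
  by rewrite /pushforward /mscale /= muleA -EFinM mulVf ?gt_eqF// mul1e.
apply: lebesgue_measure_unique => //= _ [[b c]] _ <-.
rewrite /mscale /pushforward /=.
have -> : (fun x => k * x) @^-1` `]b, c] = `]k^-1 * b, k^-1 * c]%classic.
  by apply/seteqP; split => x /=; rewrite !in_itv /= ltr_pdivrMl// ler_pdivlMl.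
rewrite !lebesgue_measure_itv/= !lte_fin ltr_pM2l ?invr_gt0//.
by case: ifP => // _; rewrite ?mule0 // -!EFinB -EFinM -mulrBr mulVKf ?gt_eqF.
Qed.

Lemma integral_scale (k : R) (f : R -> \bar R) : 0 < k ->
  measurable_fun setT f -> (forall x, 0 <= f x)%E ->
  (\int[mu]_x f (k * x)%R = k^-1%:E * \int[mu]_x f x)%E.
Proof.
move=> k0 mf f0.
have mk : measurable_fun setT ((fun x => k * x) : R -> measurableTypeR R).
  exact: measurable_funM.
rewrite -[LHS](@ge0_integral_pushforward _ _ (measurableTypeR R) (measurableTypeR R) R _ mk mu setT f)//=.
have ki : 0 <= k^-1 by rewrite invr_ge0 ltW.
rewrite -(@ge0_integral_mscale _ (measurableTypeR R) R mu setT _ (NngNum ki) f)//.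
by apply: eq_measure_integral => //= A mA _; rewrite lebesgue_measure_scale.
Qed.

Lemma integral_reflect (f : R -> \bar R) :
  measurable_fun setT f -> (forall x, 0 <= f x)%E ->
  (\int[mu]_x f (- x)%R = \int[mu]_x f x)%E.
Proof.
move=> mf f0.
have mk : measurable_fun setT (-%R : R -> measurableTypeR R) by [].
rewrite -[LHS](@ge0_integral_pushforward _ _ (measurableTypeR R) (measurableTypeR R) R _ mk mu setT f)//=.
by apply: eq_measure_integral => //= A mA _; exact: lebesgue_measureN.
Qed.

End LebesgueIterated.

(** * Linear changes of variables *)

Section ChangeOfVariables.
Context {R : realType}.
Local Notation mu := (@lebesgue_measure R).

Lemma cmeas_affine n m (H : 'cV[R]_n -> \bar R) (M : 'M[R]_(n, m)) (a : 'cV[R]_n) :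
  cmeas H -> cmeas (fun v => H (M *m v + a)).
Proof.
move=> mH d T c mc; apply: mH => i.
rewrite (_ : (fun t => _) = (fun t => \sum_j M i j * c t j 0 + a i 0)).
  apply: measurable_funD => //; apply: measurable_sum => j.
  exact: measurable_funM.
by apply/funext => t; rewrite !mxE.
Qed.

Lemma cmeas_mulmx n m (H : 'cV[R]_n -> \bar R) (M : 'M[R]_(n, m)) :
  cmeas H -> cmeas (fun v => H (M *m v)).
Proof.
move=> mH; rewrite (_ : (fun v => _) = (fun v => H (M *m v + 0))).
  exact: cmeas_affine.
by apply/funext => v; rewrite addr0.
Qed.

Lemma lint_translate n (a : 'cV[R]_n) (H : 'cV[R]_n -> \bar R) :
  cmeas H -> (forall v, 0 <= H v)%E -> lint (fun v => H (v + a)) = lint H.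
Proof.
elim: n a H => [|n IH] a H mH H0 /=; first by rewrite [0 + a]flatmx0.
pose a1 := (a : 'cV_(1 + n)) 0 0; pose a2 := dsubmx (a : 'cV_(1 + n)).
have aE : a = col_mx (a1%:M : 'M[R]_1) a2 :> 'cV_(1 + n).
  apply: etrans (esym (@vsubmxK _ 1 n 1 a)) _; congr col_mx; apply/matrixP => i j.
  by rewrite !ord1 !mxE /= mulr1n /a1; congr (_ _ _); apply/val_inj.
transitivity (\int[mu]_x lint (fun v : 'cV_n =>
    H (col_mx ((x + a1)%:M : 'M[R]_1) v)))%E.
  apply: eq_integral => x _.
  rewrite -[RHS](IH a2) ?cmeas_slice//; last exact: cmeas_slice.
  apply: eq_lint => v; congr H.
  by rewrite {1}aE [LHS](@add_col_mx _ 1 n 1) -raddfD.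
apply: (integral_translate a1
  (f := fun x => lint (fun v : 'cV_n => H (col_mx (x%:M : 'M[R]_1) v)))).
- exact: measurable_lint_slice.
- by move=> x; exact: lint_ge0.
Qed.

Lemma measurable_comp_mulr (F : R -> \bar R) (k : R) :
  measurable_fun setT F -> measurable_fun setT (fun x : R => F (k * x)).
Proof.
move=> mF; have mk : measurable_fun setT (fun x : R => k * x).
  exact: measurable_funM.
exact: (measurableT_comp (f := F) mF mk).
Qed.

Lemma lint_scale n (k : R) (H : 'cV[R]_n -> \bar R) : 0 < k ->
  cmeas H -> (forall v, 0 <= H v)%E ->
  lint (fun v => H (k *: v)) = ((k ^- n)%:E * lint H)%E.
Proof.
move=> k0; elim: n H => [|n IH] H mH H0 /=.
  by rewrite expr0 invr1 mul1e scaler0.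
transitivity (\int[mu]_x ((k ^- n)%:E * lint (fun v : 'cV_n =>
    H (col_mx ((k * x)%:M : 'M[R]_1) v))))%E.
  apply: eq_integral => x _; rewrite -IH//; last exact: cmeas_slice.
  by apply: eq_lint => v; congr H; rewrite [LHS](@scale_col_mx _ 1 n 1) scale_scalar_mx.
have kn : 0 <= k ^- n by rewrite invr_ge0 exprn_ge0// ltW.
have mS := measurable_lint_slice mH H0.
rewrite ge0_integralZl//; first last.
- by move=> x _; exact: lint_ge0.
- exact: (measurable_comp_mulr k mS).
rewrite (integral_scale (f := fun x => lint (fun v : 'cV_n =>
    H (col_mx (x%:M : 'M[R]_1) v)))) //; last by move=> x; exact: lint_ge0.
by rewrite muleA -EFinM exprSr invfM mulrC.
Qed.

(** The constant is [1 / |det M|], but it is left unspecified: the moduli are compared later through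
    total masses. *)
Definition lin_cov n (M : 'M[R]_n) := exists2 c : R, 0 < c &
  forall H : 'cV[R]_n -> \bar R, cmeas H -> (forall v, 0 <= H v)%E ->
    lint (fun v => H (M *m v)) = (c%:E * lint H)%E.

Lemma lin_covM n (M N : 'M[R]_n) : lin_cov M -> lin_cov N -> lin_cov (M *m N).
Proof.
move=> [c c0 cM] [d d0 dN]; exists (d * c); first exact: mulr_gt0.
move=> H mH H0; rewrite EFinM -muleA -cM//.
rewrite -(dN (fun v => H (M *m v)))//; last exact: cmeas_mulmx.
by apply: eq_lint => v; rewrite mulmxA.
Qed.

(** For a fixed first coordinate [x], this shear translates the inner variables by [x *: u]. *)
Lemma lin_cov_lower n (u : 'cV[R]_n) :
  lin_cov (block_mx 1%:M 0 u 1%:M : 'M[R]_(1 + n)).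
Proof.
exists 1 => // H mH H0; rewrite mul1e /=; apply: eq_integral => x _.
rewrite -[RHS](lint_translate (x *: u)) //; last exact: cmeas_slice.
apply: eq_lint => v; congr H.
by rewrite [LHS](@mul_block_col _ 1 n 1 n 1) !mul1mx mul0mx addr0 mul_mx_scalar addrC.
Qed.

Lemma jmeas_slice1 n (H : 'cV[R]_n.+1 -> \bar R) : cmeas H ->
  @jmeas R _ (measurableTypeR R) n (fun x v => H (col_mx (x%:M : 'M[R]_1) v)).
Proof. by move=> mH d T tau c mt mc; apply: mH; exact: measurable_col_mx. Qed.

(** Once the first coordinate is integrated innermost, this shear translates it by [w *m v]. *)
Lemma lin_cov_upper n (w : 'rV[R]_n) :
  lin_cov (block_mx 1%:M w 0 1%:M : 'M[R]_(1 + n)).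
Proof.
exists 1 => // H mH H0; rewrite mul1e /=.
rewrite !(lint_fubini (F := fun x v => H (col_mx (x%:M : 'M[R]_1) v))) //;
  last exact: jmeas_slice1.
rewrite (lint_fubini (F := fun x v =>
  H ((block_mx 1%:M w 0 1%:M : 'M[R]_(1 + n)) *m col_mx (x%:M : 'M[R]_1) v))) //;
  last exact/(@jmeas_slice1 _ (fun v => H (_ *m v)))/cmeas_mulmx.
apply: eq_lint => v; rewrite -[RHS](integral_translate ((w *m v) 0 0)) //.
  apply: eq_integral => x _; congr H.
  rewrite [LHS](@mul_block_col _ 1 n 1 n 1) !mul1mx mul0mx add0r; congr col_mx.
  by apply/matrixP => i j; rewrite !ord1 !mxE !mulr1n.
apply: mH; apply: (measurable_col_mx (c := fun=> v)) => //.
Qed.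

Lemma lin_cov_diag n (k : R) (M : 'M[R]_n) : k != 0 -> lin_cov M ->
  lin_cov (block_mx k%:M 0 0 M : 'M[R]_(1 + n)).
Proof.
move=> k0 [c c0 cM].
exists (c * `|k|^-1); first by rewrite mulr_gt0// invr_gt0 normr_gt0.
move=> H mH H0 /=; pose F x := lint (fun v : 'cV_n => H (col_mx (x%:M : 'M[R]_1) v)).
have mF : measurable_fun setT F by exact: measurable_lint_slice.
have F0 x : (0 <= F x)%E by exact: lint_ge0.
transitivity (\int[mu]_x (c%:E * F (k * x)%R))%E.
  apply: eq_integral => x _; rewrite /F -cM//; last exact: cmeas_slice.
  apply: eq_lint => v; congr H.
  by rewrite [LHS](@mul_block_col _ 1 n 1 n 1) !mul0mx addr0 add0r mul_scalar_mx scale_scalar_mx.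
rewrite ge0_integralZl//; first last.
- exact: ltW.
- exact: (measurable_comp_mulr k mF).
rewrite EFinM -muleA; congr (_ * _)%E.
have [kp|kn|kE] := ltgtP k 0; last by rewrite kE eqxx in k0.
  rewrite -(integral_reflect (f := fun x => F (k * x))) //; last first.
    exact: (measurable_comp_mulr k mF).
  under eq_integral do rewrite mulrN -mulNr.
  by rewrite (integral_scale (f := F)) ?oppr_gt0// ltr0_norm.
by rewrite (integral_scale (f := F))// gtr0_norm.
Qed.

(** Gaussian elimination by blocks. A nonzero corner entry gives a lower shear, a block diagonal
    matrix and an upper shear; if the corner vanishes, invertibility provides a nonzero entry below
    it, and adding its row to the first one brings it into the corner. *)
Lemma lin_cov_unit n (M : 'M[R]_n) : M \in unitmx -> lin_cov M.
Proof.
elim: n M => [|n IH] M uM.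
  exists 1 => // H _ _; rewrite mul1e /=; congr H; exact: flatmx0.
have pivot (N : 'M[R]_(1 + n)) : N \in unitmx -> ulsubmx N 0 0 != 0 -> lin_cov N.
  move=> uN; set m := ulsubmx N 0 0 => m0.
  (* The Schur complement of the pivot [m]. *)
  pose S := drsubmx N - dlsubmx N *m (m^-1 *: ursubmx N).
  have NE : N = block_mx 1%:M 0 (m^-1 *: dlsubmx N) 1%:M *m
      block_mx m%:M 0 0 S *m block_mx 1%:M (m^-1 *: ursubmx N) 0 1%:M.
    rewrite !mulmx_block !mul1mx !mul0mx !mulmx0 !mulmx1 !addr0 !add0r.
    rewrite -[LHS](submxK N); congr block_mx.
    - by apply/matrixP => i j; rewrite !ord1 !mxE mulr1n /m !mxE.
    - by rewrite mul_scalar_mx scalerA mulfV// scale1r.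
    - by rewrite mul_mx_scalar scalerA mulfV// scale1r.
    - by rewrite mul_mx_scalar scalerA mulfV// scale1r addrC /S subrK.
  have uS : S \in unitmx.
    move: uN; rewrite NE !unitmx_mul => /andP[/andP[_ +] _].
    rewrite !unitmxE det_ublock det_scalar1 unitrM => /andP[_].
    by rewrite !unitfE.
  rewrite NE; apply: lin_covM; last exact: lin_cov_upper.
  by apply: lin_covM; [exact: lin_cov_lower|exact: lin_cov_diag (IH _ uS)].
have [m0|] := eqVneq (ulsubmx (M : 'M[R]_(1 + n)) 0 0) 0; last exact: pivot.
have [j Cj] : exists j, dlsubmx (M : 'M[R]_(1 + n)) j 0 != 0.
  apply/existsP; apply: contraT; rewrite negb_exists => /forallP C0.
  suff : \det M = 0 by move: uM; rewrite unitmxE unitfE => /eqP.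
  rewrite (expand_det_col M 0) big1// => i _.
  suff -> : M i 0 = 0 by rewrite mul0r.
  rewrite -(@splitK 1 n i); case: (fintype.split (i : 'I_(1 + n))) => j /=.
    move: m0; rewrite (ord1 j) !mxE => <-; congr (M _ _); exact/val_inj.
  move: (C0 j); rewrite negbK !mxE => /eqP <-; congr (M _ _); exact/val_inj.
have uU (w : 'rV[R]_n) : block_mx 1%:M w 0 1%:M \in unitmx.
  by rewrite unitmxE det_ublock !det1 mulr1 unitr1.
(* With this [w] the upper shear adds the row of the nonzero entry to the first row; the shear by
   [- w] undoes it. *)
pose w := delta_mx 0 j : 'rV[R]_n.
have bb : block_mx 1%:M (- w) 0 1%:M *m block_mx 1%:M w 0 1%:M = 1%:M
    :> 'M[R]_(1 + n).
  rewrite (@mulmx_block _ 1 n 1 n 1 n) !mul1mx !mul0mx !mulmx0 !mulmx1 !addr0 !add0r subrr.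
  by rewrite -scalar_mx_block.
have ME : M = block_mx 1%:M (- w) 0 1%:M *m (block_mx 1%:M w 0 1%:M *m M).
  by rewrite mulmxA [X in _ = X *m _]bb mul1mx.
rewrite ME; apply: lin_covM; first exact: lin_cov_upper.
apply: pivot; first by rewrite unitmx_mul uU.
rewrite -[M in _ *m M](@submxK _ 1 n 1 n M) (@mulmx_block _ 1 n 1 n 1 n) block_mxKul mul1mx.
by rewrite mxE m0 add0r /w -rowE mxE.
Qed.

End ChangeOfVariables.

(** * Total variation between centred Gaussian laws *)

Section GaussianDensity.
Context {R : realType}.

Definition sqn n (v : 'cV[R]_n) : R := \sum_i v i 0 ^+ 2.

Lemma sqnE n (v : 'cV[R]_n) : sqn v = (v^T *m v) 0 0.
Proof. by rewrite mxE; apply: eq_bigr => i _; rewrite mxE expr2. Qed.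

Lemma sqn_ge0 n (v : 'cV[R]_n) : 0 <= sqn v.
Proof. by apply: sumr_ge0 => i _; exact: sqr_ge0. Qed.

Lemma sqnZ n (k : R) (v : 'cV[R]_n) : sqn (k *: v) = k ^+ 2 * sqn v.
Proof. by rewrite /sqn mulr_sumr; apply: eq_bigr => i _; rewrite mxE exprMn. Qed.

Definition gdens n (v : 'cV[R]_n) : R :=
  normal_peak 1 ^+ n * expR (- sqn v / 2).

Lemma gdens_ge0 n (v : 'cV[R]_n) : 0 <= gdens v.
Proof. by rewrite mulr_ge0 ?expR_ge0// exprn_ge0// normal_peak_ge0. Qed.

Lemma le_gdens n (v w : 'cV[R]_n) : sqn v <= sqn w -> gdens w <= gdens v.
Proof.
move=> vw; apply: ler_wpM2l; first by rewrite exprn_ge0// normal_peak_ge0.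
by rewrite ler_expR; lra.
Qed.

Lemma gdens_col_mx n (x : R) (v : 'cV[R]_n) :
  gdens (col_mx (x%:M : 'M[R]_1) v) = normal_pdf 0 1 x * gdens v.
Proof.
rewrite /gdens normal_pdfE ?oner_eq0// /normal_fun subr0 expr1n.
rewrite [sqn _](_ : _ = x ^+ 2 + sqn v).
  rewrite opprD mulrDl expRD [_ ^+ (1 + n)]exprS; ring.
rewrite /sqn big_split_ord /= big_ord1 col_mxEu mxE eqxx mulr1n; congr (_ + _).
by apply: eq_bigr => i _; rewrite col_mxEd.
Qed.

Lemma cmeas_gdens n : cmeas (fun v : 'cV[R]_n => (gdens v)%:E).
Proof.
move=> d T c mc; apply/measurable_EFinP; apply: measurable_funM => //.
apply: (measurableT_comp (@measurable_expR R)).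
apply: measurable_funM => //; apply: measurableT_comp => //.
by apply: measurable_sum => i; exact: measurable_funX.
Qed.

Lemma lint_gdens n : lint (fun v : 'cV[R]_n => (gdens v)%:E) = 1%E.
Proof.
elim: n => [|n IH] /=.
  by rewrite /gdens /sqn big_ord0 oppr0 mul0r expR0 mulr1 expr0.
rewrite -[RHS](@integral_normal_pdf R 0 1) ?oner_eq0//; apply: eq_integral => x _.
rewrite -[RHS]mule1 -IH -lintZ ?normal_pdf_ge0//; first last.
- by move=> v; rewrite lee_fin gdens_ge0.
- exact: cmeas_gdens.
by apply: eq_lint => v; rewrite gdens_col_mx.
Qed.

Definition rcol n (z : nat -> R) : 'cV[R]_n := \col_(i < n) z (n - i.+1)%N.

Lemma rcol_upd n (z : nat -> R) x :
  rcol n.+1 (fun i => if i == n then x else z i) =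
  col_mx (x%:M : 'M[R]_1) (rcol n z).
Proof.
apply/matrixP => i j; rewrite (ord1 j) -(@splitK 1 n i).
case: (fintype.split (i : 'I_(1 + n))) => k /=.
  by rewrite [RHS](@col_mxEu _ 1 n 1) !mxE (ord1 k) /= subn1 eqxx mulr1n.
rewrite [RHS](@col_mxEd _ 1 n 1) !mxE /= add1n subSS ifN //.
by rewrite neq_ltn ltn_subrL /= (leq_ltn_trans _ (ltn_ord k)).
Qed.

Lemma iter_gauss_lint n (H : 'cV[R]_n -> \bar R) :
  cmeas H -> (forall v, 0 <= H v)%E ->
  iter_gauss n (fun z => H (rcol n z)) = lint (fun v => (gdens v)%:E * H v)%E.
Proof.
elim: n H => [|n IH] H mH H0 /=.
  rewrite /gdens /sqn big_ord0 oppr0 mul0r expR0 mulr1 expr0 mul1e.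
  by congr H; exact: flatmx0.
apply: eq_integral => x _.
rewrite (_ : (fun z => _) =
  (fun z => H (col_mx (x%:M : 'M[R]_1) (rcol n z)))); last first.
  by apply/funext => z; rewrite rcol_upd.
rewrite (IH (fun v => H (col_mx (x%:M : 'M[R]_1) v)))//; last exact: cmeas_slice.
rewrite -lintZ ?normal_pdf_ge0//; first last.
- by move=> v; rewrite mule_ge0// lee_fin gdens_ge0.
- move=> d T c mc; apply: emeasurable_funM; first exact: cmeas_gdens.
  exact: cmeas_slice.
by apply: eq_lint => v; rewrite gdens_col_mx EFinM muleA.
Qed.

(* [iter_gauss] integrates the last coordinate outermost and [lint] the first one;
   the reversal costs nothing since a factor of a covariance matrix may be
   multiplied by an orthogonal matrix on the right. *)
Definition rev_mx n : 'M[R]_n := \matrix_(i, j) (j == rev_ord i)%:R.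

Lemma rev_mx_rcol n z : rev_mx n *m rcol n z = \col_(i < n) z i.
Proof.
apply/matrixP => i j; rewrite !mxE (bigD1 (rev_ord i))//= big1.
  by rewrite !mxE eqxx mul1r addr0 /= subnSK// subKn// ltnW.
by move=> k ki; rewrite !mxE (negbTE ki) mul0r.
Qed.

Lemma rev_mxK n : rev_mx n *m (rev_mx n)^T = 1%:M.
Proof.
apply/matrixP => i j; rewrite !mxE (bigD1 (rev_ord i))//= big1.
  by rewrite !mxE eqxx mul1r addr0 (inj_eq rev_ord_inj).
by move=> k ki; rewrite !mxE (negbTE ki) mul0r.
Qed.

Definition tind n (A : set (n.-tuple R)) (v : 'cV[R]_n) : \bar R :=
  (\1_A (tuple_of_cV v))%:E.

Lemma tind_ge0 n (A : set (n.-tuple R)) v : (0 <= tind A v)%E.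
Proof. by rewrite lee_fin. Qed.

Lemma cmeas_tind n (A : set (n.-tuple R)) : measurable A -> cmeas (tind A).
Proof.
move=> mA d T c mc; apply/measurable_EFinP.
have mt : measurable_fun setT (fun t => tuple_of_cV (c t)).
  apply/measurable_fun_tnthP => i.
  rewrite (_ : _ \o _ = (fun t => c t i 0)) //.
  by apply/funext => t; rewrite /= tnth_mktuple.
have mi := (@measurable_indic _ _ R setT A mA).
have h := measurableT_comp mi mt.
by apply: eq_measurable_fun h => t _.
Qed.

Definition glaw n (M : 'M[R]_n) (A : set (n.-tuple R)) : \bar R :=
  lint (fun v => (gdens v)%:E * tind A (M *m v))%E.

Lemma gauss_linE n (L : 'M[R]_n) A : measurable A ->
  gauss_lin L A = glaw (L *m rev_mx n) A.
Proof.
move=> mA; rewrite /glaw -(iter_gauss_lint (H := fun v => tind A (L *m rev_mx n *m v))).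
- rewrite /gauss_lin; congr iter_gauss; apply/funext => z.
  by rewrite -mulmxA rev_mx_rcol.
- exact/(cmeas_mulmx (H := tind A))/cmeas_tind.
- by move=> v; exact: tind_ge0.
Qed.

Lemma cmeas_gdens_tind n m (N : 'M[R]_(n, m)) (M : 'M[R]_(n, m)) A :
  measurable A -> cmeas (fun v => (gdens (N *m v))%:E * tind A (M *m v))%E.
Proof.
move=> mA d T c mc; apply: emeasurable_funM.
  exact: (cmeas_mulmx (H := fun v => (gdens v)%:E) N (@cmeas_gdens n)).
exact: (cmeas_mulmx (H := tind A) M (cmeas_tind mA)).
Qed.

Lemma glaw_ge0 n (M : 'M[R]_n) A : (0 <= glaw M A)%E.
Proof.
by apply: lint_ge0 => v; rewrite mule_ge0 ?tind_ge0// lee_fin gdens_ge0.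
Qed.

Lemma glaw_setC n (M : 'M[R]_n) A : measurable A ->
  (glaw M A + glaw M (~` A) = 1)%E.
Proof.
have mg (B : set (n.-tuple R)) : measurable B -> cmeas (fun v => (gdens v)%:E * tind B (M *m v))%E.
  move=> mB; rewrite (_ : (fun v => _) =
    (fun v => (gdens (1%:M *m v))%:E * tind B (M *m v))%E).
    exact: cmeas_gdens_tind.
  by apply/funext => v; rewrite mul1mx.
have g0 B v : (0 <= (gdens v)%:E * tind B (M *m v))%E.
  by rewrite mule_ge0 ?tind_ge0// lee_fin gdens_ge0.
move=> mA; have mC : measurable (~` A) by exact: measurableC.
rewrite /glaw -lintD//; try exact: mg.
rewrite -(lint_gdens n); apply: eq_lint => v.
rewrite /tind -!EFinM -EFinD indicC -mulrDr; congr (_%:E).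
by rewrite !indicE; case: (_ \in A); rewrite /= ?addr0 ?add0r mulr1.
Qed.

Lemma glaw_fin n (M : 'M[R]_n) A : measurable A ->
  exists2 p : R, 0 <= p <= 1 & glaw M A = p%:E /\ glaw M (~` A) = (1 - p)%:E.
Proof.
move=> /(glaw_setC M); move: (glaw_ge0 M A) (glaw_ge0 M (~` A)).
case: (glaw M A) => [a| |] //; case: (glaw M (~` A)) => [b| |] //.
rewrite !lee_fin => a0 b0 [abE]; exists a; first by lra.
by split => //; congr (_%:E); lra.
Qed.

(* Densities: with c the modulus of [M], the law of [M z] has density
   [c * gdens (M^-1 y)]; rescaling [M] by [k] rescales [c] by [k ^- n]. *)
Lemma glaw_density n (M : 'M[R]_n) : M \in unitmx -> exists2 c : R, 0 < c &
  forall k A, 0 < k -> measurable A -> glaw (k *: M) A =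
    ((c * k ^- n)%:E * lint (fun y => (gdens (k^-1 *: (invmx M *m y)))%:E * tind A y))%E.
Proof.
move=> uM; have [c c0 cM] := lin_cov_unit uM; exists c => // k A k0 mA.
pose G y := ((gdens (k^-1 *: (invmx M *m y)))%:E * tind A y)%E.
have mG : cmeas G.
  move=> d T f mf; rewrite (_ : (fun t => _) = (fun t =>
    (gdens ((k^-1 *: invmx M) *m f t))%:E * tind A (1%:M *m f t))%E).
    exact: cmeas_gdens_tind.
  by apply/funext => t; rewrite /G mul1mx scalemxAl.
have G0 v : (0 <= G v)%E by rewrite mule_ge0 ?tind_ge0// lee_fin gdens_ge0.
rewrite -/G mulrC EFinM -muleA -cM// -(lint_scale k0); first last.
- by move=> v.
- exact: cmeas_mulmx.
apply: eq_lint => v; rewrite /G -scalemxAr -scalemxAl; congr (_%:E * _)%E.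
rewrite -scalemxAr scalerA mulVf ?gt_eqF// scale1r mulKmx//.
Qed.

(** The law of [s *: M2] is a common dominating law: up to the factor [s ^+ (n + n)] it bounds both
    laws on every event. One factor [s ^+ n] comes from the dilation, the other from the ratio of
    the moduli. *)
Lemma glaw_le n (M1 M2 : 'M[R]_n) (s : R) A :
  M1 \in unitmx -> M2 \in unitmx -> 1 <= s -> measurable A ->
  (forall y, sqn (invmx M1 *m y) <= s ^+ 2 * sqn (invmx M2 *m y)) ->
  (forall y, sqn (invmx M2 *m y) <= s ^+ 2 * sqn (invmx M1 *m y)) ->
  (glaw M1 A <= glaw M2 A + (s ^+ (n + n) - 1)%:E)%E.
Proof.
move=> u1 u2 s1 mA le12 le21.
have s0 : 0 < s by exact: lt_le_trans s1.
have sn0 : 0 < s ^+ n by exact: exprn_gt0.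
have [c1 c10 d1] := glaw_density u1; have [c2 c20 d2] := glaw_density u2.
pose I (M : 'M[R]_n) k B :=
  lint (fun y => (gdens (k^-1 *: (invmx M *m y)))%:E * tind B y)%E.
have mI M k (B : set (n.-tuple R)) : measurable B ->
    cmeas (fun y : 'cV[R]_n => (gdens (k^-1 *: (invmx M *m y)))%:E * tind B y)%E.
  move=> mB d T f mf; rewrite (_ : (fun t => _) = (fun t =>
    (gdens ((k^-1 *: invmx M) *m f t))%:E * tind B (1%:M *m f t))%E).
    exact: cmeas_gdens_tind.
  by apply/funext => t; rewrite mul1mx scalemxAl.
have leI M N k l (B : set (n.-tuple R)) : measurable B ->
    (forall y, sqn (l^-1 *: (invmx N *m y)) <= sqn (k^-1 *: (invmx M *m y))) ->
    (I M k B <= I N l B)%E.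
  move=> mB le; apply: le_lint; [exact: mI|exact: mI| |].
    by move=> v; rewrite mule_ge0 ?tind_ge0// lee_fin gdens_ge0.
  move=> v; apply: lee_wpmul2r; first exact: tind_ge0.
  by rewrite lee_fin; apply: le_gdens.
have I0 M k B : (0 <= I M k B)%E.
  by apply: lint_ge0 => v; rewrite mule_ge0 ?tind_ge0// lee_fin gdens_ge0.
have T1 (M : 'M[R]_n) : glaw M setT = 1%E.
  have := glaw_setC M measurableT; rewrite setCT.
  rewrite [X in (_ + X)%E](_ : _ = 0)%E ?adde0//.
  rewrite /glaw (_ : (fun v => _) = (fun v => 0%:E * (gdens v)%:E)%E).
    rewrite (lintZ (lexx 0) (@cmeas_gdens n)) ?mul0e// => v.
    by rewrite lee_fin gdens_ge0.
  by apply/funext => v; rewrite /tind indicE in_set0 mule0 mul0e.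
have scale1 (M : 'M[R]_n) : M = 1 *: M by rewrite scale1r.
have e1 (B : set (n.-tuple R)) : measurable B -> glaw M1 B = (c1%:E * I M1 1%R B)%E.
  by move=> mB; rewrite [M1 in glaw M1]scale1 d1// /I expr1n !invr1 mulr1.
have e2 (B : set (n.-tuple R)) : measurable B -> glaw M2 B = (c2%:E * I M2 1%R B)%E.
  by move=> mB; rewrite [M2 in glaw M2]scale1 d2// /I expr1n !invr1 mulr1.
(* the total masses compare the two moduli *)
have c12 : c1 <= s ^+ n * c2.
  have := T1 (s^-1 *: M2); rewrite d2 ?invr_gt0// exprVn invrK -/(I _ _ _) => e4.
  have := T1 M1; rewrite e1// => eT.
  have le4 : (I M2 s^-1%R setT <= I M1 1%R setT)%E.
    by apply: leI => // y; rewrite invrK invr1 scale1r sqnZ.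
  move: eT e4 le4 (I0 M1 1 setT) (I0 M2 s^-1 setT).
  case: (I M1 1 setT) => [a| |] //; case: (I M2 s^-1 setT) => [b| |] //=.
  - rewrite -!EFinM !lee_fin => -[ea] [eb] ba a0 b0.
    have b0' : 0 < b.
      rewrite lt_def b0 andbT; apply/eqP => bE.
      by move: eb; rewrite bE mulr0 => /eqP; rewrite eq_sym oner_eq0.
    rewrite -(ler_pM2r b0') [leRHS](_ : _ = 1); last by rewrite -eb; ring.
    by rewrite -ea ler_pM2l.
  - by rewrite gt0_muley ?lte_fin// => -[].
  - by rewrite gt0_muley ?lte_fin// => -[].
have s2n : s ^+ (n + n) = s ^+ n * s ^+ n by rewrite exprD.
have sn1 : 1 <= s ^+ n by exact: exprn_ege1.
have P3 (B : set (n.-tuple R)) : measurable B -> (c2%:E * I M2 s B = (s ^+ n)%:E * glaw (s *: M2) B)%E.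
  move=> mB; rewrite d2// -/(I _ _ _) muleA -EFinM; congr (_%:E * _)%E.
  by rewrite mulrCA mulfV ?gt_eqF// mulr1.
clearbody I.
have Ple (c : R) (M : 'M[R]_n) (B : set (n.-tuple R)) : 0 <= c -> c <= s ^+ n * c2 ->
    measurable B -> (I M 1%R B <= I M2 s B)%E ->
    (c%:E * I M 1%R B <= (s ^+ (n + n))%:E * glaw (s *: M2) B)%E.
  move=> cp cle mB Ile.
  have -> : ((s ^+ (n + n))%:E * glaw (s *: M2) B = (s ^+ n * c2)%:E * I M2 s B)%E.
    by rewrite s2n !EFinM -!muleA (P3 B mB).
  by apply: lee_pmul; rewrite ?lee_fin.
have P13 (B : set (n.-tuple R)) : measurable B ->
    (glaw M1 B <= (s ^+ (n + n))%:E * glaw (s *: M2) B)%E.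
  move=> mB; rewrite (e1 B mB); apply: Ple => //; first exact: ltW.
  apply: leI => // y; rewrite invr1 scale1r sqnZ exprVn ler_pdivrMl ?exprn_gt0//.
have P23 (B : set (n.-tuple R)) : measurable B ->
    (glaw M2 B <= (s ^+ (n + n))%:E * glaw (s *: M2) B)%E.
  move=> mB; rewrite (e2 B mB); apply: Ple => //.
  - exact: ltW.
  - by rewrite ler_peMl// ltW.
  apply: leI => // y; rewrite invr1 scale1r sqnZ exprVn ler_pdivrMl ?exprn_gt0//.
  by rewrite ler_peMl ?sqn_ge0// exprn_ege1.
have mC : measurable (~` A) by exact: measurableC.
have [p _ [pE _]] := glaw_fin M1 mA.
have [a _ [aE bE]] := glaw_fin M2 mA.
have [a' _ [aE' bE']] := glaw_fin (s *: M2) mA.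
(* Domination is used on [A] for [M1] and on the complement of [A] for [M2]; on the dominating side
   the two masses add up to one. *)
move: (P13 _ mA) (P23 _ mC); rewrite pE aE bE aE' bE' -!EFinM -EFinD !lee_fin.
lra.
Qed.

End GaussianDensity.

(** * Factorisation and comparison of covariance matrices *)

Section GaussianTV.
Context {R : realType}.

Lemma posdef_unitmx n (S : 'M[R]_n) : posdef S -> S \in unitmx.
Proof.
move=> pS; rewrite unitmxE unitfE; apply/det0P => -[v v0 vS].
have := pS v^T; rewrite trmxK vS mul0mx mxE ltxx => /(_ _)/negP; apply => //.
by rewrite -[0](@trmx0 R) (inj_eq trmx_inj).
Qed.

(** Induction on the size: the first column of the factor is read off the first column of [S], and
    what remains to be factored is the Schur complement of the corner. *)
Lemma cholesky n (S : 'M[R]_n) : S^T = S -> posdef S ->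
  exists L : 'M[R]_n, L *m L^T = S.
Proof.
elim: n S => [|n IH] S symS pS; first by exists 0; rewrite [LHS]flatmx0 [RHS]flatmx0.
pose T : 'M[R]_(1 + n) := S.
pose a := T 0 0; pose b := dlsubmx T; pose D := drsubmx T.
have ulE : ulsubmx T = a%:M.
  apply/matrixP => i j; rewrite !ord1 !mxE mulr1n /a; congr (T _ _); exact/val_inj.
have urE : ursubmx T = b^T by rewrite /b trmx_dlsub /T symS.
have TE : T = block_mx a%:M b^T b D by rewrite -[LHS]submxK ulE urE.
have DT : D^T = D by rewrite /D trmx_drsub /T symS.
have quad (x : R) (v : 'cV[R]_n) :
    ((col_mx (x%:M : 'M[R]_1) v)^T *m T *m col_mx (x%:M : 'M[R]_1) v) 0 0 =
    x ^+ 2 * a + 2 * x * (b^T *m v) 0 0 + (v^T *m D *m v) 0 0.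
  rewrite TE tr_col_mx mul_row_block mul_row_col !mulmxDl tr_scalar_mx.
  have -> : v^T *m b *m x%:M = x%:M *m b^T *m v.
    rewrite mul_mx_scalar mul_scalar_mx -scalemxAl; congr (_ *: _).
    by rewrite -[LHS]trmxK trmx_mul trmxK; apply/matrixP => i j; rewrite mxE !ord1.
  rewrite -!scalar_mxM !mul_scalar_mx -scalemxAl !mxE !mulr1n; ring.
have a0 : 0 < a.
  have := pS (col_mx (1%:M : 'M[R]_1) 0); rewrite quad !mulmx0 mxE !mulr0 !addr0 expr1n mul1r.
  apply; apply/eqP => /(congr1 (fun v => usubmx (v : 'cV_(1 + n)) 0 0)).
  by rewrite col_mxKu !mxE /= => /eqP; rewrite oner_eq0.
pose D' := D - a^-1 *: (b *m b^T).
have D'T : D'^T = D' by rewrite /D' linearB /= linearZ /= trmx_mul trmxK DT.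
have pD' : posdef D'.
  (* This [x] minimises the quadratic form of [S] in the first coordinate; the minimum is the form
     of the Schur complement, hence positive. *)
  move=> v v0; pose x := - a^-1 * (b^T *m v) 0 0.
  have := pS (col_mx (x%:M : 'M[R]_1) v); rewrite quad.
  suff -> : (v^T *m D' *m v) 0 0 =
     x ^+ 2 * a + 2 * x * (b^T *m v) 0 0 + (v^T *m D *m v) 0 0.
    apply; apply: contraNneq v0 => /(congr1 (fun v => dsubmx (v : 'cV_(1 + n)))).
    by rewrite col_mxKd => ->; apply/eqP/matrixP => i j; rewrite !mxE.
  have e : (v^T *m (b *m b^T) *m v) 0 0 = (b^T *m v) 0 0 ^+ 2.
    rewrite mulmxA -mulmxA mxE big_ord1 expr2; congr (_ * _).
    by rewrite -[v^T *m b]trmxK mxE trmx_mul trmxK.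
  rewrite /D' mulmxBr mulmxBl mxE [X in _ + X]mxE -scalemxAr -scalemxAl [X in _ - X]mxE e /x.
  by field; rewrite gt_eqF.
have [L LE] := IH _ D'T pD'.
exists (block_mx (Num.sqrt a)%:M 0 ((Num.sqrt a)^-1 *: b) L).
have sa0 : Num.sqrt a != 0 by rewrite gt_eqF// sqrtr_gt0.
have saa : Num.sqrt a * Num.sqrt a = a by rewrite -expr2 sqr_sqrtr// ltW.
rewrite [RHS]TE [X in _ *m X](@tr_block_mx _ 1 n 1 n) (@mulmx_block _ 1 n 1 n 1 n) !trmx0 !mulmx0 !mul0mx !addr0.
rewrite tr_scalar_mx linearZ /= -scalar_mxM saa; congr (@block_mx _ 1 n 1 n _ _ _ _).
- by rewrite mul_scalar_mx scalerA mulfV// scale1r.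
- by rewrite mul_mx_scalar scalerA mulfV// scale1r.
- rewrite -scalemxAl -scalemxAr scalerA LE -invfM saa /D' addrC subrK//.
Qed.

Lemma quad_sqn n m (M : 'M[R]_(n, m)) (x : 'cV[R]_n) :
  (x^T *m (M *m M^T) *m x) 0 0 = sqn (M^T *m x).
Proof. by rewrite sqnE trmx_mul trmxK !mulmxA. Qed.

Lemma sqnBZ n (k : R) (v w : 'cV[R]_n) :
  sqn (v - k *: w) = sqn v - 2 * k * (v^T *m w) 0 0 + k ^+ 2 * sqn w.
Proof.
rewrite /sqn mxE !mulr_sumr -sumrB -big_split /=; apply: eq_bigr => i _.
by rewrite !mxE; ring.
Qed.

(** Inversion reverses the order of quadratic forms. The vector [w] is built so that its scalar
    product with [a] is [sqn b] while [sqn w <= s ^+ 2 * sqn b]; expanding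
    [0 <= sqn (w - s ^+ 2 *: a)] then yields the claim. *)
Lemma sqn_inv_le n (M1 M2 : 'M[R]_n) (s : R) : 0 < s ->
  M1 \in unitmx -> M2 \in unitmx ->
  (forall x, sqn (M1^T *m x) <= s ^+ 2 * sqn (M2^T *m x)) ->
  forall y, sqn (invmx M2 *m y) <= s ^+ 2 * sqn (invmx M1 *m y).
Proof.
move=> s0 u1 u2 le12 y.
set b := invmx M2 *m y; set a := invmx M1 *m y.
pose x := invmx M2^T *m b; pose w := M1^T *m x.
have wle : sqn w <= s ^+ 2 * sqn b.
  by apply: le_trans (le12 _) _; rewrite /x mulKVmx// unitmx_tr.
have aE : M1 *m a = y by rewrite mulKVmx.
have bE : invmx M2 *m y = b by [].
clearbody a b.
have wa : (w^T *m a) 0 0 = sqn b.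
  rewrite sqnE; have -> : w^T = b^T *m invmx M2 *m M1.
    by rewrite /w /x trmx_mul trmxK trmx_mul -trmx_inv trmxK.
  by rewrite -[_ *m M1 *m a]mulmxA aE -mulmxA bE.
have : 0 <= sqn (w - (s ^+ 2) *: a) by exact: sqn_ge0.
have s20 : 0 < s ^+ 2 by rewrite exprn_gt0.
by rewrite sqnBZ wa => h; rewrite -(ler_pM2l s20); lra.
Qed.

Lemma dTV_gauss_le n (S1 S2 : 'M[R]_n) (s : R) : 1 <= s ->
  S1^T = S1 -> S2^T = S2 -> posdef S1 -> posdef S2 ->
  (forall x : 'cV[R]_n, (x^T *m S1 *m x) 0 0 <= s ^+ 2 * (x^T *m S2 *m x) 0 0) ->
  (forall x : 'cV[R]_n, (x^T *m S2 *m x) 0 0 <= s ^+ 2 * (x^T *m S1 *m x) 0 0) ->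
  (dTV_gauss S1 S2 <= (s ^+ (n + n) - 1)%:E)%E.
Proof.
move=> s1 t1 t2 p1 p2 le12 le21.
have s0 : 0 < s by exact: lt_le_trans s1.
(* [cov_factor] is a choice, which meets its specification because [cholesky] shows that some factor
   exists; the orthogonal reversal keeps it a factor. *)
have factor (S : 'M[R]_n) : S^T = S -> posdef S ->
    let M := cov_factor S *m rev_mx n in M *m M^T = S /\ M \in unitmx.
  move=> tS pS M.
  have ME : M *m M^T = S.
    have [L LE] := cholesky tS pS.
    rewrite /M trmx_mul mulmxA -[_ *m _ *m (rev_mx n)^T]mulmxA rev_mxK mulmx1.
    exact: (@xgetPex _ 0 [set L : 'M[R]_n | L *m L^T = S] (ex_intro _ L LE)).
  split => //; have := posdef_unitmx pS.
  by rewrite -ME unitmx_mul => /andP[].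
have [E1 u1] := factor _ t1 p1; have [E2 u2] := factor _ t2 p2.
set M1 := cov_factor S1 *m _ in E1 u1; set M2 := cov_factor S2 *m _ in E2 u2.
have q12 x : sqn (M1^T *m x) <= s ^+ 2 * sqn (M2^T *m x).
  by rewrite -!quad_sqn E1 E2.
have q21 x : sqn (M2^T *m x) <= s ^+ 2 * sqn (M1^T *m x).
  by rewrite -!quad_sqn E1 E2.
have i21 := sqn_inv_le s0 u1 u2 q12; have i12 := sqn_inv_le s0 u2 u1 q21.
apply: ge_ereal_sup => _ [A mA <-].
rewrite /gauss !gauss_linE// -/M1 -/M2.
have := glaw_le u1 u2 s1 mA i12 i21; have := glaw_le u2 u1 s1 mA i21 i12.
have [p _ [-> _]] := glaw_fin M1 mA; have [q _ [-> _]] := glaw_fin M2 mA.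
by rewrite -EFinB -!EFinD abse_EFin !lee_fin ler_norml => ? ?; lra.
Qed.

Lemma dTV_gauss_le1 n (S1 S2 : 'M[R]_n) : (dTV_gauss S1 S2 <= 1)%E.
Proof.
apply: ge_ereal_sup => _ [A mA <-]; rewrite /gauss !gauss_linE//.
have [p hp [-> _]] := glaw_fin (cov_factor S1 *m rev_mx n) mA.
have [q hq [-> _]] := glaw_fin (cov_factor S2 *m rev_mx n) mA.
by rewrite -EFinB abse_EFin lee_fin ler_norml; lra.
Qed.

End GaussianTV.

(** * Matrix perturbation *)

Section MatrixPerturbation.
Context {R : realType}.

(** The entrywise l1 norm is submultiplicative, invariant under transposition and directly
    controlled by the entries. Its loss in the dimension only affects constants that go into the
    o-term. *)
Definition mxsum m n (M : 'M[R]_(m, n)) : R := \sum_i \sum_j `|M i j|.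

Lemma mxsum_ge0 m n (M : 'M[R]_(m, n)) : 0 <= mxsum M.
Proof. by apply: sumr_ge0 => i _; apply: sumr_ge0. Qed.

Lemma ler_mxsum m n (M : 'M[R]_(m, n)) i j : `|M i j| <= mxsum M.
Proof.
rewrite /mxsum (bigD1 i)//= (bigD1 j)//= -addrA lerDl addr_ge0//.
  exact: sumr_ge0.
by apply: sumr_ge0 => k _; apply: sumr_ge0.
Qed.

Lemma mxsumD m n (M N : 'M[R]_(m, n)) : mxsum (M + N) <= mxsum M + mxsum N.
Proof.
rewrite /mxsum -big_split; apply: ler_sum => i _; rewrite -big_split.
by apply: ler_sum => j _; rewrite mxE ler_normD.
Qed.

Lemma mxsumN m n (M : 'M[R]_(m, n)) : mxsum (- M) = mxsum M.
Proof. by do 2 apply: eq_bigr => ? _; rewrite mxE normrN. Qed.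

Lemma mxsumZ m n (k : R) (M : 'M[R]_(m, n)) : mxsum (k *: M) = `|k| * mxsum M.
Proof.
rewrite /mxsum mulr_sumr; apply: eq_bigr => i _; rewrite mulr_sumr.
by apply: eq_bigr => j _; rewrite mxE normrM.
Qed.

Lemma mxsum_tr m n (M : 'M[R]_(m, n)) : mxsum M^T = mxsum M.
Proof.
by rewrite /mxsum exchange_big; do 2 apply: eq_bigr => ? _; rewrite mxE.
Qed.

Lemma mxsum0 m n : mxsum (0 : 'M[R]_(m, n)) = 0.
Proof. by rewrite /mxsum big1// => i _; rewrite big1// => j _; rewrite mxE normr0. Qed.

Lemma mxsum_sum m n (I : Type) (r : seq I) (F : I -> 'M[R]_(m, n)) :
  mxsum (\sum_(i <- r) F i) <= \sum_(i <- r) mxsum (F i).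
Proof.
elim: r => [|i r IH]; first by rewrite !big_nil mxsum0.
by rewrite !big_cons (le_trans (mxsumD _ _))// lerD2l.
Qed.

Lemma mxsum_mul m n p (M : 'M[R]_(m, n)) (N : 'M[R]_(n, p)) :
  mxsum (M *m N) <= mxsum M * mxsum N.
Proof.
rewrite /mxsum mulr_suml; apply: ler_sum => i _.
apply: (@le_trans _ _ (\sum_k \sum_j `|M i j| * `|N j k|)).
  apply: ler_sum => k _; rewrite mxE (le_trans (ler_norm_sum _ _ _))//.
  by under eq_bigr do rewrite normrM.
rewrite exchange_big mulr_suml; apply: ler_sum => j _.
rewrite -mulr_sumr ler_wpM2l// (bigD1 j)//= lerDl.
by apply: sumr_ge0 => k _; apply: sumr_ge0.
Qed.

Lemma mxsum_eq0 m n (M : 'M[R]_(m, n)) : mxsum M <= 0 -> M = 0.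
Proof.
move=> M0; apply/matrixP => i j; rewrite mxE; apply/eqP; rewrite -normr_le0.
exact: le_trans (ler_mxsum M i j) M0.
Qed.

Lemma ler_quad n (E : 'M[R]_n) (x : 'cV[R]_n) :
  `|(x^T *m E *m x) 0 0| <= mxsum E * sqn x.
Proof.
rewrite mxE (le_trans (ler_norm_sum _ _ _))// /mxsum exchange_big mulr_suml.
apply: ler_sum => j _; rewrite mxE mulr_suml (le_trans (ler_norm_sum _ _ _))//.
rewrite mulr_suml; apply: ler_sum => i _.
rewrite mxE !normrM mulrAC mulrC ler_wpM2l//.
have xl k : x k 0 ^+ 2 <= sqn x.
  by rewrite /sqn (bigD1 k)//= lerDl; apply: sumr_ge0 => l _; exact: sqr_ge0.
have := xl i; have := xl j; rewrite -(real_normK (num_real (x i 0))) -(real_normK (num_real (x j 0))).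
have := sqr_ge0 (`|x i 0| - `|x j 0|); rewrite !expr2; lra.
Qed.

(** A Cholesky factor replaces the spectral theorem: [x] is recovered from [L^T *m x] by a fixed
    matrix, and [sqn (L^T *m x)] is the form of [S]. The added [1] keeps the constant positive in
    dimension zero as well. *)
Lemma posdef_coercive n (S : 'M[R]_n) : S^T = S -> posdef S ->
  exists2 m : R, 0 < m & forall x : 'cV[R]_n, sqn x <= m * (x^T *m S *m x) 0 0.
Proof.
move=> tS pS; have [L LE] := cholesky tS pS.
have uL : L \in unitmx.
  by have := posdef_unitmx pS; rewrite -LE unitmx_mul => /andP[].
pose Q := invmx L *m (invmx L)^T; exists (mxsum Q + 1).
  by rewrite ltr_wpDl// mxsum_ge0.
move=> x; rewrite -LE quad_sqn.
have xE : x = (invmx L)^T *m (L^T *m x) by rewrite trmx_inv mulKmx// unitmx_tr.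
rewrite {1}xE -[sqn (_ *m (_ *m _))]quad_sqn.
apply: le_trans (ler_norm _) _; apply: le_trans (ler_quad _ _) _.
by rewrite ler_wpM2r ?sqn_ge0// lerDl.
Qed.

Lemma exprD1_le (k : nat) (t : R) : 0 <= t <= 1 -> (1 + t) ^+ k - 1 <= 2 ^+ k * t.
Proof.
move=> /andP[t0 t1]; elim: k => [|k IH]; first by rewrite !expr0; lra.
rewrite !exprS; have : (1 + t) ^+ k <= 2 ^+ k by apply: lerXn2r; rewrite ?nnegrE; lra.
by move=> h; have : t * (1 + t) ^+ k <= t * 2 ^+ k; [rewrite ler_wpM2l|lra].
Qed.

Lemma invmx_perturb n (A B : 'M[R]_n) (e : R) : A \in unitmx ->
  mxsum (B - A) <= e -> mxsum (invmx A) * e <= 1 / 2 ->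
  B \in unitmx /\ mxsum (invmx B) <= 2 * mxsum (invmx A) /\
  mxsum (invmx B - invmx A) <= 2 * mxsum (invmx A) ^+ 2 * e.
Proof.
move=> uA Be ae; set a := mxsum (invmx A) in ae *.
have a0 : 0 <= a by exact: mxsum_ge0.
have e0 : 0 <= e by exact: le_trans (mxsum_ge0 _) Be.
have uB : B \in unitmx.
  rewrite unitmxE unitfE; apply/det0P => -[v v0 vB].
  have vE : v = v *m (A - B) *m invmx A.
    by rewrite mulmxBr vB subr0 mulmxK.
  have : mxsum v <= mxsum v * (1 / 2).
    rewrite {1}vE (le_trans (mxsum_mul _ _))// -/a.
    apply: (@le_trans _ _ (mxsum v * e * a)).
      rewrite ler_wpM2r// (le_trans (mxsum_mul _ _))// ler_wpM2l ?mxsum_ge0//.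
      by rewrite -mxsumN opprB.
    by rewrite -mulrA ler_wpM2l ?mxsum_ge0// mulrC.
  have := mxsum_ge0 v => h1 h2; have /mxsum_eq0 v0' : mxsum v <= 0 by lra.
  by rewrite v0' eqxx in v0.
have BE : invmx B - invmx A = - (invmx B *m (B - A) *m invmx A).
  by rewrite mulmxBr mulVmx// mulmxBl mul1mx mulmxK// opprB.
set b := mxsum (invmx B).
have b0 : 0 <= b by exact: mxsum_ge0.
have bd : mxsum (invmx B - invmx A) <= b * e * a.
  rewrite BE mxsumN (le_trans (mxsum_mul _ _))// -/a ler_wpM2r//.
  by rewrite (le_trans (mxsum_mul _ _))// ler_wpM2l.
have b2a : b <= 2 * a.
  have : b <= mxsum (invmx B - invmx A) + a.
    by rewrite /b -{1}[invmx B](subrK (invmx A)) mxsumD.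
  have : b * e * a <= b * (1 / 2) by rewrite -mulrA ler_wpM2l// mulrC.
  lra.
split => //; split => //; apply: le_trans bd _.
rewrite mulrAC [leRHS](_ : _ = 2 * a * a * e); last by ring.
by rewrite ler_wpM2r// ler_wpM2r.
Qed.

Lemma symmx_congr n (B S : 'M[R]_n) : S^T = S -> (B *m S *m B^T)^T = B *m S *m B^T.
Proof. by move=> tS; rewrite !trmx_mul trmxK tS mulmxA. Qed.

Lemma posdef_congr n (B S : 'M[R]_n) : B \in unitmx -> posdef S ->
  posdef (B *m S *m B^T).
Proof.
move=> uB pS x x0; have := pS (B^T *m x); rewrite trmx_mul trmxK !mulmxA; apply.
apply: contraNneq x0 => h.
have uBt : B^T \in unitmx by rewrite unitmx_tr.
by rewrite -[x](mulKmx uBt) h mulmx0.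
Qed.

Lemma dTV_gauss_perturb n (A G : 'M[R]_n) : A \in unitmx -> G^T = G -> posdef G ->
  exists2 c : R, 0 < c & forall (Ah Gh : 'M[R]_n) (e : R), Gh^T = Gh ->
    mxsum (Ah - A) <= e -> mxsum (Gh - G) <= e ->
    (dTV_gauss (invmx Ah *m Gh *m (invmx Ah)^T) (invmx A *m G *m (invmx A)^T)
      <= (c * e)%:E)%E.
Proof.
move=> uA tG pG; set A' := invmx A; set S2 := A' *m G *m A'^T.
have uA' : A' \in unitmx by rewrite unitmx_inv.
have tS2 : S2^T = S2 by exact: symmx_congr.
have pS2 : posdef S2 by exact: posdef_congr.
have [m m0 mS2] := posdef_coercive tS2 pS2.
pose a := mxsum A'; pose g := mxsum G.
have a0 : 0 <= a by exact: mxsum_ge0.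
have g0 : 0 <= g by exact: mxsum_ge0.
pose K := 4 * a ^+ 2 + 6 * a ^+ 3 * g.
have K0 : 0 <= K by rewrite addr_ge0 ?mulr_ge0 ?exprn_ge0.
(* The middle term is the Lipschitz constant for small [e]. It and [2 * a] also force [1 <= c * e]
   when [K * m * e] or [a * e] exceeds [1 / 2], where the trivial bound by one applies. *)
pose c := 2 * a + 2 * (K * m) * 2 ^+ (n + n) + 1.
have p1 : 1 <= (2 : R) ^+ (n + n) by rewrite exprn_ege1//; lra.
have Km0 : 0 <= K * m by rewrite mulr_ge0// ltW.
have c0 : 0 < c by rewrite /c; nra.
exists c => // Ah Gh e tGh Ae Ge.
have e0 : 0 <= e by exact: le_trans (mxsum_ge0 _) Ae.
have big : 1 <= c * e -> (dTV_gauss (invmx Ah *m Gh *m (invmx Ah)^T) S2 <= (c * e)%:E)%E.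
  by move=> ?; apply: le_trans (dTV_gauss_le1 _ _) _; rewrite lee_fin.
have [ae|] := leP (a * e) (1 / 2); last first.
  move=> ae; apply: big; rewrite /c.
  have : 0 <= 2 * (K * m) * 2 ^+ (n + n) * e by rewrite !mulr_ge0// ?ltW// exprn_ge0.
  lra.
have [eps|] := leP (K * m * e) (1 / 2); last first.
  move=> eps; apply: big; rewrite /c.
  have : 2 * (K * m) * e <= 2 * (K * m) * 2 ^+ (n + n) * e.
    by rewrite ler_wpM2r// ler_peMr// mulr_ge0.
  have : 0 <= a * e by exact: mulr_ge0.
  lra.
have [uAh [bh dh]] := invmx_perturb uA Ae ae.
set B := invmx Ah in bh dh *; rewrite -/A' -/a in bh dh.
set S1 := B *m Gh *m B^T.
have dS : mxsum (S1 - S2) <= K * e.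
  (* The three factors are exchanged one at a time; [K] adds up the three bounds [h1], [h2],
     [h3]. *)
  have -> : S1 - S2 = B *m (Gh - G) *m B^T + ((B - A') *m G *m B^T + A' *m G *m (B - A')^T).
    have -> : (B - A')^T = B^T - A'^T by apply/matrixP => i j; rewrite !mxE.
    by rewrite !mulmxBr !mulmxBl !addrA !subrK.
  have h1 : mxsum (B *m (Gh - G) *m B^T) <= 4 * a ^+ 2 * e.
    rewrite (le_trans (mxsum_mul _ _))// mxsum_tr.
    apply: (@le_trans _ _ ((2 * a) * e * (2 * a))); last by rewrite le_eqVlt; apply/orP; left; apply/eqP; ring.
    apply: ler_pM => //; try exact: mxsum_ge0.
    rewrite (le_trans (mxsum_mul _ _))//; apply: ler_pM => //; exact: mxsum_ge0.
  have h2 : mxsum ((B - A') *m G *m B^T) <= 4 * a ^+ 3 * g * e.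
    rewrite (le_trans (mxsum_mul _ _))// mxsum_tr.
    apply: (@le_trans _ _ ((2 * a ^+ 2 * e) * g * (2 * a))); last by rewrite le_eqVlt; apply/orP; left; apply/eqP; ring.
    apply: ler_pM => //; try exact: mxsum_ge0.
    rewrite (le_trans (mxsum_mul _ _))//; apply: ler_pM => //; exact: mxsum_ge0.
  have h3 : mxsum (A' *m G *m (B - A')^T) <= 2 * a ^+ 3 * g * e.
    rewrite (le_trans (mxsum_mul _ _))// mxsum_tr.
    apply: (@le_trans _ _ (a * g * (2 * a ^+ 2 * e))); last by rewrite le_eqVlt; apply/orP; left; apply/eqP; ring.
    apply: ler_pM => //; try exact: mxsum_ge0.
    exact: mxsum_mul.
  apply: le_trans (mxsumD _ _) _; apply: le_trans (lerD (lexx _) (mxsumD _ _)) _.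
  rewrite /K; lra.
pose t := K * m * e.
have t0 : 0 <= t by rewrite mulr_ge0.
have dq (x : 'cV[R]_n) : `|(x^T *m S1 *m x) 0 0 - (x^T *m S2 *m x) 0 0| <= t * (x^T *m S2 *m x) 0 0.
  have -> : (x^T *m S1 *m x) 0 0 - (x^T *m S2 *m x) 0 0 = (x^T *m (S1 - S2) *m x) 0 0.
    by rewrite mulmxBr mulmxBl [in RHS]mxE [X in _ = _ + X]mxE.
  apply: le_trans (ler_quad _ _) _.
  apply: (@le_trans _ _ (K * e * (m * (x^T *m S2 *m x) 0 0))).
    by apply: ler_pM => //; [exact: mxsum_ge0|exact: sqn_ge0].
  by rewrite le_eqVlt; apply/orP; left; apply/eqP; rewrite /t; ring.
have th : t <= 1 / 2 by [].
have q2 (x : 'cV[R]_n) : 0 <= (x^T *m S2 *m x) 0 0.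
  by have := mS2 x; have := sqn_ge0 x => h1 h2; rewrite -(pmulr_rge0 _ m0) (le_trans h1).
have pS1 : posdef S1.
  move=> x x0; have := pS2 x x0; have := dq x; rewrite ler_norml => /andP[+ _]; nra.
have tS1 : S1^T = S1 by exact: symmx_congr.
(* The relative perturbation [t] gives [S1 <= (1 + t) S2] and [(1 - t) S2 <= S1]; since
   [t <= 1 / 2], the product [(1 + 2 t) (1 - t)] is at least one, so the dilation [1 + 2 * t] serves
   both directions. *)
have := @dTV_gauss_le R n S1 S2 (1 + 2 * t) _ tS1 tS2 pS1 pS2.
move=> /(_ _ _ _) h; apply: (le_trans (h _ _ _)); first by lra.
- by move=> x; have := dq x; rewrite ler_norml => /andP[_ +]; have := q2 x; nra.
- move=> x; have := dq x; rewrite ler_norml => /andP[+ _]; have := q2 x.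
  move: ((x^T *m S1 *m x) 0 0) ((x^T *m S2 *m x) 0 0) => u v v0 uv.
  have uv' : (1 - t) * v <= u by lra.
  have u0 : 0 <= u by nra.
  have : v <= (1 + 2 * t) * u.
    apply: (@le_trans _ _ ((1 + 2 * t) * ((1 - t) * v))); last by rewrite ler_wpM2l//; lra.
    by rewrite mulrA ler_peMl//; nra.
  move=> vu; apply: le_trans vu _; rewrite ler_wpM2r// expr2; nra.
rewrite lee_fin; have t1 : 0 <= 2 * t <= 1 by lra.
apply: le_trans (exprD1_le (n + n) t1) _; rewrite /c /t.
have : 0 <= a * e by exact: mulr_ge0.
lra.
Qed.

End MatrixPerturbation.

(** * Coercivity of the mean TD matrix *)

Section TDMatrix.
Context {R : realType}.

Definition dotp n (u v : 'cV[R]_n) : R := \sum_i u i 0 * v i 0.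

Lemma dotpE n (u v : 'cV[R]_n) : (u^T *m v) 0 0 = dotp u v.
Proof. by rewrite mxE; apply: eq_bigr => i _; rewrite mxE. Qed.

Lemma dotpC n (u v : 'cV[R]_n) : dotp u v = dotp v u.
Proof. by apply: eq_bigr => i _; rewrite mulrC. Qed.

Lemma outer_quad n (v a b : 'cV[R]_n) :
  (v^T *m (a *m b^T) *m v) 0 0 = dotp v a * dotp v b.
Proof.
rewrite mulmxA -mulmxA mxE big_ord1 dotpE; congr (_ * _).
by rewrite dotpE dotpC.
Qed.

Lemma dotpBZ n (v a b : 'cV[R]_n) (k : R) :
  dotp v (a - k *: b) = dotp v a - k * dotp v b.
Proof.
rewrite /dotp mulr_sumr -sumrB; apply: eq_bigr => i _.
by rewrite !mxE; ring.
Qed.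

Lemma quad_sum n (v : 'cV[R]_n) (I : finType) (F : I -> 'M[R]_n) :
  (v^T *m (\sum_i F i) *m v) 0 0 = \sum_i (v^T *m F i *m v) 0 0.
Proof. by rewrite mulmx_sumr mulmx_suml summxE. Qed.

Lemma quadZ n (v : 'cV[R]_n) k (M : 'M[R]_n) :
  (v^T *m (k *: M) *m v) 0 0 = k * (v^T *m M *m v) 0 0.
Proof. by rewrite -scalemxAr -scalemxAl mxE. Qed.

Variables (S : finType) (d : nat) (P : S -> S -> R) (mu : S -> R).
Variables (phi : S -> 'cV[R]_d) (gamma lambda0 : R).

Lemma Sigmat_quad (v : 'cV[R]_d) :
  (v^T *m Sigmat mu phi *m v) 0 0 = \sum_x mu x * dotp v (phi x) ^+ 2.
Proof.
by rewrite quad_sum; apply: eq_bigr => x _; rewrite quadZ outer_quad expr2.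
Qed.

Lemma Sigmat_sym : (Sigmat mu phi)^T = Sigmat mu phi.
Proof.
rewrite /Sigmat linear_sum; apply: eq_bigr => x _.
by rewrite /= linearZ /= trmx_mul trmxK.
Qed.

(** The form is a sum of squares with nonnegative weights. Where it vanishes every weighted term
    vanishes, so [v] would be an eigenvector for [0], below the least eigenvalue. *)
Lemma Sigmat_posdef : (forall x, 0 <= mu x) ->
  is_lambda_min (Sigmat mu phi) lambda0 -> 0 < lambda0 -> posdef (Sigmat mu phi).
Proof.
move=> mu0 [_ lmin] l0 v v0; rewrite lt_def Sigmat_quad; apply/andP; split; last first.
  by apply: sumr_ge0 => x _; rewrite mulr_ge0// sqr_ge0.
apply/eqP => /psumr_eq0P q0.
have z x : mu x * dotp v (phi x) = 0.
  have /eqP := q0 (fun x _ => mulr_ge0 (mu0 x) (sqr_ge0 _)) x isT.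
  by rewrite mulf_eq0 expf_eq0 /= => /orP[] /eqP ->; rewrite ?mul0r ?mulr0.
have : eigenvalue (Sigmat mu phi) 0.
  apply/eigenvalueP; exists v^T; last by rewrite -[0](@trmx0 R) (inj_eq trmx_inj).
  rewrite scale0r /Sigmat mulmx_sumr big1// => x _.
  rewrite -scalemxAr mulmxA; apply/matrixP => i j.
  by rewrite !mxE big_ord1 (ord1 i) dotpE mulrA z mul0r.
by move=> /lmin; rewrite leNgt l0.
Qed.

(** With [f x] the scalar product of [v] and [phi x], the cross term [gamma * f x * f y] is at most
    [gamma / 2] times the sum of the squares, and under stationarity both squares have the same
    mean. *)
Lemma Amat_quad (v : 'cV[R]_d) : 0 <= gamma -> is_kernel P -> is_stationary P mu ->
  (1 - gamma) * (v^T *m Sigmat mu phi *m v) 0 0 <=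
  (v^T *m Amat gamma P mu phi *m v) 0 0.
Proof.
move=> g0 [P0 P1] [[mu0 _] st]; rewrite Sigmat_quad.
pose f x := dotp v (phi x).
have -> : (v^T *m Amat gamma P mu phi *m v) 0 0 =
    \sum_x \sum_y mu x * P x y * (f x * (f x - gamma * f y)).
  rewrite quad_sum; apply: eq_bigr => x _; rewrite quad_sum.
  by apply: eq_bigr => y _; rewrite quadZ outer_quad dotpBZ.
apply: (@le_trans _ _ (\sum_x \sum_y mu x * P x y *
    ((1 - gamma / 2) * f x ^+ 2 - gamma / 2 * f y ^+ 2))); last first.
  apply: ler_sum => x _; apply: ler_sum => y _; apply: ler_wpM2l.
    exact: mulr_ge0.
  have := mulr_ge0 g0 (sqr_ge0 (f x - f y)); rewrite !expr2; lra.
rewrite [leRHS](_ : _ = (1 - gamma / 2) * (\sum_x mu x * f x ^+ 2)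
   - gamma / 2 * (\sum_x mu x * f x ^+ 2)).
  by rewrite le_eqVlt; apply/orP; left; apply/eqP; rewrite -mulrBl; congr (_ * _); field.
have e1 : \sum_x \sum_y mu x * P x y * f x ^+ 2 = \sum_x mu x * f x ^+ 2.
  by apply: eq_bigr => x _; rewrite -mulr_suml -mulr_sumr P1 mulr1.
have e2 : \sum_x \sum_y mu x * P x y * f y ^+ 2 = \sum_x mu x * f x ^+ 2.
  by rewrite exchange_big; apply: eq_bigr => y _; rewrite -mulr_suml st.
rewrite -[X in _ * X - _]e1 -e2 !mulr_sumr -sumrB; apply: eq_bigr => x _.
by rewrite !mulr_sumr -sumrB; apply: eq_bigr => y _; ring.
Qed.

Lemma Amat_coercive : 0 <= gamma < 1 -> is_kernel P -> is_stationary P mu ->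
  is_lambda_min (Sigmat mu phi) lambda0 -> 0 < lambda0 ->
  exists2 c : R, 0 < c & forall v : 'cV[R]_d,
    c * sqn v <= (v^T *m Amat gamma P mu phi *m v) 0 0.
Proof.
move=> /andP[g0 g1] kP stP lmin l0.
have mu0 x : 0 <= mu x by case: stP => -[].
have [m m0 mS] := posdef_coercive Sigmat_sym (Sigmat_posdef mu0 lmin l0).
exists ((1 - gamma) / m); first by rewrite divr_gt0// subr_gt0.
move=> v; apply: le_trans _ (Amat_quad v g0 kP stP).
rewrite -mulrA; apply: ler_wpM2l; first by rewrite subr_ge0 ltW.
by rewrite ler_pdivrMl.
Qed.

Lemma sqn_gt0 n (v : 'cV[R]_n) : v != 0 -> 0 < sqn v.
Proof.
move=> v0; rewrite lt_def sqn_ge0 andbT; apply: contraNneq v0 => /psumr_eq0P h.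
apply/eqP/matrixP => i j; rewrite (ord1 j) mxE; apply/eqP.
by rewrite -sqrf_eq0 h// => k _; exact: sqr_ge0.
Qed.

End TDMatrix.

(** * Sequences *)

Section PowerSequences.
Context {R : realType}.

(* Concavity of [y `^ s], from the tangents [1 + x <= expR x] of the
   exponential at [s * ln y]. *)
Lemma powR_le_tangent (y s : R) : 0 <= y -> 0 < s <= 1 -> y `^ s <= 1 + s * (y - 1).
Proof.
move=> y0 /andP[s0 s1]; have [->|yn0] := eqVneq y 0.
  by rewrite powR0 ?gt_eqF//; lra.
have yp : 0 < y by rewrite lt_def yn0.
rewrite /powR (negbTE yn0); set L := ln y; set a := expR (s * L).
have a0 : 0 < a by exact: expR_gt0.
have yE : y = a * expR ((1 - s) * L).
  by rewrite -expRD -mulrDl addrCA subrr addr0 mul1r lnK.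
have oneE : 1 = a * expR (- (s * L)) by rewrite expRN mulfV// gt_eqF.
have h1 : a * (1 + (1 - s) * L) <= y by rewrite {1}yE ler_wpM2l ?expR_ge1Dx// ltW.
have h2 : a * (1 - s * L) <= 1 by rewrite {2}oneE ler_wpM2l ?expR_ge1Dx// ltW.
have h3 : s * (a * (1 + (1 - s) * L)) <= s * y by rewrite ler_wpM2l// ltW.
have h4 : (1 - s) * (a * (1 - s * L)) <= (1 - s) * 1 by rewrite ler_wpM2l// subr_ge0.
lra.
Qed.

Lemma powR_natS_le (a : R) n : 0 < a <= 1 -> (0 < n)%N ->
  n.+1%:R `^ a <= (1 + n%:R^-1) * n%:R `^ a.
Proof.
move=> /andP[a0 a1] n0; have np : 0 < n%:R :> R by rewrite ltr0n.
have -> : n.+1%:R = (1 + n%:R^-1) * n%:R :> R.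
  by rewrite mulrDl mul1r mulVf ?gt_eqF// -natr1.
have i0 : 0 <= n%:R^-1 :> R by rewrite invr_ge0 ltW.
rewrite powRM ?addr_ge0 ?ler0n//; apply: ler_wpM2r; first exact: powR_ge0.
apply: (le_trans (@powR_le_tangent _ a _ _)); rewrite ?addr_ge0 ?a0//.
by rewrite lerD2l [1 + _]addrC addrK ler_piMl.
Qed.

(** By concavity [(N - 1)^s <= N^s - s N^(s - 1)], so each new term is at most the increment of
    [N^s / s]. *)
Lemma sum_powR_le (s : R) n : 0 < s <= 1 ->
  \sum_(1 <= t < n.+1) t%:R `^ (s - 1) <= n%:R `^ s / s.
Proof.
move=> /andP[s0 s1]; elim: n => [|n IH].
  by rewrite big_geq// divr_ge0 ?powR_ge0// ltW.
rewrite big_nat_recr//=; apply: le_trans (lerD IH (lexx _)) _.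
have N0 : 0 < n.+1%:R :> R by rewrite ltr0n.
set N : R := n.+1%:R in N0 *.
have nE : n%:R = N * (1 - N^-1) :> R.
  by rewrite mulrBr mulr1 mulfV ?gt_eqF// /N -natr1 addrK.
have Ni : 0 <= 1 - N^-1.
  by rewrite subr_ge0 invf_le1// /N ler1n.
have h : (1 - N^-1) `^ s <= 1 - s * N^-1.
  apply: (le_trans (powR_le_tangent Ni _)); first by rewrite s0.
  by rewrite le_eqVlt; apply/orP; left; apply/eqP; ring.
have NsE : N `^ (s - 1) = N `^ s * N^-1.
  by rewrite powRD ?(gt_eqF N0) ?implybT// powR_inv1// ltW.
rewrite ler_pdivlMr// mulrDl divfK ?gt_eqF//.
rewrite nE powRM ?(ltW N0)// NsE.
by have := ler_wpM2l (powR_ge0 N s) h; rewrite mulrBr mulr1 lerBrDr mulrA mulrAC.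
Qed.

Lemma powR_large (a M : R) : 0 < a ->
  exists N : nat, forall n, (N <= n)%N -> M <= n%:R `^ a.
Proof.
move=> a0; pose M' := Num.max M 1; have M'0 : 0 < M' by rewrite lt_max ltr01 orbT.
exists (Num.truncn (M' `^ a^-1)).+1 => n Nn.
apply: (@le_trans _ _ M'); first by rewrite le_max lexx.
have -> : M' = (M' `^ a^-1) `^ a by rewrite -powRrM mulVf ?gt_eqF// powRr1// ltW.
apply: ge0_ler_powR; rewrite ?nnegrE ?powR_ge0 ?ler0n ?(ltW a0)//.
have /ltW/le_trans := truncnS_gt (M' `^ a^-1); apply.
by rewrite ler_nat.
Qed.

Lemma powR_neg_cvg0 (C a b : R) : a < b ->
  (fun n : nat => C * n%:R `^ (- b) * n%:R `^ a) @ \oo --> 0.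
Proof.
move=> ab; apply/cvgrPdist_le => e e0.
have ba0 : 0 < b - a by rewrite subr_gt0.
have [N hN] := powR_large (`|C| / e) ba0.
exists N.+1 => // n /= Nn; have n0 : (0 < n)%N by exact: leq_trans Nn.
have np : 0 < n%:R :> R by rewrite ltr0n.
rewrite sub0r normrN -mulrA -powRD ?(gt_eqF np) ?implybT//.
rewrite normrM (ger0_norm (powR_ge0 _ _)) -[- b + a]opprK powRN opprD opprK.
rewrite ler_pdivrMr ?powR_gt0// mulrC -ler_pdivrMr//.
by apply: hN; exact: ltnW.
Qed.

Variables (alpha eta0 : R).
Hypotheses (alpha01 : 0 < alpha < 1) (eta0p : 0 < eta0).
Let eta (t : nat) := eta0 * t%:R `^ (- alpha).

Lemma eta_gt0 n : (0 < n)%N -> 0 < eta n.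
Proof. by move=> n0; rewrite mulr_gt0 ?powR_gt0 ?ltr0n. Qed.

Lemma etaV n : (0 < n)%N -> (eta n)^-1 = eta0^-1 * n%:R `^ alpha.
Proof. by move=> n0; rewrite /eta invfM powRN invrK. Qed.

Lemma eta_ratio n : (0 < n)%N -> eta n / eta n.+1 <= 1 + n%:R^-1.
Proof.
move=> n0; rewrite /eta invfM powRN powRN invrK mulrACA mulfV ?gt_eqF// mul1r.
have np : 0 < n%:R :> R by rewrite ltr0n.
rewrite mulrC ler_pdivrMr ?powR_gt0//; apply: powR_natS_le => //.
by case/andP: alpha01 => -> /ltW ->.
Qed.

Lemma etaV_incr n : (0 < n)%N -> 0 <= (eta n.+1)^-1 - (eta n)^-1.
Proof.
move=> n0; rewrite !etaV// -mulrBr mulr_ge0 ?invr_ge0 ?(ltW eta0p)// subr_ge0.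
apply: ge0_ler_powR; rewrite ?nnegrE ?ler0n//.
  by case/andP: alpha01 => /ltW.
by rewrite ler_nat.
Qed.

(** For large [n] the quadratic correction costs at most half of the drift, leaving a contraction by
    [1 - c0 * eta]. Since [alpha < 1], the relative decrease of [eta], at most [1 / n], takes at
    most [c0 * eta / 2] of it; the other half absorbs the noise. *)
Lemma contraction_rate (u : nat -> R) (c0 c1 c2 : R) :
  0 < c0 -> 0 <= c1 -> 0 <= c2 -> (forall n, 0 <= u n) ->
  (forall n, u n.+1 <= (1 - 2 * c0 * eta n.+1 + c1 * eta n.+1 ^+ 2) * u n
                       + c2 * eta n.+1 ^+ 2) ->
  exists2 B : R, 0 < B & forall n, (0 < n)%N -> u n <= B * eta n.
Proof.
move=> c00 c10 c20 u0 urec; have /andP[al0 al1] := alpha01.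
have [N1 hN1] := powR_large (eta0 * (c1 / c0 + c0)) al0.
have al1' : 0 < 1 - alpha by rewrite subr_gt0.
(* The [4] is twice what is needed at index [n.+1], which pays for comparing [n.+1] with [2 * n]. *)
have [N2 hN2] := powR_large (4 / (c0 * eta0)) al1'.
pose N := (maxn N1 N2).+1.
(* The first summand lets the slack absorb the noise; the sum covers the initial segment, where
   nothing contracts yet; the [1] makes [B] positive. *)
pose B := 2 * c2 / c0 + \sum_(1 <= n < N.+1) u n / eta n + 1.
have s0 : 0 <= \sum_(1 <= n < N.+1) u n / eta n.
  rewrite big_nat_cond; apply: sumr_ge0 => n /andP[/andP[n0 _] _].
  by rewrite divr_ge0// ltW// eta_gt0.
have q0 : 0 <= 2 * c2 / c0 by rewrite divr_ge0 ?mulr_ge0// ltW.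
have B0 : 0 < B by rewrite /B; lra.
exists B => //.
have base n : (0 < n <= N)%N -> u n <= B * eta n.
  move=> nN; have /andP[n0 _] := nN; rewrite -ler_pdivrMr ?eta_gt0//.
  have : u n / eta n <= \sum_(1 <= n < N.+1) u n / eta n.
    rewrite [leRHS](bigD1_seq n) ?iota_uniq ?mem_index_iota ?ltnS//= lerDl.
    rewrite big_nat_cond; apply: sumr_ge0 => k /andP[/andP[k0 _] _].
    by rewrite divr_ge0// ltW// eta_gt0.
  by rewrite /B; lra.
elim=> // n IH _; have [nN|Nn] := leqP n.+1 N; first exact: base.
rewrite ltnS in Nn; have n0 : (0 < n)%N by apply: leq_trans Nn.
have Nn' : (maxn N1 N2 <= n.+1)%N by apply: leqW; apply: ltnW.
have /andP[N1n N2n] : (N1 <= n.+1)%N && (N2 <= n.+1)%N by rewrite -geq_max.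
have := IH n0 => {}IH; have ep := eta_gt0 (ltn0Sn n).
have np : 0 < n%:R :> R by rewrite ltr0n.
set h := eta n.+1 in ep *.
have hsmall : h * (c1 / c0 + c0) <= 1.
  have := hN1 _ N1n.
  by rewrite /h /eta powRN mulrAC ler_pdivrMr ?powR_gt0 ?ltr0n// mul1r.
have hc1 : c1 * h <= c0.
  have : h * (c1 / c0) <= 1.
    apply: le_trans hsmall; rewrite ler_wpM2l ?(ltW ep)// lerDl ltW//.
  by rewrite mulrA ler_pdivrMr// mul1r mulrC.
have hc0 : c0 * h <= 1.
  apply: le_trans hsmall; rewrite mulrC ler_wpM2l ?(ltW ep)// lerDr divr_ge0// ltW//.
have hbig : n%:R^-1 <= c0 * h / 2.
  have := hN2 _ N2n.
  have -> : n.+1%:R `^ (1 - alpha) = n.+1%:R * n.+1%:R `^ (- alpha) :> R.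
    by rewrite powRD ?pnatr_eq0 ?implybT// powRr1.
  rewrite ler_pdivrMr ?mulr_gt0// => H.
  rewrite -(ler_pM2l np) mulfV ?gt_eqF//.
  have h4 : 4 <= n.+1%:R * (c0 * h) by apply: le_trans H _; rewrite /h /eta le_eqVlt; apply/orP; left; apply/eqP; ring.
  have : n.+1%:R <= 2 * n%:R :> R by rewrite -natrM ler_nat mul2n -addnn -addn1 leq_add2l.
  have : 0 <= c0 * h by rewrite mulr_ge0// ltW.
  move=> ch0 n2; have := ler_wpM2r ch0 n2; lra.
have ratio : eta n <= (1 + n%:R^-1) * h.
  by rewrite -ler_pdivrMr//; exact: eta_ratio.
have un : u n <= B * ((1 + n%:R^-1) * h) by rewrite (le_trans IH)// ler_wpM2l// ltW.
apply: le_trans (urec n) _; rewrite -/h.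
have e1 : (1 - 2 * c0 * h + c1 * h ^+ 2) * u n <= (1 - c0 * h) * u n.
  rewrite ler_wpM2r// expr2; have := ler_wpM2r (ltW ep) hc1; lra.
have e2 : (1 - c0 * h) * u n <= (1 - c0 * h) * (B * ((1 + n%:R^-1) * h)).
  by rewrite ler_wpM2l// subr_ge0.
have e3 : (1 - c0 * h) * (1 + n%:R^-1) <= 1 - c0 * h / 2.
  have i0 : 0 <= n%:R^-1 :> R by rewrite invr_ge0 ltW.
  have : 0 <= c0 * h * n%:R^-1 by rewrite !mulr_ge0// ltW.
  lra.
have Bh : 0 <= B * h by rewrite mulr_ge0// ltW.
have e4 := ler_wpM2r Bh e3.
have e5 : c2 * h ^+ 2 <= c0 * h / 2 * (B * h).
  have : 2 * c2 <= B * c0.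
    by rewrite -ler_pdivrMr// /B; lra.
  have hh : 0 <= h ^+ 2 by rewrite sqr_ge0.
  move=> /(ler_wpM2r hh); rewrite !expr2; lra.
lra.
Qed.

End PowerSequences.

(** * Expectation, independence and the sampling model *)

Section BoundedExpectation.
Context d (T : measurableType d) (R : realType) (P : probability T R).

(** Boundedness makes the class stable under products and every member integrable, so the rules for
    [Ex] carry no further integrability conditions. *)
Definition bmeas (f : T -> R) :=
  measurable_fun setT f /\ exists M : R, forall w, `|f w| <= M.

Lemma bmeas_cst k : bmeas (fun=> k).
Proof. by split => //; exists `|k|. Qed.

Lemma bmeasD f g : bmeas f -> bmeas g -> bmeas (fun w => f w + g w).
Proof.
move=> [mf [M fM]] [mg [N gN]]; split; first exact: measurable_funD.
by exists (M + N) => w; rewrite (le_trans (ler_normD _ _))// lerD.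
Qed.

Lemma bmeasM f g : bmeas f -> bmeas g -> bmeas (fun w => f w * g w).
Proof.
move=> [mf [M fM]] [mg [N gN]]; split; first exact: measurable_funM.
by exists (M * N) => w; rewrite normrM ler_pM.
Qed.

Lemma bmeasZ k f : bmeas f -> bmeas (fun w => k * f w).
Proof. by move=> bf; apply: bmeasM => //; exact: bmeas_cst. Qed.

Lemma bmeas_sum I (r : seq I) (F : I -> T -> R) :
  (forall i, bmeas (F i)) -> bmeas (fun w => \sum_(i <- r) F i w).
Proof.
move=> bF; elim: r => [|i r IH].
  by under eq_fun do rewrite big_nil; exact: bmeas_cst.
by under eq_fun do rewrite big_cons; exact: bmeasD.
Qed.

Lemma bmeas_indic A : measurable A -> bmeas (\1_A).
Proof.
move=> mA; split; first exact: measurable_indic.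
by exists 1 => w; rewrite indicE; case: (_ \in _); rewrite ?normr1 ?normr0.
Qed.

Definition Ex (f : T -> R) : R := fine ('E_P[f]).

Lemma ExE f : Ex f = (\int[P]_w f w)%R.
Proof. by rewrite /Ex unlock. Qed.

Lemma bmeas_integrable f : bmeas f -> P.-integrable setT (EFin \o f).
Proof.
move=> [mf [M fM]]; apply: measurable_bounded_integrable => //.
  by apply: le_lt_trans (probability_le1 P measurableT) (ltry _).
by exists M; split; [exact: num_real|move=> x Mx w _; exact: le_trans (fM w) (ltW Mx)].
Qed.

Lemma Ex_cst k : Ex (fun=> k) = k.
Proof. by rewrite ExE Rintegral_cst//= probability_setT mulr1. Qed.

Lemma ExD f g : bmeas f -> bmeas g -> Ex (fun w => f w + g w) = Ex f + Ex g.
Proof. by move=> bf bg; rewrite !ExE RintegralD//; exact: bmeas_integrable. Qed.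

Lemma ExZ k f : bmeas f -> Ex (fun w => k * f w) = k * Ex f.
Proof. by move=> bf; rewrite !ExE RintegralZl//; exact: bmeas_integrable. Qed.

Lemma ExN f : bmeas f -> Ex (fun w => - f w) = - Ex f.
Proof.
by move=> bf; under eq_fun do rewrite -mulN1r; rewrite ExZ// mulN1r.
Qed.

Lemma Ex_sum I (r : seq I) (F : I -> T -> R) : (forall i, bmeas (F i)) ->
  Ex (fun w => \sum_(i <- r) F i w) = \sum_(i <- r) Ex (F i).
Proof.
move=> bF; elim: r => [|i r IH].
  by under eq_fun do rewrite big_nil; rewrite Ex_cst big_nil.
under eq_fun do rewrite big_cons.
by rewrite ExD ?IH ?big_cons//; exact: bmeas_sum.
Qed.

Lemma le_Ex f g : bmeas f -> bmeas g -> (forall w, f w <= g w) -> Ex f <= Ex g.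
Proof. by move=> bf bg fg; rewrite !ExE le_Rintegral//; exact: bmeas_integrable. Qed.

Lemma Ex_ge0 f : (forall w, 0 <= f w) -> 0 <= Ex f.
Proof. by move=> f0; rewrite ExE Rintegral_ge0. Qed.

Lemma Ex_norm_le f k : bmeas f -> (forall w, `|f w| <= k) -> `|Ex f| <= k.
Proof.
move=> bf fk; rewrite ler_norml; apply/andP; split.
  rewrite -[- k]Ex_cst; apply: le_Ex => // [|w]; first exact: bmeas_cst.
  by have := fk w; rewrite ler_norml => /andP[].
rewrite -[k]Ex_cst; apply: le_Ex => // [|w]; first exact: bmeas_cst.
by have := fk w; rewrite ler_norml => /andP[].
Qed.

Lemma Ex_indic A : measurable A -> Ex (\1_A) = fine (P A).
Proof. by move=> mA; rewrite /Ex expectation_indic. Qed.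

(** Pointwise, [1] is at most the indicator of [f <= 1] plus [f]. *)
Lemma Ex_markov f : bmeas f -> (forall w, 0 <= f w) ->
  measurable [set w | f w <= 1] /\ ((1 - Ex f)%:E <= P [set w | (f w <= 1)%R])%E.
Proof.
move=> bf f0; have mA : measurable [set w | f w <= 1].
  have -> : [set w | f w <= 1] = f @^-1` [set x | x <= 1] by [].
  rewrite -[_ @^-1` _]setTI; apply: bf.1 => //.
  by have := @measurable_itv R `]-oo, 1]; congr measurable; apply/seteqP; split => x /=; rewrite in_itv.
split => //; rewrite -[leRHS]fineK ?fin_num_measure// lee_fin -Ex_indic//.
rewrite lerBlDr -[X in X <= _](Ex_cst 1) -ExD//; last exact: bmeas_indic.
apply: le_Ex => [||w]; [exact: bmeas_cst|exact: bmeasD (bmeas_indic mA) bf|].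
rewrite indicE; case: (boolP (w \in _)) => /=.
  by move=> _; rewrite lerDl.
by rewrite notin_setE /= => /negP; rewrite -ltNge add0r => /ltW.
Qed.

Inductive simple (C : set (set T)) : (T -> R) -> Prop :=
| simple0 : simple C (fun=> 0)
| simpleS k A f : C A -> simple C f -> simple C (fun w => k * \1_A w + f w).

(* Uniform closure of the linear span of the indicators of a class of events:
   it is an algebra when the class is closed under intersection, and
   independence of two classes extends to their closures. *)
Definition span_cl (C : set (set T)) (f : T -> R) :=
  bmeas f /\ forall e : R, 0 < e ->
    exists2 g, simple C g & forall w, `|f w - g w| <= e.

Lemma simpleD C f g : simple C f -> simple C g -> simple C (fun w => f w + g w).
Proof.
move=> sf sg; elim: sf => [|k A h CA sh IH].
  by under eq_fun do rewrite add0r.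
by under eq_fun do rewrite -addrA; exact: simpleS.
Qed.

Lemma simpleZ C k f : simple C f -> simple C (fun w => k * f w).
Proof.
elim => [|l A h CA sh IH]; first by under eq_fun do rewrite mulr0; exact: simple0.
by under eq_fun do rewrite mulrDr mulrA; exact: simpleS.
Qed.

Lemma simple_indic C A : C A -> simple C (\1_A).
Proof.
move=> CA; rewrite (_ : \1_A = fun w => 1 * \1_A w + 0).
  by apply: simpleS => //; exact: simple0.
by apply/funext => w; rewrite mul1r addr0.
Qed.

Lemma simpleM C f g : (forall A B, C A -> C B -> C (A `&` B)) ->
  simple C f -> simple C g -> simple C (fun w => f w * g w).
Proof.
move=> CI; elim => [|k A h CA sh IH] sg.
  by under eq_fun do rewrite mul0r; exact: simple0.
under eq_fun do rewrite mulrDl; apply: simpleD; last exact: IH.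
under eq_fun do rewrite -mulrA; apply: simpleZ.
elim: sg => [|l B h' CB _ IH']; first by under eq_fun do rewrite mulr0; exact: simple0.
rewrite (_ : (fun w => _) = (fun w => l * \1_(A `&` B) w + \1_A w * h' w)).
  by apply: simpleS => //; exact: CI.
by apply/funext => w; rewrite indicI /=; ring.
Qed.

Lemma simple_bmeas C f : (forall A, C A -> measurable A) -> simple C f -> bmeas f.
Proof.
move=> mC; elim => [|k A h CA _ IH]; first exact: bmeas_cst.
by apply: bmeasD => //; apply: bmeasZ; exact/bmeas_indic/mC.
Qed.

Lemma span_cl_simple C f : (forall A, C A -> measurable A) -> simple C f -> span_cl C f.
Proof.
move=> mC sf; split; first exact: simple_bmeas sf.
by move=> e e0; exists f => // w; rewrite subrr normr0 ltW.
Qed.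

Lemma span_clD C f g : span_cl C f -> span_cl C g -> span_cl C (fun w => f w + g w).
Proof.
move=> [bf af] [bg ag]; split; first exact: bmeasD.
move=> e e0; have e2 : 0 < e / 2 by rewrite divr_gt0.
have [f' sf hf] := af _ e2; have [g' sg hg] := ag _ e2.
exists (fun w => f' w + g' w); first exact: simpleD.
move=> w; rewrite opprD addrACA (le_trans (ler_normD _ _))//.
by rewrite [leRHS](splitr e) lerD.
Qed.

Lemma span_clM C f g : (forall A B, C A -> C B -> C (A `&` B)) ->
  span_cl C f -> span_cl C g -> span_cl C (fun w => f w * g w).
Proof.
move=> CI [bf af] [bg ag]; split; first exact: bmeasM.
move=> e e0; have [_ [M fM]] := bf; have [_ [N gN]] := bg.
have M0 : 0 <= `|M| by []. have N0 : 0 <= `|N| by [].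
have fM' w : `|f w| <= `|M| by exact: le_trans (fM w) (ler_norm _).
have gN' w : `|g w| <= `|N| by exact: le_trans (gN w) (ler_norm _).
pose k := `|M| + `|N| + 1; have k0 : 0 < k by rewrite /k; lra.
pose e' := Num.min 1 (e / k).
have e'0 : 0 < e' by rewrite lt_min ltr01 divr_gt0.
have e'1 : e' <= 1 by rewrite ge_min lexx.
have e'k : e' * k <= e by rewrite -ler_pdivlMr// ge_min lexx orbT.
have [f' sf hf] := af _ e'0; have [g' sg hg] := ag _ e'0.
exists (fun w => f' w * g' w); first exact: simpleM.
(* The factor [g'] is written as [g - (g - g')], which is bounded by the bound of [g] plus one
   because [e' <= 1]. *)
move=> w; have -> : f w * g w - f' w * g' w =
  f w * (g w - g' w) + (g w - (g w - g' w)) * (f w - f' w) by ring.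
rewrite (le_trans (ler_normD _ _))// !normrM.
have h1 : `|f w| * `|g w - g' w| <= `|M| * e' by rewrite ler_pM.
have h2 : `|g w - (g w - g' w)| * `|f w - f' w| <= (`|N| + 1) * e'.
  rewrite ler_pM// (le_trans (ler_normB _ _))// lerD//.
  exact: le_trans (hg w) e'1.
by move: e'k; rewrite /k; lra.
Qed.

Lemma span_cl_sub C D f : (forall A, C A -> D A) -> span_cl C f -> span_cl D f.
Proof.
move=> CD [bf af]; split => // e e0; have [g sg hg] := af _ e0; exists g => //.
by elim: sg => [|k A h /CD DA _ IH]; [exact: simple0|exact: simpleS].
Qed.

Lemma Ex_indep C D f g :
  (forall A, C A -> measurable A) -> (forall A, D A -> measurable A) ->
  (forall A B, C A -> D B -> fine (P (A `&` B)) = fine (P A) * fine (P B)) ->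
  span_cl C f -> span_cl D g -> Ex (fun w => f w * g w) = Ex f * Ex g.
Proof.
move=> mC mD ind [bf af] [bg ag].
have simp f' g' : simple C f' -> simple D g' ->
    Ex (fun w => f' w * g' w) = Ex f' * Ex g'.
  move=> sf sg; have bg' := simple_bmeas mD sg.
  elim: sf => [|k A h CA sh IH].
    by under eq_fun do rewrite mul0r; rewrite !Ex_cst mul0r.
  have bh := simple_bmeas mC sh; have bA := bmeas_indic (mC _ CA).
  under eq_fun do rewrite mulrDl -mulrA.
  have bAg := bmeasM bA bg'; have bhg := bmeasM bh bg'.
  rewrite (ExD (bmeasZ k bAg) bhg) (ExD (bmeasZ k bA) bh) !ExZ// IH mulrDl.
  congr (_ + _); rewrite -mulrA; congr (_ * _).
  elim: sg {bg' IH bAg bhg} => [|l B h' DB sh' IH'].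
    by under eq_fun do rewrite mulr0; rewrite !Ex_cst mulr0.
  have bh' := simple_bmeas mD sh'; have bB := bmeas_indic (mD _ DB).
  rewrite (_ : (fun w => _) = (fun w => l * \1_(A `&` B) w + \1_A w * h' w)); last first.
    by apply/funext => w; rewrite indicI /=; ring.
  have mAB : measurable (A `&` B) by apply: measurableI; [exact: mC|exact: mD].
  have bAB := bmeas_indic mAB.
  have bAh := bmeasM bA bh'.
  rewrite (ExD (bmeasZ l bAB) bAh) (ExD (bmeasZ l bB) bh') !ExZ// IH'.
  rewrite (Ex_indic mAB) (Ex_indic (mC _ CA)) (Ex_indic (mD _ DB)) (ind _ _ CA DB).
  ring.
have [_ [M fM]] := bf; have [_ [N gN]] := bg.
have M0 : 0 <= `|M| by []. have N0 : 0 <= `|N| by [].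
have fM' w : `|f w| <= `|M| by exact: le_trans (fM w) (ler_norm _).
have gN' w : `|g w| <= `|N| by exact: le_trans (gN w) (ler_norm _).
(* The factor [2] covers two errors: one for the expectation of the product, one for the product of
   the expectations. *)
pose k := 2 * (`|M| + `|N| + 1); have k0 : 0 < k by rewrite /k; lra.
apply/eqP; rewrite -subr_eq0 -normr_le0; apply/ler_addgt0Pr => e e0; rewrite add0r.
pose e' := Num.min 1 (e / k).
have e'0 : 0 < e' by rewrite lt_min ltr01 divr_gt0.
have e'1 : e' <= 1 by rewrite ge_min lexx.
have e'k : e' * k <= e by rewrite -ler_pdivlMr// ge_min lexx orbT.
have [f' sf hf] := af _ e'0; have [g' sg hg] := ag _ e'0.
have bf' := simple_bmeas mC sf; have bg' := simple_bmeas mD sg.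
have prod_close (a b a' b' : R) : `|a| <= `|M| -> `|b| <= `|N| ->
    `|a - a'| <= e' -> `|b - b'| <= e' ->
    `|a * b - a' * b'| <= (`|M| + `|N| + 1) * e'.
  move=> aM bN aa bb; have -> : a * b - a' * b' =
    a * (b - b') + (b - (b - b')) * (a - a') by ring.
  rewrite (le_trans (ler_normD _ _))// !normrM.
  have h1 : `|a| * `|b - b'| <= `|M| * e' by rewrite ler_pM.
  have h2 : `|b - (b - b')| * `|a - a'| <= (`|N| + 1) * e'.
    by rewrite ler_pM// (le_trans (ler_normB _ _))// lerD// (le_trans bb).
  lra.
have close (a a' : T -> R) c : bmeas a -> bmeas a' -> (forall w, `|a w - a' w| <= c) ->
    `|Ex a - Ex a'| <= c.
  move=> ba ba' h; have bn : bmeas (fun w => - a' w).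
    by under eq_fun do rewrite -mulN1r; exact: bmeasZ.
  rewrite -ExN// -ExD//; apply: Ex_norm_le => //; exact: bmeasD.
have l1 : `|Ex (fun w => f w * g w) - Ex (fun w => f' w * g' w)| <= (`|M| + `|N| + 1) * e'.
  apply: close; [exact: bmeasM|exact: bmeasM|] => w.
  exact: prod_close.
have l2 : `|Ex f * Ex g - Ex f' * Ex g'| <= (`|M| + `|N| + 1) * e'.
  by apply: prod_close; [exact: Ex_norm_le|exact: Ex_norm_le|exact: close|exact: close].
rewrite -(simp _ _ sf sg) in l2.
have := ler_distD (Ex (fun w => f' w * g' w)) (Ex (fun w => f w * g w)) (Ex f * Ex g).
move=> /le_trans; apply; rewrite distrC in l2.
by move: e'k l1 l2; rewrite /k; lra.
Qed.

End BoundedExpectation.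

(** * Events and random variables generated by the samples *)

Section SamplingAlgebra.
Context {dO : measure_display} {Om : measurableType dO} {R : realType}.
Variables (Pr : probability Om R) (S : finType).
Variables (s s' : nat -> Om -> S) (rw : nat -> Om -> R).
Hypothesis mS : samples_measurable s s' rw.
Hypothesis indS : samples_independent Pr s s' rw.
Hypothesis idS : samples_ident_distr Pr s s' rw.
Hypothesis rw01 : forall t w, (0 < t)%N -> 0 <= rw t w <= 1.
Local Notation ev := (sample_event s s' rw).
Local Notation Ex := (Ex Pr).

Lemma measurable_mem_fin (f : Om -> S) (X : {set S}) :
  (forall x, measurable [set w | f w = x]) -> measurable [set w | f w \in X].
Proof.
move=> mf; rewrite (_ : [set _ | _] = \bigcup_(x in [set` X]) [set w | f w = x]).
  by apply: fin_bigcup_measurable => //; exact: finite_finset.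
by apply/seteqP; split => [w fw|w [x xX /= ->]//]; exists (f w).
Qed.

Lemma measurable_ev t X X' B : measurable B -> measurable (ev t X X' B).
Proof.
move=> mB; have [m1 [m2 m3]] := mS t.
have -> : ev t X X' B = [set w | s t w \in X] `&` ([set w | s' t w \in X'] `&` rw t @^-1` B).
  by [].
apply: measurableI; first exact: measurable_mem_fin.
apply: measurableI; first exact: measurable_mem_fin.
by rewrite -[_ @^-1` _]setTI; exact: m3.
Qed.

Lemma indic_ev t X X' B w : \1_(ev t X X' B) w =
  ((s t w \in X) && (s' t w \in X'))%:R * \1_B (rw t w) :> R.
Proof.
rewrite !indicE -natrM; congr (_%:R).
have -> : (w \in ev t X X' B) = [&& s t w \in X, s' t w \in X' & rw t w \in B].
  apply/idP/idP; first by rewrite inE => -[-> [-> /mem_set ->]].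
  by move=> /and3P[a b /set_mem c]; rewrite inE.
by rewrite andbA mulnb.
Qed.

(** Rectangles in the samples [1] to [n], the range on which independence is given. They are stable
    under intersection, which [span_cl] needs to be an algebra. *)
Definition cyl n (A : set Om) := exists (X X' : nat -> {set S}) (B : nat -> set R),
  (forall t, measurable (B t)) /\
  A = \bigcap_(t in [set` iota 1 n]) ev t (X t) (X' t) (B t).

Definition pres t (A : set Om) := exists (X X' : {set S}) (B : set R),
  measurable B /\ A = ev t X X' B.

Lemma pres_measurable t A : pres t A -> measurable A.
Proof. by move=> [X [X' [B [mB ->]]]]; exact: measurable_ev. Qed.

Lemma cyl_measurable n A : cyl n A -> measurable A.
Proof.
move=> [X [X' [B [mB ->]]]]; rewrite bigcap_seq; apply: bigsetI_measurable => t _.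
exact: measurable_ev.
Qed.

Lemma cylI n A B : cyl n A -> cyl n B -> cyl n (A `&` B).
Proof.
move=> [X [X' [D [mD ->]]]] [Y [Y' [E [mE ->]]]].
exists (fun t => X t :&: Y t), (fun t => X' t :&: Y' t), (fun t => D t `&` E t).
split; first by move=> t; exact: measurableI.
rewrite -bigcapI; apply: eq_bigcapr => t _; apply/seteqP; split => w /=.
  by move=> [[a [b c]] [a' [b' c']]]; rewrite /sample_event /= !inE a b a' b'.
by rewrite /sample_event /= !inE => -[/andP[-> ->] [/andP[-> ->] []]].
Qed.

Lemma cylT n : cyl n setT.
Proof.
exists (fun=> [set: S]%SET), (fun=> [set: S]%SET), (fun=> setT); split => //.
by apply/esym/seteqP; split => // w _ t _ /=; rewrite /sample_event /= !inE.
Qed.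

Lemma pres_cyl t n A : (0 < t <= n)%N -> pres t A -> cyl n A.
Proof.
move=> tn [X [X' [B [mB ->]]]].
exists (fun k => if k == t then X else [set: S]%SET),
  (fun k => if k == t then X' else [set: S]%SET),
  (fun k => if k == t then B else setT).
split; first by move=> k; case: ifP.
apply/seteqP; split => w.
  move=> hw k _; case: eqP => [->//|_]; by rewrite /sample_event /= !inE.
by move=> /(_ t); rewrite /= eqxx mem_iota; apply; rewrite add1n ltnS.
Qed.

Lemma cyl_le m n A : (m <= n)%N -> cyl m A -> cyl n A.
Proof.
move=> mn [X [X' [B [mB ->]]]].
exists (fun k => if (k <= m)%N then X k else [set: S]%SET),
  (fun k => if (k <= m)%N then X' k else [set: S]%SET),
  (fun k => if (k <= m)%N then B k else setT).
split; first by move=> k; case: ifP.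
apply/seteqP; split => w hw k /=; rewrite mem_iota => /andP[k0].
  move=> _; case: ifPn => km; last by rewrite /sample_event /= !inE.
  by apply: hw; rewrite /= mem_iota k0 add1n ltnS.
rewrite add1n ltnS => km; have := hw k; rewrite /= km mem_iota k0 add1n ltnS; apply.
exact: leq_trans km mn.
Qed.

Lemma cyl_pres_indep n A D : cyl n A -> pres n.+1 D ->
  fine (Pr (A `&` D)) = fine (Pr A) * fine (Pr D).
Proof.
move=> [X [X' [B [mB ->]]]] [Y [Y' [E [mE ->]]]].
have all0 m k : (0 < m)%N -> all (fun t => 0 < t)%N (iota m k).
  by move=> m0; apply/allP => t; rewrite mem_iota => /andP[/(leq_trans m0)].
(* The independence hypothesis takes one family of sides for all indices, so the sides of the past
   and of sample [n.+1] are merged. *)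
pose Z k := if (k <= n)%N then X k else Y.
pose Z' k := if (k <= n)%N then X' k else Y'.
pose F k := if (k <= n)%N then B k else E.
have mF k : measurable (F k) by rewrite /F; case: ifP.
have AE : \bigcap_(t in [set` iota 1 n]) ev t (X t) (X' t) (B t) =
   \bigcap_(t in [set` iota 1 n]) ev t (Z t) (Z' t) (F t).
  apply: eq_bigcapr => t /=; rewrite mem_iota add1n ltnS => /andP[_ tn].
  by rewrite /Z /Z' /F tn.
have DE : ev n.+1 Y Y' E = ev n.+1 (Z n.+1) (Z' n.+1) (F n.+1).
  by rewrite /Z /Z' /F ltnn.
have iE : iota 1 n.+1 = rcons (iota 1 n) n.+1 by rewrite -[in LHS](addn1 n) iotaD cats1.
have u1 : uniq (rcons (iota 1 n) n.+1) by rewrite -iE iota_uniq.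
have a1 : all (fun t => 0 < t)%N (rcons (iota 1 n) n.+1) by rewrite -iE all0.
have -> : \bigcap_(t in [set` iota 1 n]) ev t (X t) (X' t) (B t) `&` ev n.+1 Y Y' E =
    \bigcap_(t in [set` rcons (iota 1 n) n.+1]) ev t (Z t) (Z' t) (F t).
  rewrite AE DE; apply/seteqP; split => w.
    move=> [h1 h2] t /=; rewrite mem_rcons inE => /orP[/eqP ->//|tn].
    exact: h1.
  move=> h; split => [t tn|]; apply: h; rewrite /= mem_rcons inE ?eqxx//.
  by rewrite [_ \in _]tn orbT.
rewrite AE DE !indS ?iota_uniq ?all0// big_rcons /=.
by rewrite mulrC.
Qed.

(* The coefficients and events do not depend on [t], so that identity in
   distribution passes from events to functions of a sample. *)
Inductive psimple : (nat -> Om -> R) -> Prop :=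
| psimple0 : psimple (fun _ => fun=> 0)
| psimpleS k X X' B f : measurable B -> psimple f ->
    psimple (fun t w => k * \1_(ev t X X' B) w + f t w).

Lemma psimpleD f g : psimple f -> psimple g -> psimple (fun t w => f t w + g t w).
Proof.
move=> sf sg; elim: sf => [|k X X' B h mB sh IH].
  by rewrite (_ : (fun t w => _) = g)//; apply/funext => t; apply/funext => w; rewrite add0r.
rewrite (_ : (fun t w => _) = (fun t w => k * \1_(ev t X X' B) w + (h t w + g t w))).
  exact: psimpleS.
by apply/funext => t; apply/funext => w; rewrite addrA.
Qed.

Lemma psimple_sum I (r : seq I) (F : I -> nat -> Om -> R) :
  (forall i, psimple (F i)) -> psimple (fun t w => \sum_(i <- r) F i t w).
Proof.
move=> sF; elim: r => [|i r IH].
  rewrite (_ : (fun t w => _) = (fun _ => fun=> 0)); first exact: psimple0.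
  by apply/funext => t; apply/funext => w; rewrite big_nil.
rewrite (_ : (fun t w => _) = (fun t w => F i t w + \sum_(j <- r) F j t w)).
  exact: psimpleD.
by apply/funext => t; apply/funext => w; rewrite big_cons.
Qed.

Lemma psimple_ev k X X' B : measurable B -> psimple (fun t w => k * \1_(ev t X X' B) w).
Proof.
move=> mB; rewrite (_ : (fun t w => _) = (fun t w => k * \1_(ev t X X' B) w + 0)).
  by apply: psimpleS => //; exact: psimple0.
by apply/funext => t; apply/funext => w; rewrite addr0.
Qed.

Lemma psimple_pres f t : psimple f -> simple (pres t) (f t).
Proof.
elim => [|k X X' B h mB sh IH]; first exact: simple0.
by apply: simpleS => //; exists X, X', B.
Qed.

Lemma psimple_bmeas f t : psimple f -> bmeas (f t).
Proof.
by move=> sf; apply: simple_bmeas (psimple_pres t sf) => A; exact: pres_measurable.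
Qed.

Lemma psimple_ident f t : (0 < t)%N -> psimple f -> Ex (f t) = Ex (f 1%N).
Proof.
move=> t0; elim => [|k X X' B h mB sh IH]; first by rewrite !Ex_cst.
have bi u := bmeas_indic R (measurable_ev u X X' mB).
have bh u := psimple_bmeas u sh.
rewrite !(ExD Pr (bmeasZ k (bi _)) (bh _)) !(ExZ Pr k (bi _)) IH !Ex_indic; try exact: measurable_ev.
by rewrite idS.
Qed.

(** The sum counts the positive integers up to [z], hence is its integer part. It discretises a
    bounded function through its superlevel sets. *)
Lemma count_level (z : R) N : 0 <= z <= N%:R ->
  `|z - \sum_(1 <= j < N.+1) (j%:R <= z)%R%:R| <= 1.
Proof.
move=> /andP[z0 zN].
have le_N M : \sum_(1 <= j < M.+1) (j%:R <= z)%R%:R <= M%:R :> R.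
  elim: M => [|M IH]; first by rewrite big_geq.
  rewrite big_nat_recr//= -[M.+1 in leRHS]addn1 natrD lerD//.
  by case: (M.+1%:R <= z); rewrite ?ler01.
have le_z M : \sum_(1 <= j < M.+1) (j%:R <= z)%R%:R <= z.
  elim: M => [|M IH]; first by rewrite big_geq.
  rewrite big_nat_recr//=; have [Mz|_] := boolP (M.+1%:R <= z); last by rewrite addr0.
  by apply: le_trans Mz; rewrite -[M.+1 in leRHS]addn1 natrD lerD.
have ge_z M : z <= \sum_(1 <= j < M.+1) (j%:R <= z)%R%:R + 1 \/
    \sum_(1 <= j < M.+1) (j%:R <= z)%R%:R = M%:R :> R.
  elim: M => [|M IH]; first by right; rewrite big_geq.
  rewrite big_nat_recr//=; have [Mz|] := boolP (M.+1%:R <= z).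
    case: IH => [h|->]; first by left; rewrite (le_trans h)// lerDl.
    by right; rewrite -natr1.
  rewrite -ltNge addr0 => zM; case: IH => [h|->]; first by left.
  by left; rewrite natr1 ltW.
have := le_z N; rewrite ler_norml; case: (ge_z N) => [|->]; lra.
Qed.

(** Boundedness is required for rewards in [[0, 1]] only, which admits the identity as a function of
    the reward. *)
Definition good_fun (h : S -> S -> R -> R) := forall x y,
  measurable_fun setT (h x y) /\
  exists M : R, forall r, 0 <= r <= 1 -> `|h x y r| <= M.

Definition sampf (F : nat -> Om -> R) := exists2 h, good_fun h &
  forall t w, (0 < t)%N -> F t w = h (s t w) (s' t w) (rw t w).

Lemma good_fun_approx h x y (e : R) : good_fun h -> 0 < e ->
  exists2 G, psimple G & forall t w, (0 < t)%N ->
    (if (s t w == x) && (s' t w == y) then is_true (`|h x y (rw t w) - G t w| <= e)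
     else G t w = 0).
Proof.
move=> gh e0; have [mh [M0 hM0]] := gh x y.
pose M := `|M0| + 1; have Mp : 0 < M by rewrite ltr_wpDl.
have hM r : 0 <= r <= 1 -> `|h x y r| <= M.
  by move=> /hM0 /le_trans; apply; rewrite (le_trans (ler_norm _))// lerDl.
have [N Np] : exists N : nat, 2 * M / e < N.+1%:R.
  exists (Num.truncn (2 * M / e)); have := @truncnS_gt R (2 * M / e); exact.
(* [z] sends the range [[-M, M]] of [h] onto [[0, N + 1]], so unit levels of [z] are steps of height
   [c] for [h]; the indicator with coefficient [- M] undoes the shift. *)
pose z r := N.+1%:R * (h x y r + M) / (2 * M).
have mz : measurable_fun setT z.
  apply: measurable_funM => //; apply: measurable_funM => //.
  exact: measurable_funD.
pose B j := [set r | j%:R <= z r].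
have mB j : measurable (B j).
  have -> : B j = setT `&` z @^-1` `[j%:R, +oo[.
    by apply/seteqP; split => r /=; rewrite in_itv /= andbT => //; case.
  exact: mz.
pose c := 2 * M / N.+1%:R.
exists (fun t w => - M * \1_(ev t [set x]%SET [set y]%SET setT) w +
   \sum_(1 <= j < N.+2) c * \1_(ev t [set x]%SET [set y]%SET (B j)) w).
  apply: psimpleS => //; apply: psimple_sum => j; exact: psimple_ev.
move=> t w t0; rewrite indic_ev !inE indicT mulr1.
under eq_bigr do rewrite indic_ev !inE.
case: (boolP ((s t w == x) && (s' t w == y))) => _ /=; last first.
  by rewrite mulr0 add0r big1// => j _; rewrite mul0r mulr0.
rewrite mulr1; under eq_bigr do rewrite mul1r; rewrite -mulr_sumr.
set r := rw t w; have r01 : 0 <= r <= 1 by exact: rw01.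
have hz : 0 <= z r <= N.+1%:R.
  have := hM _ r01; rewrite ler_norml => /andP[h1 h2].
  rewrite /z divr_ge0 ?mulr_ge0//=; [|lra|lra].
  by rewrite ler_pdivrMr ?mulr_gt0// ler_pM2l ?ltr0Sn//; lra.
have -> : \sum_(1 <= j < N.+2) \1_(B j) r = \sum_(1 <= j < N.+2) (j%:R <= z r)%R%:R :> R.
  apply: eq_bigr => j _; rewrite indicE; congr (_%:R); congr nat_of_bool.
  by apply/idP/idP => [/set_mem//|?]; exact/mem_set.
have hE : h x y r = c * z r - M.
  by rewrite /c /z; field; rewrite gt_eqF//= pnatr_eq0.
rewrite {1}hE [X in `|X|](_ : _ = c * (z r - \sum_(1 <= j < N.+2) (j%:R <= z r)%R%:R)); last by ring.
have c0 : 0 <= c by rewrite divr_ge0// mulr_ge0// ltW.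
rewrite normrM ger0_norm//; apply: (@le_trans _ _ (c * 1)).
  by rewrite ler_wpM2l// count_level.
by rewrite mulr1 /c ler_pdivrMr ?ltr0Sn// [leRHS]mulrC -ler_pdivrMr// ltW.
Qed.

Lemma sampf_approx F (e : R) : sampf F -> 0 < e ->
  exists2 G, psimple G & forall t w, (0 < t)%N -> `|F t w - G t w| <= e.
Proof.
move=> [h gh FE] e0.
have exG (xy : S * S) : exists G : nat -> Om -> R, psimple G /\
    forall t w, (0 < t)%N ->
    (if (s t w == xy.1) && (s' t w == xy.2)
     then is_true (`|h xy.1 xy.2 (rw t w) - G t w| <= e) else G t w = 0).
  by have [G sG GP] := good_fun_approx xy.1 xy.2 gh e0; exists G.
have [G GP] := choice exG.
exists (fun t w => \sum_xy G xy t w).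
  by apply: psimple_sum => xy; case: (GP xy).
move=> t w t0; rewrite FE// (bigD1 (s t w, s' t w))//= big1 ?addr0.
  by have := (GP (s t w, s' t w)).2 t w t0; rewrite /= !eqxx.
move=> [x y] xy; have := (GP (x, y)).2 t w t0; case: ifP => //= /andP[/eqP a /eqP b].
by rewrite -a -b eqxx in xy.
Qed.

Lemma sampf_bmeas F t : (0 < t)%N -> sampf F -> bmeas (F t).
Proof.
move=> t0 [h gh FE]; have [m1 [m2 m3]] := mS t.
have -> : F t = fun w => \sum_xy \1_(ev t [set xy.1]%SET [set xy.2]%SET setT) w *
    h xy.1 xy.2 (rw t w).
  apply/funext => w; rewrite FE// (bigD1 (s t w, s' t w))//= big1 ?addr0.
    by rewrite indic_ev !inE !eqxx indicT mulr1 mul1r.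
  move=> [x y] xy; rewrite indic_ev !inE /= indicT mulr1.
  case: (boolP (_ && _)) => [/andP[/eqP a /eqP b]|_]; last by rewrite mul0r.
  by rewrite -a -b eqxx in xy.
apply: bmeas_sum => -[x y] /=; apply: bmeasM; first exact/bmeas_indic/measurable_ev.
have [mh [M hM]] := gh x y; split; first exact: measurableT_comp.
by exists M => w; apply: hM; exact: rw01.
Qed.

Lemma sampf_pres F t : (0 < t)%N -> sampf F -> span_cl (pres t) (F t).
Proof.
move=> t0 sF; split; first exact: sampf_bmeas.
move=> e e0; have [G sG hG] := sampf_approx sF e0; exists (G t); first exact: psimple_pres.
by move=> w; exact: hG.
Qed.

Lemma sampf_ident F t : (0 < t)%N -> sampf F -> Ex (F t) = Ex (F 1%N).
Proof.
move=> t0 sF; apply/eqP; rewrite -subr_eq0 -normr_le0.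
apply/ler_addgt0Pr => e e0; rewrite add0r.
have e2 : 0 < e / 2 by rewrite divr_gt0.
have [G sG hG] := sampf_approx sF e2.
have close u : (0 < u)%N -> `|Ex (F u) - Ex (G u)| <= e / 2.
  move=> u0; have bF := sampf_bmeas u0 sF; have bG := psimple_bmeas u sG.
  have bn : bmeas (fun w => - G u w).
    by under eq_fun do rewrite -mulN1r; exact: bmeasZ.
  rewrite -ExN// -ExD//; apply: Ex_norm_le; first exact: bmeasD.
  by move=> w; exact: hG.
have := close _ t0; have := close 1%N isT; rewrite (psimple_ident t0 sG).
rewrite !ler_norml; lra.
Qed.

(** Plays the role of the bounded random variables measurable with respect to the first [n]
    samples. *)
Definition past n := span_cl (R := R) (cyl n).

Lemma past_bmeas n f : past n f -> bmeas f.
Proof. by case. Qed.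

Lemma past_cst n k : past n (fun=> k).
Proof.
apply: span_cl_simple; first exact: cyl_measurable.
rewrite (_ : (fun=> k) = (fun w => k * \1_setT w)).
  by apply: simpleZ; apply: simple_indic; exact: cylT.
by apply/funext => w; rewrite indicT mulr1.
Qed.

Lemma pastD n f g : past n f -> past n g -> past n (fun w => f w + g w).
Proof. exact: span_clD. Qed.

Lemma pastM n f g : past n f -> past n g -> past n (fun w => f w * g w).
Proof. by apply: span_clM => A B; exact: cylI. Qed.

Lemma pastZ n k f : past n f -> past n (fun w => k * f w).
Proof. by move=> pf; apply: pastM => //; exact: past_cst. Qed.

Lemma past_sum n I (r : seq I) (F : I -> Om -> R) :
  (forall i, past n (F i)) -> past n (fun w => \sum_(i <- r) F i w).
Proof.
move=> pF; elim: r => [|i r IH].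
  by under eq_fun do rewrite big_nil; exact: past_cst.
by under eq_fun do rewrite big_cons; exact: pastD.
Qed.

Lemma past_le m n f : (m <= n)%N -> past m f -> past n f.
Proof. by move=> mn; apply: span_cl_sub => A; exact: cyl_le. Qed.

Lemma past_sampf F t n : (0 < t <= n)%N -> sampf F -> past n (F t).
Proof.
move=> tn sF; have /andP[t0 _] := tn.
by apply: span_cl_sub (sampf_pres t0 sF) => A; exact: pres_cyl.
Qed.

(** The form in which independence and equal distribution enter all later moment computations: a
    fresh sample may be replaced by its mean under any factor from the past. *)
Lemma past_indep n f F : past n f -> sampf F ->
  Ex (fun w => f w * F n.+1 w) = Ex f * Ex (F 1%N).
Proof.
move=> pf sF; rewrite -(sampf_ident (ltn0Sn n) sF).
apply: Ex_indep pf (sampf_pres (ltn0Sn n) sF).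
- exact: cyl_measurable.
- exact: pres_measurable.
- by move=> A B; exact: cyl_pres_indep.
Qed.

Lemma sampf_cst k : sampf (fun _ => fun=> k).
Proof.
by exists (fun _ _ => fun=> k) => // x y; split => //; exists `|k|.
Qed.

Lemma sampfD F G : sampf F -> sampf G -> sampf (fun t w => F t w + G t w).
Proof.
move=> [h gh FE] [k gk GE]; exists (fun x y r => h x y r + k x y r).
  move=> x y; have [mh [M hM]] := gh x y; have [mk [N kN]] := gk x y.
  split; first exact: measurable_funD.
  by exists (M + N) => r r01; rewrite (le_trans (ler_normD _ _))// lerD ?hM ?kN.
by move=> t w t0; rewrite FE// GE.
Qed.

Lemma sampfM F G : sampf F -> sampf G -> sampf (fun t w => F t w * G t w).
Proof.
move=> [h gh FE] [k gk GE]; exists (fun x y r => h x y r * k x y r).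
  move=> x y; have [mh [M hM]] := gh x y; have [mk [N kN]] := gk x y.
  split; first exact: measurable_funM.
  by exists (M * N) => r r01; rewrite normrM ler_pM ?hM ?kN.
by move=> t w t0; rewrite FE// GE.
Qed.

Lemma sampf_state (g : S -> S -> R) : sampf (fun t w => g (s t w) (s' t w)).
Proof.
exists (fun x y => fun=> g x y) => // x y; split => //.
by exists `|g x y|.
Qed.

Lemma sampf_rw : sampf rw.
Proof.
exists (fun _ _ => id) => // x y; split => //; exists 1 => r /andP[r0 r1].
by rewrite ger0_norm.
Qed.

(** * Fourth moments, the TD recursion and Polyak-Ruppert averaging *)

Lemma sampf_bound F : sampf F -> exists2 M : R, 0 <= M &
  forall t w, (0 < t)%N -> `|F t w| <= M.
Proof.
move=> [h gh FE].
have [M hM] := choice (fun xy : S * S => (gh xy.1 xy.2).2).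
exists (\sum_xy `|M xy|); first exact: sumr_ge0.
move=> t w t0; rewrite FE// (le_trans (hM (s t w, s' t w) _ (rw01 w t0)))//.
by rewrite (le_trans (ler_norm _))// (bigD1 (s t w, s' t w))//= lerDl sumr_ge0.
Qed.

Lemma sampf_mxsum_bound m n (M_ : nat -> Om -> 'M[R]_(m, n)) :
  (forall i j, sampf (fun t w => M_ t w i j)) -> exists2 K : R, 0 <= K &
  forall t w, (0 < t)%N -> mxsum (M_ t w) <= K.
Proof.
move=> sM; have hM ij := sampf_bound (sM ij.1 ij.2).
have [K hK] := choice (fun ij => let: ex_intro2 M M0 h := hM ij in
  ex_intro (fun M => 0 <= M /\ forall t w, (0 < t)%N -> `|M_ t w ij.1 ij.2| <= M) M (conj M0 h)).
exists (\sum_i \sum_j K (i, j)).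
  by apply: sumr_ge0 => i _; apply: sumr_ge0 => j _; case: (hK (i, j)).
move=> t w t0; apply: ler_sum => i _; apply: ler_sum => j _.
by have [_] := hK (i, j); apply.
Qed.

Lemma pastX n k f : past n f -> past n (fun w => f w ^+ k).
Proof.
move=> pf; elim: k => [|k IH]; first by under eq_fun do rewrite expr0; exact: past_cst.
by under eq_fun do rewrite exprS; exact: pastM.
Qed.

Lemma past_sampfS F n : sampf F -> past n.+1 (F n.+1).
Proof. by apply: past_sampf; rewrite /= leqnn. Qed.

Section FourthMoment.
Variable F : nat -> Om -> R.
Hypotheses (sF : sampf F) (F0 : Ex (F 1%N) = 0).
Let T n w := \sum_(0 <= t < n) F t.+1 w.

Let TS n w : T n.+1 w = T n w + F n.+1 w.
Proof. by rewrite /T big_nat_recr. Qed.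

Lemma past_psum G n : sampf G -> past n (fun w => \sum_(0 <= t < n) G t.+1 w).
Proof.
move=> sG; elim: n => [|n IH].
  by under eq_fun do rewrite big_geq//; exact: past_cst.
under eq_fun do rewrite big_nat_recr//=; apply: pastD; last exact: past_sampfS.
exact: past_le IH.
Qed.

Lemma second_moment : exists2 c : R, 0 <= c &
  forall n, Ex (fun w => T n w ^+ 2) <= c * n%:R.
Proof.
have [M M0 FM] := sampf_bound sF.
have pT n : past n (T n) by exact: past_psum.
exists (M ^+ 2); first exact: sqr_ge0.
elim=> [|n IH].
  rewrite mulr0 (_ : (fun w => _) = fun=> 0) ?Ex_cst//.
  by apply/funext => w; rewrite /T big_geq// expr0n.
have bT2 := past_bmeas (pastX 2 (pT n)).
have bTF : bmeas (fun w => 2 * T n w * F n.+1 w).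
  apply: (@past_bmeas n.+1); apply: pastM; last exact: past_sampfS.
  by apply: pastZ; exact: past_le (pT n).
apply: (@le_trans _ _ (Ex (fun w => (T n w ^+ 2 + 2 * T n w * F n.+1 w) + M ^+ 2))).
  apply: le_Ex.
  - exact: past_bmeas (pastX 2 (pT n.+1)).
  - by apply: bmeasD (bmeas_cst _ _); exact: bmeasD.
  - move=> w; rewrite TS; have := FM n.+1 w isT; rewrite ler_norml => /andP[h1 h2].
    by rewrite !expr2; nra.
rewrite (ExD Pr (bmeasD bT2 bTF) (bmeas_cst _ _)) Ex_cst (ExD Pr bT2 bTF).
rewrite (past_indep (pastZ 2 (pT n)) sF) F0 mulr0 addr0 -natr1 mulrDr mulr1.
by rewrite lerD.
Qed.

(** In the expansion of the fourth power of [T n + F n.+1] the term linear in the fresh sample has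
    mean zero. The others grow at most like the second moment, so the increments are linear in
    [n]. *)
Lemma fourth_moment : exists2 c : R, 0 <= c &
  forall n, Ex (fun w => T n w ^+ 4) <= c * n%:R ^+ 2.
Proof.
have [M M0 FM] := sampf_bound sF; have [c2 c20 h2] := second_moment.
have pT n : past n (T n) by exact: past_psum.
exists (8 * M ^+ 2 * c2 + 3 * M ^+ 4).
  by rewrite addr_ge0 ?mulr_ge0 ?exprn_ge0.
elim=> [|n IH].
  rewrite expr0n mulr0 (_ : (fun w => _) = fun=> 0) ?Ex_cst//.
  by apply/funext => w; rewrite /T big_geq// expr0n.
have bT4 := past_bmeas (pastX 4 (pT n)).
have bT2 := past_bmeas (pastX 2 (pT n)).
have bTF : bmeas (fun w => 4 * T n w ^+ 3 * F n.+1 w).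
  apply: (@past_bmeas n.+1); apply: pastM; last exact: past_sampfS.
  by apply: pastZ; apply: past_le (pastX 3 (pT n)).
have bT2' := bmeasZ (8 * M ^+ 2) bT2.
apply: (@le_trans _ _ (Ex (fun w => ((T n w ^+ 4 + 4 * T n w ^+ 3 * F n.+1 w) +
    8 * M ^+ 2 * T n w ^+ 2) + 3 * M ^+ 4))).
  apply: le_Ex.
  - exact: past_bmeas (pastX 4 (pT n.+1)).
  - by apply: bmeasD (bmeas_cst _ _); apply: bmeasD => //; exact: bmeasD.
  - move=> w; rewrite TS; set a := T n w; set x := F n.+1 w.
    have x2 : x ^+ 2 <= M ^+ 2.
      by have := FM n.+1 w isT; rewrite -/x ler_norml => /andP[h1 h3]; rewrite !expr2; nra.
    have x20 : 0 <= x ^+ 2 by exact: sqr_ge0.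
    have x4 : (x ^+ 2) ^+ 2 <= (M ^+ 2) ^+ 2 by rewrite lerXn2r// nnegrE ?sqr_ge0.
    have ax : a ^+ 2 * x ^+ 2 <= a ^+ 2 * M ^+ 2 by rewrite ler_wpM2l// sqr_ge0.
    (* This yields [4 a x^3 <= 2 a^2 x^2 + 2 x^4], turning the coefficients [6] and [1] into [8] and
       [3]. *)
    have cr : 0 <= x ^+ 2 * (a - x) ^+ 2 by rewrite mulr_ge0// sqr_ge0.
    have -> : (a + x) ^+ 4 = a ^+ 4 + 4 * a ^+ 3 * x + 6 * (a ^+ 2 * x ^+ 2) +
      (4 * a * x ^+ 3 + (x ^+ 2) ^+ 2) by ring.
    have crE : x ^+ 2 * (a - x) ^+ 2 = a ^+ 2 * x ^+ 2 - 2 * a * x ^+ 3 + (x ^+ 2) ^+ 2 by ring.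
    have -> : M ^+ 4 = (M ^+ 2) ^+ 2 by ring.
    lra.
rewrite (ExD Pr (bmeasD (bmeasD bT4 bTF) bT2') (bmeas_cst _ _)) Ex_cst.
rewrite (ExD Pr (bmeasD bT4 bTF) bT2') (ExD Pr bT4 bTF) (ExZ Pr _ bT2).
rewrite (past_indep (pastZ 4 (pastX 3 (pT n))) sF) F0 mulr0 addr0.
have h := ler_wpM2l (mulr_ge0 (ler0n R 8) (sqr_ge0 M)) (h2 n).
apply: le_trans (lerD (lerD IH h) (lexx _)) _.
set A := 8 * M ^+ 2; set D := 3 * M ^+ 4.
have A0 : 0 <= A * c2 by rewrite !mulr_ge0// sqr_ge0.
have D0 : 0 <= D by rewrite mulr_ge0// exprn_ge0.
have n0 : 0 <= n%:R :> R by [].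
rewrite -natr1 !expr2; have := mulr_ge0 A0 n0; have := mulr_ge0 D0 n0; lra.
Qed.

End FourthMoment.

(** * The error recursion and its averages *)

Section TDError.
Variables (d : nat) (A_ : nat -> Om -> 'M[R]_d) (e_ : nat -> Om -> 'cV[R]_d).
Variables (A : 'M[R]_d) (D0 : 'cV[R]_d) (c0 : R).
Hypothesis sA : forall i j, sampf (fun t w => A_ t w i j).
Hypothesis se : forall i, sampf (fun t w => e_ t w i 0).
Hypothesis EA : forall i j, Ex (fun w => A_ 1%N w i j) = A i j.
Hypothesis Ee : forall i, Ex (fun w => e_ 1%N w i 0) = 0.
Hypothesis c0p : 0 < c0.
Hypothesis coerA : forall v : 'cV[R]_d, c0 * sqn v <= (v^T *m A *m v) 0 0.
Variables (alpha eta0 : R).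
Hypotheses (alpha01 : 1 / 2 < alpha < 1) (eta0p : 0 < eta0).
Let eta (t : nat) := eta0 * t%:R `^ (- alpha).

Let alpha01' : 0 < alpha < 1.
Proof. by case/andP: alpha01 => h ->; rewrite andbT; apply: lt_trans h; lra. Qed.

(** The recursion obeyed by the error of the iterates when [e_] is the residual at the target and
    [D0] the initial error. *)
Fixpoint tderr n w : 'cV[R]_d :=
  if n is n'.+1 then
    tderr n' w - eta n'.+1 *: (A_ n'.+1 w *m tderr n' w + e_ n'.+1 w)
  else D0.

Arguments tderr : simpl never.

Lemma tderrS n w : tderr n.+1 w =
  tderr n w - eta n.+1 *: (A_ n.+1 w *m tderr n w + e_ n.+1 w).
Proof. by []. Qed.

Definition vpast n m (v : Om -> 'cV[R]_m) := forall i, past n (fun w => v w i 0).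

Lemma vpastD n m (u v : Om -> 'cV[R]_m) :
  vpast n u -> vpast n v -> vpast n (fun w => u w + v w).
Proof. by move=> pu pv i; under eq_fun do rewrite mxE; exact: pastD. Qed.

Lemma vpastZ n m k (u : Om -> 'cV[R]_m) : vpast n u -> vpast n (fun w => k *: u w).
Proof. by move=> pu i; under eq_fun do rewrite mxE; exact: pastZ. Qed.

Lemma vpastB n m (u v : Om -> 'cV[R]_m) :
  vpast n u -> vpast n v -> vpast n (fun w => u w - v w).
Proof.
by move=> pu pv; under eq_fun do rewrite -scaleN1r; apply: vpastD => //; exact: vpastZ.
Qed.

Lemma vpast_le k n m (u : Om -> 'cV[R]_m) : (k <= n)%N -> vpast k u -> vpast n u.
Proof. by move=> kn pu i; exact: past_le (pu i). Qed.

Lemma vpast_mul n m p (M : Om -> 'M[R]_(m, p)) (u : Om -> 'cV[R]_p) :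
  (forall i j, past n (fun w => M w i j)) -> vpast n u -> vpast n (fun w => M w *m u w).
Proof.
move=> pM pu i; under eq_fun do rewrite mxE.
by apply: past_sum => j; exact: pastM.
Qed.

Lemma past_sqn n m (u : Om -> 'cV[R]_m) : vpast n u -> past n (fun w => sqn (u w)).
Proof. by move=> pu; apply: past_sum => i; exact: pastX. Qed.

Lemma past_dotp n m (u v : Om -> 'cV[R]_m) :
  vpast n u -> vpast n v -> past n (fun w => dotp (u w) (v w)).
Proof. by move=> pu pv; apply: past_sum => i; exact: pastM. Qed.

Lemma vpast_tderr n : vpast n (tderr n).
Proof.
elim: n => [|n IH]; first by move=> i; exact: past_cst.
have IH' := vpast_le (leqnSn n) IH.
apply: vpastB => //; apply: vpastZ; apply: vpastD.
  by apply: vpast_mul => // i j; exact: (past_sampfS _ (sA i j)).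
by move=> i; exact: (past_sampfS _ (se i)).
Qed.

Lemma sqn_mul_le n m (M : 'M[R]_(n, m)) (v : 'cV[R]_m) :
  sqn (M *m v) <= mxsum M ^+ 2 * sqn v.
Proof.
rewrite -[M in M *m _]trmxK -quad_sqn.
apply: le_trans (ler_norm _) _; apply: le_trans (ler_quad _ _) _.
rewrite ler_wpM2r ?sqn_ge0// (le_trans (mxsum_mul _ _))// trmxK mxsum_tr expr2//.
Qed.

Lemma sqn_le_mxsum n (v : 'cV[R]_n) : sqn v <= mxsum v ^+ 2.
Proof.
have := sqn_mul_le v 1%:M; rewrite mulmx1 => /le_trans; apply.
by rewrite /sqn big_ord1 mxE eqxx expr1n mulr1.
Qed.

Lemma sqnD_le n (u v : 'cV[R]_n) : sqn (u + v) <= 2 * sqn u + 2 * sqn v.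
Proof.
rewrite /sqn !mulr_sumr -big_split /=; apply: ler_sum => i _.
by rewrite mxE; have := sqr_ge0 (u i 0 - v i 0); rewrite !expr2; lra.
Qed.

Let u n := Ex (fun w => sqn (tderr n w)).

Lemma Ex_bilinear n (f g : Om -> 'cV[R]_d) (M_ : nat -> Om -> 'M[R]_d) :
  vpast n f -> vpast n g -> (forall i j, sampf (fun t w => M_ t w i j)) ->
  Ex (fun w => dotp (f w) (M_ n.+1 w *m g w)) =
  \sum_i \sum_j Ex (fun w => f w i 0 * g w j 0) * Ex (fun w => M_ 1%N w i j).
Proof.
move=> pf pg sM.
have pij i j : past n (fun w => f w i 0 * g w j 0) by exact: pastM.
have bij i j : bmeas (fun w => (f w i 0 * g w j 0) * M_ n.+1 w i j).
  apply: (@past_bmeas n.+1); apply: pastM; first exact: past_le (pij i j).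
  exact: (past_sampfS _ (sM i j)).
rewrite (_ : (fun w => _) = (fun w => \sum_i \sum_j (f w i 0 * g w j 0) * M_ n.+1 w i j)).
  rewrite Ex_sum; last by move=> i; exact: bmeas_sum.
  apply: eq_bigr => i _; rewrite Ex_sum//; apply: eq_bigr => j _.
  by rewrite (past_indep (pij i j) (sM i j)).
apply/funext => w; apply: eq_bigr => i _; rewrite mxE mulr_sumr.
by apply: eq_bigr => j _; ring.
Qed.

Lemma Ex_quadA n : c0 * u n <= Ex (fun w => dotp (tderr n w) (A_ n.+1 w *m tderr n w)).
Proof.
have pD := @vpast_tderr n.
rewrite (Ex_bilinear pD pD sA).
have -> : \sum_i \sum_j Ex (fun w => tderr n w i 0 * tderr n w j 0) *
      Ex (fun w => A_ 1%N w i j) =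
    Ex (fun w => \sum_i \sum_j A i j * (tderr n w i 0 * tderr n w j 0)).
  have pij i j : bmeas (fun w => tderr n w i 0 * tderr n w j 0).
    by apply: past_bmeas; exact: pastM.
  rewrite Ex_sum; last by move=> i; apply: bmeas_sum => j; exact: bmeasZ.
  apply: eq_bigr => i _; rewrite Ex_sum; last by move=> j; exact: bmeasZ.
  by apply: eq_bigr => j _; rewrite EA ExZ// mulrC.
rewrite -ExZ; last exact: past_bmeas (past_sqn pD).
apply: le_Ex.
- exact/bmeasZ/past_bmeas/(past_sqn pD).
- apply: bmeas_sum => i; apply: bmeas_sum => j; apply: bmeasZ.
  by apply: past_bmeas; exact: pastM.
move=> w; apply: le_trans (coerA _) _; rewrite le_eqVlt; apply/orP; left; apply/eqP.
rewrite -mulmxA dotpE; apply: eq_bigr => i _; rewrite mxE mulr_sumr.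
by apply: eq_bigr => j _; ring.
Qed.

Lemma Ex_noise n : Ex (fun w => dotp (tderr n w) (e_ n.+1 w)) = 0.
Proof.
have pD := @vpast_tderr n.
rewrite Ex_sum.
  by apply: big1 => i _; rewrite (past_indep (pD i) (se i)) Ee mulr0.
move=> i; apply: (@past_bmeas n.+1); apply: pastM; first exact: past_le (pD i).
exact: (past_sampfS _ (se i)).
Qed.

(** Expand the square of one step: the cross term with [A_] contracts by coercivity, the one with
    the noise has mean zero, and the square of the update is bounded through the uniform bounds [K]
    and [L] of [A_] and [e_]. *)
Lemma second_moment_rec : exists c1 c2 : R, 0 <= c1 /\ 0 <= c2 /\
  forall n, u n.+1 <= (1 - 2 * c0 * eta n.+1 + c1 * eta n.+1 ^+ 2) * u n
                      + c2 * eta n.+1 ^+ 2.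
Proof.
have [K K0 hK] := sampf_mxsum_bound sA.
(* The transport carries the hypothesis from column [0] to an arbitrary index of ['I_1]. *)
have [L L0 hL] := @sampf_mxsum_bound d 1 e_ (fun i j => eq_rect _ (fun k => sampf (fun t w => e_ t w i k)) (se i) _ (esym (ord1 j))).
exists (2 * K ^+ 2), (2 * L ^+ 2); do 2 (split; first by rewrite mulr_ge0// sqr_ge0).
move=> n; have pD := @vpast_tderr n; have pD' := vpast_le (leqnSn n) pD.
have pAD : vpast n.+1 (fun w => A_ n.+1 w *m tderr n w).
  by apply: vpast_mul => // i j; exact: (past_sampfS _ (sA i j)).
have pe : vpast n.+1 (e_ n.+1) by move=> i; exact: (past_sampfS _ (se i)).
set h := eta n.+1.
have b1 := past_bmeas (past_sqn pD').
have b2 := past_bmeas (past_dotp pD' pAD).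
have b3 := past_bmeas (past_dotp pD' pe).
have hpos : 0 <= h by rewrite ltW// eta_gt0.
pose B w := (1 + 2 * K ^+ 2 * h ^+ 2) * sqn (tderr n w) +
    ((- (2 * h)) * dotp (tderr n w) (A_ n.+1 w *m tderr n w) +
     (- (2 * h)) * dotp (tderr n w) (e_ n.+1 w)) + 2 * L ^+ 2 * h ^+ 2.
have bB1 := bmeasZ (1 + 2 * K ^+ 2 * h ^+ 2) b1.
have bB2 := bmeasD (bmeasZ (- (2 * h)) b2) (bmeasZ (- (2 * h)) b3).
have EB : Ex B = (1 + 2 * K ^+ 2 * h ^+ 2) * u n -
    2 * h * Ex (fun w => dotp (tderr n w) (A_ n.+1 w *m tderr n w)) + 2 * L ^+ 2 * h ^+ 2.
  rewrite /B (ExD Pr (bmeasD bB1 bB2) (bmeas_cst _ _)) Ex_cst (ExD Pr bB1 bB2).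
  rewrite (ExD Pr (bmeasZ _ b2) (bmeasZ _ b3)) !ExZ// Ex_noise mulr0 addr0 mulNr//.
apply: (@le_trans _ _ (Ex B)).
  apply: le_Ex.
  - exact: past_bmeas (past_sqn (@vpast_tderr n.+1)).
  - exact: bmeasD (bmeasD bB1 bB2) (bmeas_cst _ _).
  move=> w; rewrite tderrS sqnBZ dotpE -/h.
  set v := tderr n w; set Av := A_ n.+1 w *m v.
  have -> : dotp v (Av + e_ n.+1 w) = dotp v Av + dotp v (e_ n.+1 w).
    by rewrite /dotp -big_split; apply: eq_bigr => i _; rewrite mxE mulrDr.
  have h1 : sqn Av <= K ^+ 2 * sqn v.
    apply: le_trans (sqn_mul_le _ _) _; rewrite ler_wpM2r ?sqn_ge0//.
    by rewrite lerXn2r ?nnegrE ?mxsum_ge0// hK.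
  have h2 : sqn (e_ n.+1 w) <= L ^+ 2.
    by apply: le_trans (sqn_le_mxsum _) _; rewrite lerXn2r ?nnegrE ?mxsum_ge0// hL.
  have h3 := sqnD_le Av (e_ n.+1 w).
  have h4 : sqn (Av + e_ n.+1 w) <= 2 * (K ^+ 2 * sqn v) + 2 * L ^+ 2 by lra.
  have := ler_wpM2l (sqr_ge0 h) h4; rewrite /B -/v -/Av; lra.
rewrite EB; have := ler_wpM2l hpos (Ex_quadA n); lra.
Qed.

Lemma tderr_rate : exists2 B : R, 0 < B & forall n, (0 < n)%N -> u n <= B * eta n.
Proof.
have [c1 [c2 [c10 [c20 rec]]]] := second_moment_rec.
apply: (contraction_rate alpha01' eta0p c0p c10 c20) => // n.
by apply: Ex_ge0 => w; exact: sqn_ge0.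
Qed.

Definition tdmart n w : 'cV[R]_d := \sum_(0 <= t < n) (A_ t.+1 w - A) *m tderr t w.

Let sAc i j : sampf (fun t w => (A_ t w - A) i j).
Proof.
rewrite (_ : (fun t w => _) = (fun t w => A_ t w i j + - A i j)).
  by apply: sampfD => //; exact: sampf_cst.
by apply/funext => t; apply/funext => w; rewrite !mxE.
Qed.

Lemma vpast_tdmart n : vpast n (tdmart n).
Proof.
elim: n => [|n IH].
  move=> i; rewrite /tdmart; under eq_fun do rewrite big_geq// mxE.
  exact: past_cst.
rewrite /tdmart; under eq_fun do rewrite big_nat_recr//=.
apply: vpastD; first exact: vpast_le IH.
apply: vpast_mul; last exact: vpast_le (@vpast_tderr n).
by move=> i j; exact: (past_sampfS (F := fun t w => (A_ t w - A) i j)).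
Qed.

(* The increments of the martingale [tdmart] are orthogonal. *)
Lemma tdmart_moment : exists2 K : R, 0 <= K & forall n,
  Ex (fun w => sqn (tdmart n w)) <= K * \sum_(0 <= t < n) u t.
Proof.
have [K K0 hK] := sampf_mxsum_bound sAc.
exists (K ^+ 2); first exact: sqr_ge0.
elim=> [|n IH].
  rewrite big_geq// mulr0 (_ : (fun w => _) = fun=> 0) ?Ex_cst//.
  by apply/funext => w; rewrite /tdmart big_geq// /sqn big1// => i _; rewrite mxE expr0n.
have pD := @vpast_tderr n; have pD' := vpast_le (leqnSn n) pD.
have pM := @vpast_tdmart n; have pM' := vpast_le (leqnSn n) pM.
pose X w := (A_ n.+1 w - A) *m tderr n w.
have pX : vpast n.+1 X.
  apply: vpast_mul => // i j.
  exact: (past_sampfS (F := fun t w => (A_ t w - A) i j)).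
have b1 := past_bmeas (past_sqn pM'); have b2 := past_bmeas (past_dotp pM' pX).
have b3 := past_bmeas (past_sqn pD').
have cross : Ex (fun w => dotp (tdmart n w) (X w)) = 0.
  rewrite (Ex_bilinear (M_ := fun t w => A_ t w - A) pM pD sAc).
  rewrite big1// => i _; rewrite big1// => j _.
  rewrite [X in _ * X](_ : _ = 0) ?mulr0//.
  under eq_fun do rewrite !mxE.
  rewrite (ExD Pr (sampf_bmeas (ltn0Sn 0) (sA i j)) (bmeas_cst _ _)) Ex_cst EA.
  exact: subrr.
apply: (@le_trans _ _ (Ex (fun w => (sqn (tdmart n w) + 2 * dotp (tdmart n w) (X w)) +
    K ^+ 2 * sqn (tderr n w)))).
  apply: le_Ex.
  - exact: past_bmeas (past_sqn (@vpast_tdmart n.+1)).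
  - by apply: bmeasD; [apply: bmeasD => //; exact: bmeasZ|exact: bmeasZ].
  move=> w; rewrite /tdmart big_nat_recr//= -/(tdmart n w) -/(X w).
  have -> : sqn (tdmart n w + X w) =
      sqn (tdmart n w) + 2 * dotp (tdmart n w) (X w) + sqn (X w).
    rewrite /sqn /dotp mulr_sumr -!big_split /=; apply: eq_bigr => i _.
    by rewrite mxE; ring.
  rewrite lerD2l; apply: le_trans (sqn_mul_le _ _) _; rewrite ler_wpM2r ?sqn_ge0//.
  by rewrite lerXn2r ?nnegrE ?mxsum_ge0// hK.
rewrite (ExD Pr (bmeasD b1 (bmeasZ 2 b2)) (bmeasZ _ b3)) (ExD Pr b1 (bmeasZ 2 b2)).
rewrite !ExZ// cross mulr0 addr0 big_nat_recr//= mulrDr.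
by rewrite lerD.
Qed.

Definition tdboundary n w : 'cV[R]_d :=
  \sum_(0 <= t < n) (eta t.+1)^-1 *: (tderr t w - tderr t.+1 w).

(** The terms [tderr n w - D0] arise from an index shift: the recursion is summed over errors [0] to
    [n - 1], the average runs over [1] to [n]. *)
Definition tdrem n w : 'cV[R]_d :=
  n%:R^-1 *: (invmx A *m (tdboundary n w - tdmart n w) + tderr n w - D0).

Let step n w : (eta n.+1)^-1 *: (tderr n w - tderr n.+1 w) =
  A_ n.+1 w *m tderr n w + e_ n.+1 w.
Proof.
by rewrite tderrS opprB addrC subrK scalerA mulVf ?scale1r// gt_eqF// eta_gt0.
Qed.

Lemma td_decomposition n w : A \in unitmx ->
  n%:R^-1 *: (\sum_(1 <= t < n.+1) tderr t w) =
  - (invmx A *m (n%:R^-1 *: \sum_(0 <= t < n) e_ t.+1 w)) + tdrem n w.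
Proof.
move=> uA.
have -> : \sum_(1 <= t < n.+1) tderr t w =
    \sum_(0 <= t < n) tderr t w + tderr n w - D0.
  by rewrite -big_nat_recr// [in RHS]big_nat_recl// addrAC subrr add0r big_add1.
have bE : tdboundary n w - tdmart n w =
    A *m (\sum_(0 <= t < n) tderr t w) + \sum_(0 <= t < n) e_ t.+1 w.
  rewrite /tdboundary /tdmart -sumrB mulmx_sumr -big_split /=; apply: eq_bigr => t _.
  rewrite step mulmxBl opprB. by rewrite [LHS]addrC [LHS]addrA subrK.
rewrite /tdrem bE mulmxDr mulKmx// -scalemxAr -scalerN -scalerDr; congr (_ *: _).
by rewrite [RHS]addrC [RHS]addrAC; congr (_ - _); rewrite [RHS]addrAC addrK.
Qed.

Lemma addr_swap (V : zmodType) (a b c e f : V) :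
  a - b + f + (c - e) = a - e + (f + (c - b)).
Proof.
rewrite -!addrA; congr (a + _); rewrite addrCA [RHS]addrCA; congr (f + _).
by rewrite addrCA [RHS]addrCA; congr (c + _); rewrite addrC.
Qed.

Lemma tdboundaryE n w : tdboundary n.+1 w =
  (eta 1)^-1 *: D0 - (eta n.+1)^-1 *: tderr n.+1 w +
  \sum_(1 <= t < n.+1) ((eta t.+1)^-1 - (eta t)^-1) *: tderr t w.
Proof.
elim: n => [|n IH].
  by rewrite /tdboundary big_nat1 [\sum_(1 <= t < 1) _]big_geq// addr0 scalerBr.
rewrite /tdboundary big_nat_recr//= -/(tdboundary n.+1 w) IH [in RHS]big_nat_recr//=.
rewrite (scalerBr (eta n.+2)^-1 (tderr n.+1 w)) scalerBl; exact: addr_swap.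
Qed.

Lemma sqnN m (v : 'cV[R]_m) : sqn (- v) = sqn v.
Proof. by apply: eq_bigr => i _; rewrite mxE sqrrN. Qed.

Lemma bmeas_sqn m (v : Om -> 'cV[R]_m) :
  (forall i, bmeas (fun w => v w i 0)) -> bmeas (fun w => sqn (v w)).
Proof.
by move=> bv; apply: bmeas_sum => i; under eq_fun do rewrite expr2; exact: bmeasM.
Qed.

(** Cauchy-Schwarz with weights [k]. It bounds the correlated errors left by summation by parts
    using only their second moments. *)
Lemma sqn_wsum m I (r : seq I) (k : I -> R) (v : I -> 'cV[R]_m) :
  (forall i, 0 <= k i) ->
  sqn (\sum_(i <- r) k i *: v i) <=
  (\sum_(i <- r) k i) * (\sum_(i <- r) k i * sqn (v i)).
Proof.
move=> k0; elim: r => [|i r IH].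
  by rewrite !big_nil mul0r /sqn big1// => i _; rewrite mxE expr0n.
rewrite !big_cons.
have sC : 0 <= \sum_(j <- r) k j by exact: sumr_ge0.
have sQ : 0 <= \sum_(j <- r) k j * sqn (v j).
  by apply: sumr_ge0 => j _; rewrite mulr_ge0 ?sqn_ge0.
move: (\sum_(j <- r) k j *: v j) (\sum_(j <- r) k j) (\sum_(j <- r) k j * sqn (v j)) IH sC sQ.
move=> V C Q IH C0 Q0.
have h1 := sqn_ge0 (V - C *: v i); rewrite sqnBZ dotpE in h1.
have -> : sqn (k i *: v i + V) = sqn V + 2 * k i * dotp V (v i) + k i ^+ 2 * sqn (v i).
  by rewrite addrC -[V + _]opprK -scaleN1r opprD -scalerN;
     rewrite /sqn /dotp !mulr_sumr -!big_split /=; apply: eq_bigr => l _; rewrite !mxE; ring.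
have q0 := sqn_ge0 (v i); have ki := k0 i.
suff h : 2 * dotp V (v i) <= Q + C * sqn (v i).
  have := ler_wpM2l ki h; rewrite expr2; lra.
have [C0'|Cp] := leP C 0; last first.
  rewrite -(ler_pM2l Cp); move: h1; rewrite expr2; lra.
have CE : C = 0 by apply/eqP; rewrite eq_le C0' C0.
have V0 : V = 0.
  apply/eqP; apply: contraT => /sqn_gt0; move: IH; rewrite CE mul0r; lra.
rewrite V0 CE /dotp big1; first by lra.
by move=> l _; rewrite mxE mul0r.
Qed.

(** The point two thirds of the way from [alpha] to [1]: the distance [s0] from [alpha] leaves room
    for a logarithm, [p < 1] makes [kappa] exceed [1/3], and [p >= 5/6] keeps the failures of the
    fourth moments below [T^(-1/3)]. *)
Let p := (alpha + 2) / 3.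
Let s0 := 2 * (1 - alpha) / 3.

Let expo : 0 < p <= 1 /\ 0 < s0 <= 1 /\ alpha + s0 = p /\ alpha <= p /\ - alpha <= p - 1.
Proof. by case/andP: alpha01 => h1 h2; rewrite /p /s0; do ! split; lra. Qed.

Let pow1 n : (0 < n)%N -> 1 <= n%:R `^ p :> R.
Proof.
move=> n0; rewrite -[leLHS](powRr0 n%:R); apply: ler_powR; first by rewrite ler1n.
by case: expo => /andP[/ltW].
Qed.

Let powle n a b : (0 < n)%N -> a <= b -> n%:R `^ a <= n%:R `^ b :> R.
Proof. by move=> n0 ab; apply: ler_powR => //; rewrite ler1n. Qed.

(* Summation by parts leaves weights [1 / eta (t + 1) - 1 / eta t] of sum
   [O(n ^ alpha)]; against [u t = O(eta t)] they sum to [O(log n)], which is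
   absorbed in [n ^ s0]. *)
Lemma tdboundary_moment : exists2 c : R, 0 <= c & forall n, (0 < n)%N ->
  Ex (fun w => sqn (tdboundary n w)) <= c * n%:R `^ p.
Proof.
have [B B0 hB] := tderr_rate; have [p01 [s01 [aps [alp _]]]] := expo.
have /andP[s00 s0le] := s01.
pose k t := (eta t.+1)^-1 - (eta t)^-1.
have k0 t : 0 <= k t.
  case: t => [|t]; last exact: (etaV_incr alpha01' eta0p (ltn0Sn t)).
  have /andP[al0 _] := alpha01'.
  (* At [t = 0] the power is [0] and so is its inverse by convention, hence [k 0] is the inverse of
     [eta 1]; [sqn_wsum] asks for a sign at every index. *)
  rewrite /k /eta powR0 ?oppr_eq0 ?gt_eqF// mulr0 invr0 subr0 invr_ge0 ltW//.
  exact: eta_gt0.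
have ku t : (0 < t)%N -> k t * u t <= B * t%:R `^ (s0 - 1).
  move=> t0; apply: (@le_trans _ _ (k t * (B * eta t))); first by rewrite ler_wpM2l ?hB.
  rewrite mulrCA ler_wpM2l ?(ltW B0)//.
  have -> : k t * eta t = eta t / eta t.+1 - 1.
    by rewrite /k mulrBl mulVf ?gt_eqF ?eta_gt0// mulrC.
  apply: (@le_trans _ _ (t%:R^-1)).
    by rewrite lerBlDl; exact: eta_ratio.
  by rewrite -powR_inv1 ?ler0n//; apply: powle => //; lra.
exists (4 * sqn D0 / eta0 ^+ 2 + 4 * B / eta0 + 2 * (B / (eta0 * s0))).
  have B0' := ltW B0; have e0' := ltW eta0p; have s0' := ltW s00.
  by do ![assumption|exact: ler0n|exact: sqn_ge0|apply: addr_ge0|apply: divr_ge0|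
          apply: mulr_ge0|apply: exprn_ge0].
case=> // n _.
pose V w := \sum_(1 <= t < n.+1) k t *: tderr t w.
have btd t i : bmeas (fun w => tderr t w i 0) by exact: past_bmeas (@vpast_tderr t i).
have bsq t : bmeas (fun w => sqn (tderr t w)) by exact: bmeas_sqn.
have bV : bmeas (fun w => sqn (V w)).
  apply: bmeas_sqn => i; rewrite /V; under eq_fun do rewrite summxE.
  by apply: bmeas_sum => t; under eq_fun do rewrite mxE; exact: bmeasZ.
have EV : Ex (fun w => sqn (V w)) <= (n.+1%:R `^ alpha / eta0) * (B * (n.+1%:R `^ s0 / s0)).
  apply: (@le_trans _ _ ((\sum_(1 <= t < n.+1) k t) * (\sum_(1 <= t < n.+1) k t * u t))).
    have -> : (\sum_(1 <= t < n.+1) k t) * (\sum_(1 <= t < n.+1) k t * u t) =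
      Ex (fun w => (\sum_(1 <= t < n.+1) k t) * (\sum_(1 <= t < n.+1) k t * sqn (tderr t w))).
      rewrite ExZ; last by apply: bmeas_sum => t; exact: bmeasZ.
      rewrite Ex_sum; last by move=> t; exact: bmeasZ.
      by congr (_ * _); apply: eq_bigr => t _; rewrite ExZ.
    apply: le_Ex => //; first by apply: bmeasZ; apply: bmeas_sum => t; exact: bmeasZ.
    by move=> w; exact: sqn_wsum.
  have u0 t : 0 <= u t by apply: Ex_ge0 => w; exact: sqn_ge0.
  apply: ler_pM; try by apply: sumr_ge0 => t _; rewrite ?mulr_ge0.
    rewrite telescope_sumr// etaV// mulrC lerBlDr lerDl invr_ge0 ltW// eta_gt0//.
  apply: (@le_trans _ _ (B * \sum_(1 <= t < n.+1) t%:R `^ (s0 - 1))).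
    rewrite mulr_sumr big_nat_cond [leRHS]big_nat_cond; apply: ler_sum => t /andP[/andP[t0 _] _].
    exact: ku.
  rewrite ler_wpM2l ?(ltW B0)//; apply: le_trans (sum_powR_le _ s01) _.
  rewrite ler_pM2r ?invr_gt0//; apply: ge0_ler_powR; rewrite ?nnegrE ?ler0n ?(ltW s00)//.
  by rewrite ler_nat.
pose N : R := n.+1%:R.
have N0 : N != 0 by rewrite pnatr_eq0.
have En : u n.+1 <= B * eta n.+1 by exact: hB.
apply: (@le_trans _ _ (Ex (fun w => (4 * ((eta 1)^-1 ^+ 2 * sqn D0) +
    4 * (eta n.+1)^-1 ^+ 2 * sqn (tderr n.+1 w)) + 2 * sqn (V w)))).
  apply: le_Ex.
  - apply: bmeas_sqn => i; rewrite /tdboundary; under eq_fun do rewrite summxE.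
    apply: bmeas_sum => t; under eq_fun do rewrite mxE; apply: bmeasZ.
    under eq_fun do rewrite mxE; apply: bmeasD => //.
    by under eq_fun do rewrite mxE -mulN1r; exact: bmeasZ.
  - by apply: bmeasD; [apply: bmeasD; [exact: bmeas_cst|exact: bmeasZ]|exact: bmeasZ].
  move=> w; rewrite tdboundaryE -/(V w); apply: le_trans (sqnD_le _ _) _.
  rewrite lerD2r -scaleNr; have := sqnD_le ((eta 1)^-1 *: D0) (- (eta n.+1)^-1 *: tderr n.+1 w).
  rewrite !sqnZ sqrrN; lra.
rewrite (ExD Pr (bmeasD (bmeas_cst _ _) (bmeasZ _ (bsq n.+1))) (bmeasZ 2 bV)).
rewrite (ExD Pr (bmeas_cst _ _) (bmeasZ _ (bsq n.+1))) Ex_cst !ExZ//.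
have Np1 : 1 <= N `^ p by exact: pow1.
have e1 : (eta 1)^-1 = eta0^-1 by rewrite etaV// powR1 mulr1.
have h1 : 4 * ((eta 1)^-1 ^+ 2 * sqn D0) <= 4 * sqn D0 / eta0 ^+ 2 * N `^ p.
  have -> : 4 * ((eta 1)^-1 ^+ 2 * sqn D0) = 4 * sqn D0 / eta0 ^+ 2.
    by rewrite e1 exprVn; ring.
  rewrite -[leLHS]mulr1 ler_wpM2l// divr_ge0 ?sqr_ge0// mulr_ge0 ?sqn_ge0//.
have h2 : 4 * (eta n.+1)^-1 ^+ 2 * u n.+1 <= 4 * B / eta0 * N `^ p.
  have e0 : 0 < eta n.+1 by exact: eta_gt0.
  apply: (@le_trans _ _ (4 * (B * (eta n.+1)^-1))).
    rewrite -mulrA ler_wpM2l//.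
    apply: (@le_trans _ _ ((eta n.+1)^-1 ^+ 2 * (B * eta n.+1))).
      by rewrite ler_wpM2l// sqr_ge0.
    rewrite le_eqVlt; apply/orP; left; apply/eqP; field.
    by rewrite gt_eqF.
  rewrite etaV// -!mulrA ler_wpM2l// ler_wpM2l ?(ltW B0)// ler_wpM2l ?invr_ge0 ?(ltW eta0p)//.
  exact: powle.
have h3 : 2 * Ex (fun w => sqn (V w)) <= 2 * (B / (eta0 * s0)) * N `^ p.
  rewrite -mulrA ler_wpM2l//; apply: le_trans EV _.
  rewrite -aps powRD ?N0 ?implybT// le_eqVlt; apply/orP; left; apply/eqP.
  by rewrite -/N; field; rewrite !gt_eqF.
by apply: le_trans (lerD (lerD h1 h2) h3) _; rewrite -!mulrDl.
Qed.

Lemma tdmart_moment_rate : exists2 c : R, 0 <= c & forall n, (0 < n)%N ->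
  Ex (fun w => sqn (tdmart n w)) <= c * n%:R `^ p.
Proof.
have [B B0 hB] := tderr_rate; have [K K0 hK] := tdmart_moment.
have [p01 [_ [_ [_ alp]]]] := expo; have /andP[p0 _] := p01.
have u0 : 0 <= u 0 by apply: Ex_ge0 => w; exact: sqn_ge0.
exists (K * (u 0 + B * eta0 / p)).
  have B0' := ltW B0; have e0' := ltW eta0p; have p0' := ltW p0.
  by do ![assumption|apply: addr_ge0|apply: divr_ge0|apply: mulr_ge0].
case=> // n _; apply: le_trans (hK _) _; rewrite -mulrA ler_wpM2l//.
(* The term [u 0] is split off because the rate [B * eta t] holds from index one on. *)
rewrite big_nat_recl//= mulrDl; apply: lerD.
  by rewrite -[leLHS]mulr1 ler_wpM2l// pow1.
rewrite -(big_add1 _ _ 0 n.+1 xpredT u) /=.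
apply: (@le_trans _ _ (B * eta0 * \sum_(1 <= t < n.+1) t%:R `^ (p - 1))).
  rewrite mulr_sumr big_nat_cond [leRHS]big_nat_cond; apply: ler_sum => t /andP[/andP[t0 _] _].
  apply: le_trans (hB t t0) _; rewrite /eta mulrA ler_wpM2l ?mulr_ge0 ?(ltW B0) ?(ltW eta0p)//.
  exact: powle.
rewrite -!mulrA ler_wpM2l ?(ltW B0)// ler_wpM2l ?(ltW eta0p)//.
apply: le_trans (sum_powR_le _ p01) _; rewrite mulrC ler_wpM2l ?invr_ge0 ?(ltW p0)//.
by apply: ge0_ler_powR; rewrite ?nnegrE ?ler0n ?ler_nat ?(ltW p0).
Qed.

Lemma bmeas_tdrem n i : bmeas (fun w => tdrem n w i 0).
Proof.
have btd t j : bmeas (fun w => tderr t w j 0) by exact: past_bmeas (@vpast_tderr t j).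
have bm j : bmeas (fun w => tdmart n w j 0) by exact: past_bmeas (@vpast_tdmart n j).
rewrite /tdrem; under eq_fun do rewrite mxE mxE; apply: bmeasZ.
apply: bmeasD (bmeas_cst _ _).
under eq_fun do rewrite mxE; apply: bmeasD => //.
under eq_fun do rewrite mxE; apply: bmeas_sum => j; apply: bmeasZ.
under eq_fun do rewrite mxE; apply: bmeasD.
  rewrite /tdboundary; under eq_fun do rewrite summxE.
  apply: bmeas_sum => t; under eq_fun do rewrite mxE; apply: bmeasZ.
  under eq_fun do rewrite mxE; apply: bmeasD => //.
  by under eq_fun do rewrite mxE -mulN1r; exact: bmeasZ.
by under eq_fun do rewrite mxE -mulN1r; exact: bmeasZ.
Qed.

Lemma tdrem_moment : exists2 c : R, 0 <= c & forall n, (0 < n)%N ->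
  Ex (fun w => sqn (tdrem n w)) <= c * (n%:R^-1 ^+ 2 * n%:R `^ p).
Proof.
have [cb cb0 hb] := tdboundary_moment; have [cm cm0 hm] := tdmart_moment_rate.
have [B B0 hB] := tderr_rate; have [p01 [_ [_ [_ alp]]]] := expo.
pose a := mxsum (invmx A) ^+ 2; have a0 : 0 <= a by exact: sqr_ge0.
exists (4 * a * (2 * cb + 2 * cm) + 4 * (B * eta0) + 2 * sqn D0).
  have B0' := ltW B0; have e0' := ltW eta0p.
  by do ![assumption|exact: ler0n|exact: sqn_ge0|apply: addr_ge0|apply: mulr_ge0].
move=> n n0.
have bb : bmeas (fun w => sqn (tdboundary n w)).
  apply: bmeas_sqn => i; rewrite /tdboundary; under eq_fun do rewrite summxE.
  apply: bmeas_sum => t; under eq_fun do rewrite mxE; apply: bmeasZ.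
  under eq_fun do rewrite mxE; apply: bmeasD; first exact: past_bmeas (@vpast_tderr t i).
  under eq_fun do rewrite mxE -mulN1r; apply: bmeasZ.
  exact: past_bmeas (@vpast_tderr t.+1 i).
have bm : bmeas (fun w => sqn (tdmart n w)) by exact: past_bmeas (past_sqn (@vpast_tdmart n)).
have bt : bmeas (fun w => sqn (tderr n w)) by exact: past_bmeas (past_sqn (@vpast_tderr n)).
pose G w := (4 * a * (2 * sqn (tdboundary n w) + 2 * sqn (tdmart n w)) +
   4 * sqn (tderr n w)) + 2 * sqn D0.
have bG1 : bmeas (fun w => 2 * sqn (tdboundary n w) + 2 * sqn (tdmart n w)).
  by apply: bmeasD; exact: bmeasZ.
have bG2 := bmeasZ (4 * a) bG1; have bG3 := bmeasZ 4 bt.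
have EG : Ex G <= (4 * a * (2 * cb + 2 * cm) + 4 * (B * eta0) + 2 * sqn D0) * n%:R `^ p.
  rewrite /G (ExD Pr (bmeasD bG2 bG3) (bmeas_cst _ _)) Ex_cst (ExD Pr bG2 bG3).
  rewrite (ExZ Pr _ bG1) (ExD Pr (bmeasZ 2 bb) (bmeasZ 2 bm)) !ExZ//.
  have g1 : 2 * Ex (fun w => sqn (tdboundary n w)) + 2 * Ex (fun w => sqn (tdmart n w)) <=
     (2 * cb + 2 * cm) * n%:R `^ p by have := hb n n0; have := hm n n0; lra.
  have g2 : u n <= B * eta0 * n%:R `^ p.
    apply: le_trans (hB n n0) _; rewrite /eta mulrA ler_wpM2l ?mulr_ge0 ?(ltW B0) ?(ltW eta0p)//.
    by apply: powle => //; case/andP: p01 => q1 q2; apply: le_trans alp _; lra.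
  have g3 : sqn D0 <= sqn D0 * n%:R `^ p.
    by rewrite -[leLHS]mulr1 ler_wpM2l ?sqn_ge0// pow1.
  have h := ler_wpM2l (mulr_ge0 (ler0n R 4) a0) g1.
  apply: le_trans (lerD (lerD h (ler_wpM2l (ler0n R 4) g2)) (ler_wpM2l (ler0n R 2) g3)) _.
  by rewrite le_eqVlt; apply/orP; left; apply/eqP; ring.
apply: (@le_trans _ _ (Ex (fun w => n%:R^-1 ^+ 2 * G w))); last first.
  rewrite ExZ; last by apply: bmeasD (bmeas_cst _ _); exact: bmeasD.
  by rewrite mulrCA; apply: ler_wpM2l EG; exact: sqr_ge0.
apply: le_Ex.
- by apply: bmeas_sqn => i; exact: bmeas_tdrem.
- by apply: bmeasZ; apply: bmeasD (bmeas_cst _ _); exact: bmeasD.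
move=> w; rewrite /tdrem sqnZ ler_wpM2l ?sqr_ge0//.
apply: le_trans (sqnD_le _ _) _; rewrite sqnN /G lerD2r.
set X := invmx A *m _.
have h1 := sqnD_le X (tderr n w).
have h2 : sqn X <= a * (2 * sqn (tdboundary n w) + 2 * sqn (tdmart n w)).
  apply: le_trans (sqn_mul_le _ _) _; rewrite -/a ler_wpM2l//.
  by apply: le_trans (sqnD_le _ _) _; rewrite sqnN.
lra.
Qed.

End TDError.

(** * Simultaneous concentration *)

Section GoodEvent.
Variables (I : finType) (F : I -> nat -> Om -> R) (m : nat).
Variables (rem : nat -> Om -> 'cV[R]_m) (alpha crem : R).
Hypothesis sF : forall k, sampf (F k).
Hypothesis F0 : forall k, Ex (F k 1%N) = 0.
Hypothesis alpha01 : 1 / 2 < alpha < 1.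
Hypothesis brem : forall n i, bmeas (fun w => rem n w i 0).
Hypothesis crem0 : 0 <= crem.
Hypothesis rem_moment : forall n, (0 < n)%N ->
  Ex (fun w => sqn (rem n w)) <= crem * (n%:R^-1 ^+ 2 * n%:R `^ ((alpha + 2) / 3)).
Let kappa := 1 / 2 - alpha / 6.

(* Markov's inequality for the fourth moments of the averages and the second
   moment of the remainder, at the scale [T `^ - kappa]; the exponent is chosen so
   that the latter fails with probability of order [T `^ - (1 / 3)] exactly. *)
Lemma good_event : exists2 D : R, 0 <= D & forall T, (0 < T)%N ->
  exists2 E : set Om, measurable E /\ ((1 - T%:R `^ (- (1 / 3)))%:E <= Pr E)%E &
  forall w, E w ->
    (forall k, `|T%:R^-1 * \sum_(0 <= t < T) F k t.+1 w| <= D * T%:R `^ (- kappa)) /\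
    (forall i, `|rem T w i 0| <= D * T%:R `^ (- kappa)).
Proof.
have [c hc] := choice (fun k => let: ex_intro2 c c0 h := fourth_moment (sF k) (F0 k) in
  ex_intro (fun c => 0 <= c /\ forall n,
    Ex (fun w => (\sum_(0 <= t < n) F k t.+1 w) ^+ 4) <= c * n%:R ^+ 2) c (conj c0 h)).
have c0 k : 0 <= c k by case: (hc k).
have sc0 : 0 <= \sum_k c k by exact: sumr_ge0.
(* [D ^+ 2] exceeds the sum of all moment constants, which normalises the failure probability to
   exactly [T^(-1/3)]. *)
pose D := 1 + \sum_k c k + crem.
have D1 : 1 <= D by rewrite /D -addrA lerDl addr_ge0.
have D0 : 0 < D by lra.
exists D; first exact: ltW.
move=> T T0; have /andP[al1 al2] := alpha01.
pose x : R := T%:R; have x1 : 1 <= x by rewrite ler1n.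
have x0 : 0 < x by lra.
have xn0 : x != 0 by rewrite gt_eqF.
pose del := D * x `^ (- kappa).
have del0 : 0 < del by rewrite mulr_gt0// powR_gt0.
have Dn0 : D != 0 by rewrite gt_eqF.
have Px0 : x `^ (- kappa) != 0 by rewrite gt_eqF// powR_gt0.
pose S_ k w := \sum_(0 <= t < T) F k t.+1 w.
have bS k : bmeas (fun w => (S_ k w) ^+ 4).
  by apply: past_bmeas; apply: pastX; exact: (past_psum T (sF k)).
have br : bmeas (fun w => sqn (rem T w)) by apply: bmeas_sqn => i; exact: brem.
(* A single use of Markov's inequality on the sum of all normalised deviations replaces a union
   bound: the summands are nonnegative, so [Y w <= 1] bounds each one. *)
pose Y w := \sum_k (x * del) ^- 4 * S_ k w ^+ 4 + del ^- 2 * sqn (rem T w).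
have xd0 : 0 < x * del by rewrite mulr_gt0.
have bY1 : bmeas (fun w => \sum_k (x * del) ^- 4 * S_ k w ^+ 4).
  by apply: bmeas_sum => k; exact: bmeasZ.
have bY : bmeas Y by apply: bmeasD => //; exact: bmeasZ.
have t10 k w : 0 <= (x * del) ^- 4 * S_ k w ^+ 4.
  by rewrite mulr_ge0 ?invr_ge0 ?exprn_even_ge0.
have t20 w : 0 <= del ^- 2 * sqn (rem T w).
  by rewrite mulr_ge0 ?invr_ge0 ?sqr_ge0 ?sqn_ge0.
have Y0 w : 0 <= Y w by rewrite addr_ge0// sumr_ge0.
have EY : Ex Y <= x `^ (- (1 / 3)).
  rewrite (ExD Pr bY1 (bmeasZ _ br)) Ex_sum; last by move=> k; exact: bmeasZ.
  rewrite (ExZ Pr _ br).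
  have xk2 : x `^ (- kappa) ^+ 2 = x `^ (- kappa *+ 2).
    by rewrite -powR_mulrn ?powR_ge0// -powRrM mulr_natr.
  have a1 : del ^- 2 * (crem * (x^-1 ^+ 2 * x `^ ((alpha + 2) / 3))) =
      crem / D ^+ 2 * x `^ (- (1 / 3)).
    have -> : x `^ (- (1 / 3)) = (x `^ (- kappa) ^+ 2)^-1 * (x^-1 ^+ 2 * x `^ ((alpha + 2) / 3)).
      rewrite xk2 -powRN -[x^-1](powR_inv1 (ltW x0)) -powR_mulrn ?powR_ge0// -powRrM.
      by rewrite -!powRD ?xn0 ?implybT//; congr powR; rewrite /kappa; field.
    by rewrite /del; field; rewrite ?Px0 ?Dn0 ?xn0.
  have a2 k : (x * del) ^- 4 * (c k * x ^+ 2) <= c k / D ^+ 2 * x `^ (- (1 / 3)).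
    have e1 : x ^+ 2 / (x * del) ^+ 4 = D ^- 4 * x `^ (- 2 + kappa *+ 4).
      have xk4 : x `^ (kappa *+ 4) = x `^ (- kappa) ^- 4.
        by rewrite -[X in _ = X^-1]powR_mulrn ?powR_ge0// -powRrM -powRN mulNr opprK mulr_natr.
      have x2 : x `^ (- 2) = x ^- 2 by rewrite powRN powR_mulrn// ltW.
      rewrite powRD ?xn0 ?implybT// xk4 x2 /del.
      by field; rewrite ?Px0 ?Dn0 ?xn0.
    (* The exponent on the left is [- 2 * alpha / 3], so [alpha > 1/2] enters here. *)
    have e2 : x `^ (- 2 + kappa *+ 4) <= x `^ (- (1 / 3)).
      by apply: ler_powR => //; rewrite /kappa; lra.
    rewrite mulrCA -mulrA ler_wpM2l// mulrC e1.
    apply: ler_pM => //; rewrite ?invr_ge0 ?exprn_ge0 ?powR_ge0 ?(ltW D0)//.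
    by rewrite lef_pV2 ?posrE ?exprn_gt0// ler_weXn2l.
  apply: (@le_trans _ _ (\sum_k c k / D ^+ 2 * x `^ (- (1 / 3)) + crem / D ^+ 2 * x `^ (- (1 / 3)))).
    apply: lerD.
      apply: ler_sum => k _; rewrite ExZ//; apply: le_trans _ (a2 k).
      by rewrite ler_wpM2l ?invr_ge0 ?exprn_even_ge0//; apply: (hc k).2.
    rewrite -a1 ler_wpM2l ?invr_ge0 ?sqr_ge0//; exact: rem_moment.
  rewrite -!mulr_suml -mulrDl -mulrDl -[leRHS]mul1r ler_wpM2r ?powR_ge0//.
  rewrite ler_pdivrMr ?exprn_gt0// mul1r expr2.
  by apply: (@le_trans _ _ (D * 1)); [rewrite /D; lra|rewrite ler_wpM2l// ltW].
have [mE PE] := Ex_markov Pr bY Y0.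
exists [set w | Y w <= 1]; first split => //.
  by apply: le_trans PE; rewrite lee_fin; move: EY; rewrite -/x; lra.
move=> w /= Yw; rewrite -/x -/del; split => [k|i].
  have : (x * del) ^- 4 * S_ k w ^+ 4 <= 1.
    apply: le_trans Yw; rewrite /Y (bigD1 k)//= -addrA lerDl addr_ge0//.
    by apply: sumr_ge0.
  rewrite ler_pdivrMl ?exprn_gt0// mulr1 => h.
  have : `|S_ k w| <= x * del.
    rewrite -(@ler_pXn2r _ 4)// ?nnegrE ?(ltW xd0)//.
    by rewrite -normrX ger0_norm// exprn_even_ge0.
  by rewrite normrM normfV (gtr0_norm x0) ler_pdivrMl.
have : del ^- 2 * sqn (rem T w) <= 1.
  by apply: le_trans Yw; rewrite /Y lerDr sumr_ge0.
rewrite ler_pdivrMl ?exprn_gt0// mulr1 => h.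
rewrite -(@ler_pXn2r _ 2)// ?nnegrE ?(ltW del0)//.
apply: le_trans h; rewrite real_normK ?num_real// /sqn (bigD1 i)//= lerDl.
by apply: sumr_ge0 => j _; exact: sqr_ge0.
Qed.

End GoodEvent.
End SamplingAlgebra.

(** * The theorem *)

Section Averages.
Context {R : realType}.

Lemma mxsum_avg m n (X : nat -> 'M[R]_(m, n)) (M : R) T : (0 < T)%N ->
  (forall t, (0 < t)%N -> mxsum (X t) <= M) ->
  mxsum (T%:R^-1 *: \sum_(1 <= t < T.+1) X t) <= M.
Proof.
move=> T0 hX; have Tp : 0 < T%:R :> R by rewrite ltr0n.
rewrite mxsumZ gtr0_norm ?invr_gt0// ler_pdivrMl//.
apply: le_trans (mxsum_sum _ _) _.
apply: (@le_trans _ _ (\sum_(1 <= t < T.+1) M)).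
  rewrite big_nat_cond [leRHS]big_nat_cond; apply: ler_sum => t /andP[/andP[t0 _] _].
  exact: hX.
by rewrite sumr_const_nat subSS subn0 mulr_natl.
Qed.

Lemma mxsum_le_const m n (M : 'M[R]_(m, n)) (k : R) :
  (forall i j, `|M i j| <= k) -> mxsum M <= (m * n)%:R * k.
Proof.
move=> h; apply: (@le_trans _ _ (\sum_(i < m) \sum_(j < n) k)).
  by apply: ler_sum => i _; apply: ler_sum => j _.
by rewrite !sumr_const !card_ord -mulrnA mulr_natl mulnC.
Qed.

(** The residual at [th] is [e t + A t *m (th - th0)]. Only the outer product of [e t] with itself
    needs an average; the other three are bounded sample by sample, so [th] may depend on all the
    samples. *)
Lemma Gammahat_perturb d (A : nat -> 'M[R]_d) (b e : nat -> 'cV[R]_d)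
    (th th0 : 'cV[R]_d) (G : 'M[R]_d) (K L h : R) T : (0 < T)%N ->
  (forall t, (0 < t)%N -> e t = A t *m th0 - b t) ->
  (forall t, (0 < t)%N -> mxsum (A t) <= K) ->
  (forall t, (0 < t)%N -> mxsum (e t) <= L) ->
  mxsum (th - th0) <= h ->
  mxsum (Gammahat A b th T - G) <=
  mxsum (T%:R^-1 *: \sum_(1 <= t < T.+1) (e t *m (e t)^T) - G) +
  (2 * L * (K * h) + (K * h) ^+ 2).
Proof.
move=> T0 eE AK eL hh; pose v t := A t *m (th - th0).
pose X t := e t *m (v t)^T + v t *m (e t)^T + v t *m (v t)^T.
have -> : Gammahat A b th T =
    T%:R^-1 *: \sum_(1 <= t < T.+1) (e t *m (e t)^T) + T%:R^-1 *: \sum_(1 <= t < T.+1) X t.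
  rewrite -scalerDr -big_split /=; congr (_ *: _).
  apply: eq_big_nat => t /andP[t0 _].
  have -> : A t *m th - b t = e t + v t.
    by rewrite eE// /v mulmxBr [RHS]addrC [RHS]addrA subrK.
  have -> : (e t + v t)^T = (e t)^T + (v t)^T by apply/matrixP => i j; rewrite !mxE.
  by rewrite mulmxDl !mulmxDr /X !addrA.
rewrite addrAC; apply: le_trans (mxsumD _ _) _; rewrite lerD2l.
apply: mxsum_avg => // t t0.
have K0 : 0 <= K by exact: le_trans (mxsum_ge0 _) (AK 1%N isT).
have vle : mxsum (v t) <= K * h.
  apply: le_trans (mxsum_mul _ _) _; apply: ler_pM; rewrite ?mxsum_ge0//; exact: AK.
have el := eL t t0.
have ge0 := @mxsum_ge0 R.
have x1 : mxsum (e t *m (v t)^T) <= L * (K * h).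
  by apply: le_trans (mxsum_mul _ _) _; rewrite mxsum_tr ler_pM.
have x2 : mxsum (v t *m (e t)^T) <= L * (K * h).
  by apply: le_trans (mxsum_mul _ _) _; rewrite mxsum_tr mulrC ler_pM.
have x3 : mxsum (v t *m (v t)^T) <= (K * h) ^+ 2.
  by apply: le_trans (mxsum_mul _ _) _; rewrite mxsum_tr expr2 ler_pM.
apply: le_trans (mxsumD _ _) _; apply: le_trans (lerD (mxsumD _ _) (lexx _)) _.
lra.
Qed.

Lemma opnorm_ge0 m n (M : 'M[R]_(m, n)) : 0 <= opnorm M.
Proof.
have ge0 x : [set l2norm (M *m x) | x in [set x : 'cV[R]_n | l2norm x <= 1]] x -> 0 <= x.
  by move=> [y _ <-]; exact: sqrtr_ge0.
(* By convention [sup] is [0] when there is no supremum, so both cases are nonnegative. *)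
rewrite /opnorm; have [hs|/sup_out ->//] := pselect (has_sup
  [set l2norm (M *m x) | x in [set x : 'cV[R]_n | l2norm x <= 1]]).
have [[y Sy] ub] := hs.
by apply: le_trans (ge0 y Sy) _; exact: ub_le_sup.
Qed.

End Averages.

(** * Means of functions of one sample *)

Section SampleMoments.
Context {dO : measure_display} {Om : measurableType dO} {R : realType}.
Variables (Pr : probability Om R) (S : finType).
Variables (s s' : nat -> Om -> S) (rw : nat -> Om -> R).
Variables (P : S -> S -> R) (mu r : S -> R).
Hypothesis mS : samples_measurable s s' rw.
Hypothesis law : samples_law Pr s s' rw P mu r.

Lemma Ex_state (g : S -> S -> R) t : (0 < t)%N ->
  Ex Pr (fun w => g (s t w) (s' t w)) = \sum_x \sum_y (mu x * P x y) * g x y.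
Proof.
move=> t0; have [lawP _] := law t0.
have mev x y : measurable [set w | s t w = x /\ s' t w = y].
  by have [m1 [m2 _]] := mS t; exact: (measurableI _ _ (m1 x) (m2 y)).
rewrite (_ : (fun w => _) =
    (fun w => \sum_x \sum_y g x y * \1_[set w | s t w = x /\ s' t w = y] w)).
  rewrite Ex_sum; last first.
    by move=> x; apply: bmeas_sum => y; apply: bmeasZ; exact: bmeas_indic.
  apply: eq_bigr => x _; rewrite Ex_sum; last first.
    by move=> y; apply: bmeasZ; exact: bmeas_indic.
  apply: eq_bigr => y _; rewrite ExZ; last exact: bmeas_indic.
  by rewrite Ex_indic// lawP mulrC.
apply/funext => w; rewrite (bigD1 (s t w))//= (bigD1 (s' t w))//= !big1 ?addr0.
- by rewrite indicE mem_set// mulr1.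
- move=> x xs; rewrite big1// => y _; rewrite indicE memNset ?mulr0//= => -[sx _].
  by rewrite sx eqxx in xs.
- move=> y ys; rewrite indicE memNset ?mulr0//= => -[_ sy].
  by rewrite sy eqxx in ys.
Qed.

Lemma Ex_reward (g : S -> R) t : (0 < t)%N ->
  Ex Pr (fun w => rw t w * g (s t w)) = \sum_x (mu x * r x) * g x.
Proof.
move=> t0; have [_ [r01 Er]] := law t0.
have bterm x : bmeas (fun w => rw t w * (s t w == x)%:R).
  have [m1 [_ m3]] := mS t; apply: bmeasM.
    by split => //; exists 1 => w; have /andP[a b] := r01 w; rewrite ger0_norm.
  rewrite (_ : (fun w => _) = \1_[set w | s t w = x]); first exact/bmeas_indic/m1.
  apply/funext => w; rewrite indicE; congr (_%:R); congr nat_of_bool.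
  by apply/eqP/idP => [?|/set_mem//]; exact/mem_set.
rewrite (_ : (fun w => _) = (fun w => \sum_x g x * (rw t w * (s t w == x)%:R))).
  rewrite Ex_sum; last by move=> x; exact: bmeasZ.
  apply: eq_bigr => x _; rewrite ExZ//.
  by rewrite /Ex Er /= mulrC [r x * _]mulrC.
apply/funext => w; rewrite (bigD1 (s t w))//= big1 ?addr0.
  by rewrite eqxx mulr1 mulrC.
by move=> x xs; rewrite eq_sym (negbTE xs) !mulr0.
Qed.

End SampleMoments.

(** The error starts at [- th] because the iterates start at [0]. Any reference point [th] is
    allowed; centring of the noise comes only with the choice of the fixed point. *)
Lemma td_iter_error {R : realType} {dO : measure_display} {Om : measurableType dO} d (eta0 alpha : R)
    (A : nat -> Om -> 'M[R]_d) (b : nat -> Om -> 'cV[R]_d) (th : 'cV[R]_d) t w :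
  td_iter (fun t : nat => eta0 * t%:R `^ (- alpha)) (A ^~ w) (b ^~ w) t =
  tderr A (fun t w => A t w *m th - b t w) (- th) alpha eta0 t w + th.
Proof.
elim: t => [|t IH]; first by rewrite addNr.
rewrite tderrS /= IH mulmxDr; set v := tderr _ _ _ _ _ _ _.
by rewrite [RHS]addrAC -[A t.+1 w *m v + _ - _]addrA.
Qed.

Theorem theorem3 (R : realType) :
  exists C : R, 0 < C /\
  forall (S : finType) (d : nat) (gamma alpha eta0 lambda0 : R)
    (P : S -> S -> R) (mu r : S -> R) (phi : S -> 'cV[R]_d)
    (dO : measure_display) (Om : measurableType dO) (Pr : probability Om R)
    (s s' : nat -> Om -> S) (rw : nat -> Om -> R),
  0 <= gamma < 1 ->
  is_kernel P -> unique_stationary P mu ->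
  (forall x, 0 <= r x <= 1) ->
  (forall x, l2norm (phi x) <= 1) ->
  is_lambda_min (Sigmat mu phi) lambda0 -> 0 < lambda0 ->
  samples_measurable s s' rw ->
  samples_independent Pr s s' rw ->
  samples_ident_distr Pr s s' rw ->
  samples_law Pr s s' rw P mu r ->
  1/2 < alpha < 1 -> 0 < eta0 < 1/2 ->
  let eta := fun t : nat => eta0 * t%:R `^ (- alpha) in
  let A := Amat gamma P mu phi in
  let thetastar := invmx A *m bvec mu r phi in
  let At_ := fun t w => At gamma phi (s t w) (s' t w) in
  let bt_ := fun t w => bt phi (s t w) (rw t w) in
  let Gamma := \matrix_(i < d, j < d)
      fine (('E_Pr[fun w => (((At_ 1%N w *m thetastar - bt_ 1%N w) *m
                            (At_ 1%N w *m thetastar - bt_ 1%N w)^T) i j)%R])%E) in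
  let Lambdastar := invmx A *m Gamma *m (invmx A)^T in
  posdef Gamma ->
  let K := Num.sqrt (\tr Gamma) / (lambda0 * (1 - gamma)) in
  exists f : nat -> R,
    (fun T : nat => f T * T%:R `^ (1/3)) @ \oo --> 0 /\
    forall T : nat, (0 < T)%N ->
      exists E : set Om, measurable E /\
        E `<=` [set w | (dTV_gauss
                   (Lambdahat (fun t => At_ t w) (fun t => bt_ t w)
                      (avg_iter eta (fun t => At_ t w) (fun t => bt_ t w) T) T)
                   Lambdastar
                 <= (C * (K * (l2norm thetastar + 1) * opnorm (invmx Gamma))
                       * T%:R `^ (- (1/3)) + f T)%:E)%E] /\
        ((1 - 3 * T%:R `^ (- (1/3)) - K / Num.sqrt T%:R)%:E <= Pr E)%E.
Proof.
(* The o-term [f] alone will dominate the distance and the leading term is nonnegative, so any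
   positive constant would do. *)
exists 1; split => // S d gamma alpha eta0 lambda0 P mu r phi dO Om Pr s s' rw.
move=> g01 kP [stP _] _ _ lmin l0 mS indS idS law alpha01 /andP[eta0p _].
move=> eta A ths At_ bt_ G Lam pG K.
have rw01 t w : (0 < t)%N -> 0 <= rw t w <= 1 by move=> t0; case: (law t t0) => _ [].
have [c0 c0p coer] := Amat_coercive g01 kP stP lmin l0; rewrite -/A in coer.
have uA : A \in unitmx.
  apply: posdef_unitmx => x x0; apply: lt_le_trans (coer x).
  by rewrite mulr_gt0// sqn_gt0.
pose e_ t w := At_ t w *m ths - bt_ t w.
have sA i j : sampf s s' rw (fun t w => At_ t w i j).
  exact: (sampf_state _ _ _ (fun x y => At gamma phi x y i j)).
have se i : sampf s s' rw (fun t w => e_ t w i 0).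
  rewrite (_ : (fun t w => _) = (fun t w => (At gamma phi (s t w) (s' t w) *m ths) i 0 +
      rw t w * (- phi (s t w) i 0))).
    apply: sampfD; first exact: (sampf_state _ _ _ (fun x y => (At gamma phi x y *m ths) i 0)).
    apply: sampfM; first exact: sampf_rw.
    exact: (sampf_state _ _ _ (fun x y => - phi x i 0)).
  by apply/funext => t; apply/funext => w; rewrite !mxE mulrN.
have EA i j : Ex Pr (fun w => At_ 1%N w i j) = A i j.
  rewrite (Ex_state mS law (fun x y => At gamma phi x y i j))// /A /Amat summxE.
  by apply: eq_bigr => x _; rewrite summxE; apply: eq_bigr => y _; rewrite [RHS]mxE.
have Ee i : Ex Pr (fun w => e_ 1%N w i 0) = 0.
  rewrite (_ : (fun w => _) = (fun w => (At gamma phi (s 1 w) (s' 1 w) *m ths) i 0 +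
      rw 1%N w * (- phi (s 1%N w) i 0))); last first.
    by apply/funext => w; rewrite !mxE mulrN.
  rewrite ExD; first last.
  - apply: (sampf_bmeas (F := fun t w => rw t w * (- phi (s t w) i 0)) mS rw01) => //.
    apply: sampfM; first exact: sampf_rw.
    exact: (sampf_state _ _ _ (fun x y => - phi x i 0)).
  - apply: (sampf_bmeas (F := fun t w => (At gamma phi (s t w) (s' t w) *m ths) i 0) mS rw01) => //.
    exact: (sampf_state _ _ _ (fun x y => (At gamma phi x y *m ths) i 0)).
  rewrite (Ex_reward mS law (fun x => - phi x i 0))//.
  rewrite (Ex_state mS law (fun x y => (At gamma phi x y *m ths) i 0))//.
  have -> : \sum_x \sum_y mu x * P x y * (At gamma phi x y *m ths) i 0 = (A *m ths) i 0.
    rewrite /A /Amat mulmx_suml summxE; apply: eq_bigr => x _.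
    rewrite mulmx_suml summxE; apply: eq_bigr => y _.
    by rewrite -scalemxAl [RHS]mxE.
  rewrite /ths mulKVmx// /bvec summxE -big_split /= big1// => x _.
  by rewrite [X in X + _]mxE mulrN subrr.
have GE i j : G i j = Ex Pr (fun w => e_ 1%N w i 0 * e_ 1%N w j 0).
  rewrite mxE /Ex; congr (fine 'E_Pr[_]%E); apply/funext => w.
  by rewrite mxE big_ord1 [X in _ * X]mxE.
have tG : G^T = G.
  apply/matrixP => i j; rewrite mxE !GE; congr Ex; apply/funext => w; exact: mulrC.
(* All centred scalars to be averaged form one finite family, so that a single good event controls
   them: entries of the noise, of [At_] and of the outer product of the noise. *)
pose F (k : ('I_d + 'I_d * 'I_d) + 'I_d * 'I_d) : nat -> Om -> R :=
  match k with
  | inl (inl i) => fun t w => e_ t w i 0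
  | inl (inr ij) => fun t w => At_ t w ij.1 ij.2 + - A ij.1 ij.2
  | inr ij => fun t w => e_ t w ij.1 0 * e_ t w ij.2 0 + - G ij.1 ij.2
  end.
have see i j : sampf s s' rw (fun t w => e_ t w i 0 * e_ t w j 0) by exact: sampfM.
have sF k : sampf s s' rw (F k).
  case: k => [[i|[i j]]|[i j]] //=; apply: sampfD => //; exact: sampf_cst.
have F0 k : Ex Pr (F k 1%N) = 0.
  case: k => [[i|[i j]]|[i j]] //=.
    rewrite (ExD Pr (sampf_bmeas mS rw01 (ltn0Sn 0) (sA i j)) (bmeas_cst _ _)) Ex_cst EA.
    exact: subrr.
  rewrite (ExD Pr (sampf_bmeas mS rw01 (ltn0Sn 0) (see i j)) (bmeas_cst _ _)) Ex_cst GE.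
  exact: subrr.
have [crem crem0 hrem] := tdrem_moment mS indS idS rw01 (- ths) sA se EA Ee c0p coer alpha01 eta0p.
have brem := bmeas_tdrem mS rw01 A (- ths) sA se alpha eta0.
have [D D0 hD] := good_event mS indS idS rw01 sF F0 alpha01 brem crem0 hrem.
have [cT cT0 hT] := dTV_gauss_perturb uA tG pG.
have [KA KA0 hKA] := sampf_mxsum_bound rw01 sA.
have [L L0 hL] := sampf_mxsum_bound (m := d) (n := 1) rw01 (M_ := e_)
  (fun i j => eq_rect _ (fun k => sampf s s' rw (fun t w => e_ t w i k)) (se i) _ (esym (ord1 j))).
pose a := mxsum (invmx A); have a0 : 0 <= a by exact: mxsum_ge0.
(* Bounds the averaged error: [a * d] for the mean noise multiplied by [invmx A], [d] for the
   remainder. *)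
pose c1 := (a + 1) * d%:R.
have c10 : 0 <= c1 by rewrite mulr_ge0// addr_ge0.
pose c2 := (d * d)%:R + (2 * L * (KA * c1) + (KA * c1) ^+ 2).
have c20 : 0 <= c2.
  by rewrite /c2 !addr_ge0 ?exprn_even_ge0//; do ![assumption|exact: ler0n|apply: mulr_ge0].
(* The added [1] gives [del <= f T], so for [del > 1] the trivial bound on the distance suffices;
   otherwise [del ^+ 2 <= del] and all errors are linear in [del]. *)
pose f (T : nat) := (cT * c2 + 1) * D * T%:R `^ (- (1 / 2 - alpha / 6)).
exists f; split.
  by apply: powR_neg_cvg0; case/andP: alpha01; lra.
move=> T T0; have [E [mE PE] hE] := hD T T0.
have pos_lam : 0 < lambda0 * (1 - gamma).
  by rewrite mulr_gt0// subr_gt0; case/andP: g01.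
have K0 : 0 <= K by rewrite divr_ge0 ?sqrtr_ge0// ltW.
exists E; split=> //; split; last first.
  (* The good event fails with probability at most [T^(-1/3)], within the allowed
     [3 T^(-1/3) + K / sqrt T]. *)
  apply: le_trans PE; rewrite lee_fin.
  have := powR_ge0 (T%:R : R) (- (1 / 3)).
  have : 0 <= K / Num.sqrt T%:R by rewrite divr_ge0// sqrtr_ge0.
  lra.
move=> w Ew /=; have [hF hR] := hE w Ew.
set del := D * _ in hF hR.
have del0 : 0 <= del by rewrite mulr_ge0// powR_ge0.
have main0 : 0 <= 1 * (K * (l2norm ths + 1) * opnorm (invmx G)) * T%:R `^ (- (1 / 3)).
  rewrite mul1r; do ![assumption|exact: opnorm_ge0|exact: powR_ge0|exact: sqrtr_ge0|
    exact: ler01|apply: addr_ge0|apply: mulr_ge0].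
apply: (@le_trans _ _ (f T)%:E); last by rewrite lee_fin lerDr.
have fE : f T = (cT * c2 + 1) * del by rewrite /f /del mulrA.
have [del1|/ltW del1] := leP del 1; last first.
  apply: le_trans (dTV_gauss_le1 _ _) _; rewrite lee_fin fE.
  apply: le_trans del1 _; by rewrite ler_peMl// lerDr mulr_ge0// ltW.
apply: (@le_trans _ _ (cT * (c2 * del))%:E); last first.
  by rewrite lee_fin fE [leRHS]mulrDl mul1r mulrA lerDl.
set th := avg_iter _ _ _ _.
pose err t := tderr At_ e_ (- ths) alpha eta0 t w.
have thE : th - ths = T%:R^-1 *: \sum_(1 <= t < T.+1) err t.
  rewrite /th /avg_iter.
  have -> : \sum_(1 <= t < T.+1) td_iter eta (fun t => At_ t w) (fun t => bt_ t w) t =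
      \sum_(1 <= t < T.+1) (err t + ths).
    by apply: eq_bigr => t _; exact: td_iter_error.
  rewrite big_split /= scalerDr sumr_const_nat subSS subn0 -[ths *+ T]scaler_nat scalerA.
  by rewrite mulVf ?scale1r ?addrK// pnatr_eq0 -lt0n.
have thle : mxsum (th - ths) <= c1 * del.
  rewrite thE /err (td_decomposition At_ e_ (- ths) alpha eta0p T w uA).
  apply: le_trans (mxsumD _ _) _; rewrite mxsumN /c1 mulrDl mul1r mulrDl.
  apply: lerD.
    rewrite -mulrA; apply: le_trans (mxsum_mul _ _) _; rewrite ler_wpM2l ?mxsum_ge0//.
    rewrite -[d in leRHS]muln1; apply: mxsum_le_const => i j; rewrite (ord1 j) mxE summxE.
    exact: (hF (inl (inl i))).
  rewrite -[d in leRHS]muln1; apply: mxsum_le_const => i j; rewrite (ord1 j).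
  exact: hR.
have avgE (H : nat -> Om -> R) (k : R) :
    T%:R^-1 * \sum_(0 <= t < T) (H t.+1 w + - k) =
    T%:R^-1 * (\sum_(1 <= t < T.+1) H t w) - k.
  rewrite big_split /= sumr_const_nat subn0 mulrDr big_add1 /= -[- k *+ T]mulr_natl [X in _ + X]mulrA.
  by rewrite mulVf ?mul1r// pnatr_eq0 -lt0n.
have cle : (d * d)%:R * del <= c2 * del.
  rewrite ler_wpM2r// lerDl addr_ge0 ?exprn_even_ge0//.
  by do ![assumption|exact: ler0n|apply: mulr_ge0].
apply: hT.
- rewrite /Gammahat linearZ /= linear_sum /=; congr (_ *: _).
  by apply: eq_bigr => t _; rewrite trmx_mul trmxK.
- apply: le_trans cle; apply: mxsum_le_const => i j.
  rewrite /Abar !mxE summxE; have := hF (inl (inr (i, j))); rewrite /=.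
  by rewrite (avgE (fun t w => At_ t w i j)).
- have := @Gammahat_perturb R d (At_ ^~ w) (bt_ ^~ w) (e_ ^~ w) th ths G KA L (c1 * del) T T0.
  move=> /(_ (fun t _ => erefl) (fun t => hKA t w) (fun t => hL t w) thle) /le_trans; apply.
  rewrite /c2 [leRHS]mulrDl; apply: lerD.
    apply: mxsum_le_const => i j.
    rewrite [X in `|X|]mxE [X in `|X + _|]mxE [X in `|_ + X|]mxE summxE.
    have := hF (inr (i, j)); rewrite /= (avgE (fun t w => e_ t w i 0 * e_ t w j 0)).
    congr (`|_ * _ - _| <= _); apply: eq_bigr => t _.
    by rewrite [RHS]mxE big_ord1; congr (_ * _); rewrite [RHS]mxE.
  have x0 : 0 <= (KA * c1) ^+ 2 by rewrite exprn_even_ge0.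
  have -> : (KA * (c1 * del)) ^+ 2 = (KA * c1) ^+ 2 * (del * del) by ring.
  have : (KA * c1) ^+ 2 * (del * del) <= (KA * c1) ^+ 2 * del.
    by rewrite ler_wpM2l// ler_piMl.
  lra.
Qed.
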